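(* Assume (H2) and let $x\in\mathcal C^{p\text{-var}}([a,b],\mathbb R^m)$, $0\le a<b$. For every $y_a\in\mathbb R^d$ the equation $y_t=y_a+\int_a^t[Ay_s+f(y_s)]\,ds+\int_a^t g(y_s)\,dx_s$, $t\in[a,b]$, has a unique solution $y$, and $$\|y\|_{\infty,[a,b]}\le\big[\|y_a\|+M_0N_{[a,b]}(x)\big]e^{\alpha N_{[a,b]}(x)+2L(b-a)},$$ $$\|y\|_{p\text{-var},[a,b]}\le\big[\|y_a\|+M_0N_{[a,b]}(x)\big]e^{\alpha N_{[a,b]}(x)+2L(b-a)}\,N_{[a,b]}(x)^{\frac{p-1}{p}}.$$
   Context: Fix $d,m\ge1$ and $p\in(1,2)$. For a path $x:[a,b]\to\mathbb R^r$: $\|x\|_{\infty,[a,b]}=\sup_{t\in[a,b]}\|x_t\|$ (Euclidean norm); $|||x|||_{p\text{-var},[a,b]}=\big(\sup_{\Pi}\sum_i\|x_{t_{i+1}}-x_{t_i}\|^p\big)^{1/p}$, the supremum over all finite partitions $a=t_0<\dots<t_n=b$; $\|x\|_{p\text{-var},[a,b]}=\|x_a\|+|||x|||_{p\text{-var},[a,b]}$; $\mathcal C^{p\text{-var}}$ denotes continuous paths with finite $p$-variation. Integrals against $dx$ are Young integrals. Here $A\in\mathbb R^{d\times d}$, $|A|$ is its operator norm. (H2): $f:\mathbb R^d\to\mathbb R^d$ and $g:\mathbb R^d\to\mathbb R^{d\times m}$ are globally Lipschitz with constants $C_f$ and $C_g>0$; $g\in C^1$ and $Dg$ is globally Lipschitz.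 Constants: $L=|A|+C_f$, $K=(1-2^{1-2/p})^{-1}$, $\alpha=\log\big(1+\frac1{K+1}\big)$, $M_0=\frac{\|f(0)\|}{L}+\frac{\|g(0)\|}{(K+1)C_g}$. Greedy times: with $\gamma=\frac{1}{2(K+1)C_g}$, set $\tau_0=a$, $\tau_{k+1}=\inf\{t>\tau_k:|||x|||_{p\text{-var},[\tau_k,t]}=\gamma\}\wedge b$ (with $\inf\emptyset=\infty$), and $N_{[a,b]}(x)=\min\{k\ge1:\tau_k=b\}$. *)

(* Defs.v *)
From Stdlib Require Import Reals Lra Lia List Classical ClassicalEpsilon.
Open Scope R_scope.

(** Vectors of R^r are represented as [nat -> R] (only indices < r matter);
    matrices of R^{r x c} as [nat -> nat -> R]. *)
Definition vec := nat -> R.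
Definition mat := nat -> nat -> R.

Fixpoint fsum (n : nat) (f : nat -> R) : R :=
  match n with O => 0 | S k => fsum k f + f k end.

Definition vadd (u v : vec) : vec := fun i => u i + v i.
Definition vsub (u v : vec) : vec := fun i => u i - v i.
Definition vscale (c : R) (u : vec) : vec := fun i => c * u i.
Definition vzero : vec := fun _ => 0.
Definition msub (M N : mat) : mat := fun i j => M i j - N i j.

Definition vnorm (r : nat) (v : vec) : R := sqrt (fsum r (fun i => v i ^ 2)).

Definition matvec (c : nat) (M : mat) (v : vec) : vec :=
  fun i => fsum c (fun j => M i j * v j).

Definition sup (E : R -> Prop) : R := epsilon (inhabits 0) (is_lub E).

Definition is_inf (E : R -> Prop) (m : R) : Prop :=
  (forall x, E x -> m <= x) /\ (forall m', (forall x, E x -> m' <= x) -> m' <= m).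

Definition opnorm (r c : nat) (M : mat) : R :=
  sup (fun s => exists v, vnorm c v <= 1 /\ s = vnorm r (matvec c M v)).

(** Real power with the convention 0^q = 0 (for q > 0). *)
Definition rpow (x q : R) : R := if Rle_dec x 0 then 0 else Rpower x q.

(** Partitions a = t_0 < t_1 < ... < t_n = b, encoded by the list [t_1;...;t_n]. *)
Fixpoint incr_to (t : R) (l : list R) (b : R) : Prop :=
  match l with
  | nil => t = b
  | s :: l' => t < s /\ incr_to s l' b
  end.
Definition partition (a b : R) (l : list R) : Prop := incr_to a l b.

Fixpoint mesh (t : R) (l : list R) : R :=
  match l with nil => 0 | s :: l' => Rmax (s - t) (mesh s l') end.

Fixpoint pv_sum (r : nat) (p : R) (x : R -> vec) (t : R) (l : list R) : R :=
  match l with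
  | nil => 0
  | s :: l' => rpow (vnorm r (vsub (x s) (x t))) p + pv_sum r p x s l'
  end.

Definition pvar_sums (r : nat) (p : R) (x : R -> vec) (a b : R) (s : R) : Prop :=
  exists l, partition a b l /\ s = pv_sum r p x a l.

Definition pvar_semi (r : nat) (p : R) (x : R -> vec) (a b : R) : R :=
  rpow (sup (pvar_sums r p x a b)) (1 / p).

Definition pvar_norm (r : nat) (p : R) (x : R -> vec) (a b : R) : R :=
  vnorm r (x a) + pvar_semi r p x a b.

Definition sup_norm (r : nat) (x : R -> vec) (a b : R) : R :=
  sup (fun s => exists t, a <= t <= b /\ s = vnorm r (x t)).

Definition cont_on (r : nat) (x : R -> vec) (a b : R) : Prop :=
  forall t, a <= t <= b -> forall eps, 0 < eps -> exists delta, 0 < delta /\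
    forall s, a <= s <= b -> Rabs (s - t) < delta -> vnorm r (vsub (x s) (x t)) < eps.

Definition finite_pvar (r : nat) (p : R) (x : R -> vec) (a b : R) : Prop :=
  exists C, forall s, pvar_sums r p x a b s -> s <= C.

Definition Cpvar (r : nat) (p : R) (x : R -> vec) (a b : R) : Prop :=
  cont_on r x a b /\ finite_pvar r p x a b.

(** Left-point Riemann(-Stieltjes) sums with increment term [term t s]
    for the subinterval [t,s]. *)
Fixpoint RS_sum (term : R -> R -> vec) (t : R) (l : list R) : vec :=
  match l with
  | nil => vzero
  | s :: l' => vadd (term t s) (RS_sum term s l')
  end.

(** I is the limit of the Riemann-Stieltjes sums as the mesh tends to 0
    (this is the Riemann integral / the Young integral). *)
Definition is_RS_integral (r : nat) (term : R -> R -> vec) (a b : R) (I : vec) : Prop :=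
  forall eps, 0 < eps -> exists delta, 0 < delta /\
    forall l, partition a b l -> mesh a l < delta ->
      vnorm r (vsub (RS_sum term a l) I) < eps.

Definition lipschitz_v (d : nat) (f : vec -> vec) (C : R) : Prop :=
  forall u v, vnorm d (vsub (f u) (f v)) <= C * vnorm d (vsub u v).
Definition lipschitz_m (d m : nat) (g : vec -> mat) (C : R) : Prop :=
  forall u v, opnorm d m (msub (g u) (g v)) <= C * vnorm d (vsub u v).

(** g is C^1 with globally Lipschitz derivative Dg: Dg u is the (linear)
    Frechet derivative of g at u, and u |-> Dg u is Lipschitz for the
    operator norm L(R^d, R^{d x m}). *)
Definition C1_Dg_lipschitz (d m : nat) (g : vec -> mat) : Prop :=
  exists (Dg : vec -> vec -> mat) (CD : R),
    (forall u h k c i j, (i < d)%nat -> (j < m)%nat ->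
        Dg u (vadd (vscale c h) k) i j = c * Dg u h i j + Dg u k i j) /\
    (forall u eps, 0 < eps -> exists delta, 0 < delta /\ forall h,
        vnorm d h < delta ->
        opnorm d m (msub (msub (g (vadd u h)) (g u)) (Dg u h)) <= eps * vnorm d h) /\
    (forall u v h, opnorm d m (msub (Dg u h) (Dg v h)) <= CD * vnorm d (vsub u v) * vnorm d h).

Definition H2 (d m : nat) (A : mat) (f : vec -> vec) (g : vec -> mat) (Cf Cg : R) : Prop :=
  0 <= Cf /\ 0 < Cg /\ lipschitz_v d f Cf /\ lipschitz_m d m g Cg /\ C1_Dg_lipschitz d m g.

Definition Lc (d : nat) (A : mat) (Cf : R) : R := opnorm d d A + Cf.
Definition Kc (p : R) : R := / (1 - Rpower 2 (1 - 2 / p)).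
Definition alphac (p : R) : R := ln (1 + / (Kc p + 1)).
Definition M0c (d m : nat) (p : R) (A : mat) (f : vec -> vec) (g : vec -> mat) (Cf Cg : R) : R :=
  vnorm d (f vzero) / Lc d A Cf + opnorm d m (g vzero) / ((Kc p + 1) * Cg).

Definition next_time (m : nat) (p gam : R) (x : R -> vec) (b tau : R) : R :=
  let S := fun t => tau < t <= b /\ pvar_semi m p x tau t = gam in
  Rmin b (epsilon (inhabits b) (fun s => ((exists t, S t) /\ is_inf S s) \/
                                          ((~ exists t, S t) /\ s = b))).

Fixpoint greedy_tau (m : nat) (p gam : R) (x : R -> vec) (a b : R) (k : nat) : R :=
  match k with
  | O => a
  | S k' => next_time m p gam x b (greedy_tau m p gam x a b k')
  end.

Definition N_greedy (m : nat) (p Cg : R) (x : R -> vec) (a b : R) : nat :=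
  let gam := / (2 * (Kc p + 1) * Cg) in
  epsilon (inhabits O) (fun n => (1 <= n)%nat /\ greedy_tau m p gam x a b n = b /\
            forall k, (1 <= k < n)%nat -> greedy_tau m p gam x a b k <> b).

Definition is_solution (d m : nat) (p : R) (A : mat) (f : vec -> vec) (g : vec -> mat)
    (x : R -> vec) (a b : R) (ya : vec) (y : R -> vec) : Prop :=
  Cpvar d p y a b /\
  forall t, a <= t <= b -> exists I1 I2,
    is_RS_integral d (fun u s => vscale (s - u) (vadd (matvec d A (y u)) (f (y u)))) a t I1 /\
    is_RS_integral d (fun u s => matvec m (g (y u)) (vsub (x s) (x u))) a t I2 /\
    forall i, (i < d)%nat -> y t i = ya i + I1 i + I2 i.

(* Main.v *)
Require Import Defs.
From Stdlib Require Import Reals Lra Lia Compare_dec Classical ClassicalEpsilon FunctionalExtensionality.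
From Coquelicot Require Import Coquelicot.
Open Scope list_scope.
Open Scope R_scope.

(** Bounds. On an interval [s,t] where the p-variation of x is at most
    gamma = 1/(2(K+1)C_g), the Young-Loeve estimate with constant K absorbs half
    of the p-variation of y, and a Gronwall comparison gives
    |y_s| + |||y||| <= (e^alpha |y_s| + M_0) e^(2L(t-s)).  Iterating over the greedy
    times, with |||.||| subadditive in the interval, gives both bounds.

    Existence and uniqueness. Run time by the clock F(t) = |||x|||^p_[a,t] + (t-a), for
    which x is 1/p-Hoelder and the time variable is 1-Lipschitz, and let Y^n be the Euler
    scheme on the dyadic grid of mesh h in F-time.  Discrete sewing gives Hoelder
    bounds for Y^n and a stability estimate: a path satisfying the Euler recursion up to errors
    O(h^(2/p)) stays within O(h^(2/p-1)) of Y^n.  Applied to Y^(n+1) it shows that Y^n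
    converges, to a path y with |y_t - y_s - (Ay_s + f(y_s))(t-s) - g(y_s)(x_t - x_s)| = O((F(t)-F(s))^(2/p)),
    which is therefore a solution; applied to an arbitrary solution it gives uniqueness. *)

(** A solution is only known to have finite p-variation, so the Young-Loeve bound concerns a product
    of two different variations. Weighted AM-GM merges them into one increasing function whose
    values are halved: two halves carry the factor 2^(1-2/p), the ratio of the geometric series with
    sum K. The threshold satisfies (K+1) C_g gamma = 1/2. Absorbing half of the variation of y
    doubles the other terms, so C_g |y_s| gamma becomes |y_s|/(K+1), whence e^alpha = 1 + 1/(K+1);
    the g(0) part of M_0 arises in the same way, and the rate L becomes 2L. Since g has linear
    growth only, the discrete bounds are local: on clock windows of a fixed length they scale with
    the value at the left end. Each window at most doubles the size, and the number of windows does
    not depend on the mesh. Stability compares g along two schemes. The increments of g(Z) - g(Y)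
    must be controlled by Z - Y and its increments, which a Lipschitz bound on g alone does not
    give; the Lipschitz derivative enters here, through a four-point inequality. *)

(** * Real powers and the pointwise form of Minkowski's inequality *)

Lemma rpow_Rpower (x q : R) : 0 < x -> rpow x q = Rpower x q.
Proof. intros H. unfold rpow. destruct (Rle_dec x 0); lra. Qed.

Lemma rpow_npos (x q : R) : x <= 0 -> rpow x q = 0.
Proof. intros H. unfold rpow. destruct (Rle_dec x 0); lra. Qed.

Lemma rpow_gt0 (x q : R) : 0 < x -> 0 < rpow x q.
Proof. intros H. rewrite rpow_Rpower by easy. apply exp_pos. Qed.

Lemma rpow_ge0 (x q : R) : 0 <= rpow x q.
Proof.
destruct (Rle_lt_dec x 0).
- rewrite rpow_npos; lra.
- left; apply rpow_gt0; lra.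
Qed.

Lemma rpow_lt (x y q : R) : 0 < q -> 0 <= x < y -> rpow x q < rpow y q.
Proof.
intros Hq [[Hx|Hx] Hy].
- rewrite !rpow_Rpower by lra. apply Rlt_Rpower_l; lra.
- subst. rewrite (rpow_npos 0) by lra. apply rpow_gt0; lra.
Qed.

Lemma rpow_le (x y q : R) : 0 < q -> x <= y -> rpow x q <= rpow y q.
Proof.
intros Hq Hxy. destruct (Rle_lt_dec x 0).
- rewrite rpow_npos by easy. apply rpow_ge0.
- destruct Hxy as [Hxy|Hxy].
  + left; apply rpow_lt; lra.
  + subst; lra.
Qed.

Lemma rpow_mul (x y q : R) : 0 <= x -> 0 <= y -> rpow (x * y) q = rpow x q * rpow y q.
Proof.
intros [Hx|Hx] [Hy|Hy].
- rewrite !rpow_Rpower; try easy; [|now apply Rmult_lt_0_compat].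
  now rewrite Rpower_mult_distr.
- subst. rewrite Rmult_0_r, (rpow_npos 0) by lra. ring.
- subst. rewrite Rmult_0_l, (rpow_npos 0) by lra. ring.
- subst. rewrite Rmult_0_l, (rpow_npos 0) by lra. ring.
Qed.

Lemma rpow_rpow (x p q : R) : rpow (rpow x p) q = rpow x (p * q).
Proof.
destruct (Rle_lt_dec x 0).
- rewrite !(rpow_npos x) by easy. apply rpow_npos; lra.
- rewrite (rpow_Rpower (rpow x p)) by now apply rpow_gt0.
  rewrite !(rpow_Rpower x) by easy. apply Rpower_mult.
Qed.

Lemma rpow_add (x p q : R) : rpow x (p + q) = rpow x p * rpow x q.
Proof.
destruct (Rle_lt_dec x 0).
- rewrite !(rpow_npos x) by easy. ring.
- rewrite !(rpow_Rpower x) by easy. apply Rpower_plus.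
Qed.

Lemma rpow_1 (x : R) : 0 <= x -> rpow x 1 = x.
Proof.
intros [H|H].
- rewrite rpow_Rpower by easy. now apply Rpower_1.
- subst. now apply rpow_npos; lra.
Qed.

Lemma rpow_one (q : R) : rpow 1 q = 1.
Proof.
rewrite rpow_Rpower by lra. unfold Rpower. rewrite ln_1, Rmult_0_r. apply exp_0.
Qed.

Lemma rpow_inv_r (x p : R) : 0 < p -> 0 <= x -> rpow (rpow x p) (1 / p) = x.
Proof.
intros. rewrite rpow_rpow. replace (p * (1 / p)) with 1 by (field; lra). now apply rpow_1.
Qed.

Lemma rpow_inv_l (x p : R) : 0 < p -> 0 <= x -> rpow (rpow x (1 / p)) p = x.
Proof.
intros. rewrite rpow_rpow. replace (1 / p * p) with 1 by (field; lra). now apply rpow_1.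
Qed.

Lemma rpow_le_le_inv (x y p : R) : 0 < p -> 0 <= x -> 0 <= y -> x <= rpow y p -> rpow x (1 / p) <= y.
Proof.
intros Hp Hx Hy H. rewrite <- (rpow_inv_r y p) by easy.
apply rpow_le; [|easy]. apply Rdiv_lt_0_compat; lra.
Qed.

Lemma rpow_le_one (x q : R) : 0 < q -> x <= 1 -> rpow x q <= 1.
Proof. intros. rewrite <- (rpow_one q). now apply rpow_le. Qed.

(** For q > 0 the value 0 given to nonpositive arguments agrees with the limit at 0, so continuity
    holds on the whole line. *)
Lemma rpow_continuous (q x : R) : 0 < q -> continuity_pt (fun t => rpow t q) x.
Proof.
intros Hq. destruct (Rtotal_order x 0) as [H|[H|H]].
- intros eps Heps. exists (- x). split; [lra|]. intros y [_ Hy].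
  simpl in *. unfold Rdist in *. apply Rabs_def2 in Hy.
  rewrite !rpow_npos, Rminus_diag, Rabs_R0; lra.
- subst. intros eps Heps. exists (rpow eps (1 / q)). split; [now apply rpow_gt0|].
  intros y [_ Hy]. simpl in *. unfold Rdist in *. rewrite Rminus_0_r in Hy.
  rewrite (rpow_npos 0), Rminus_0_r, Rabs_pos_eq by (try apply rpow_ge0; lra).
  destruct (Rle_lt_dec y 0); [rewrite rpow_npos; lra|].
  rewrite Rabs_pos_eq in Hy by lra.
  rewrite <- (rpow_inv_l eps q) by lra. apply rpow_lt; lra.
- assert (Hc : continuity_pt (fun t => exp (q * ln t)) x).
  { apply (continuity_pt_comp (fun t => q * ln t) exp).
    - apply continuity_pt_mult.
      + apply continuity_pt_const. now intros ? ?.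
      + apply derivable_continuous_pt. exists (/ x). now apply derivable_pt_lim_ln.
    - apply derivable_continuous_pt, derivable_pt_exp. }
  intros eps Heps. destruct (Hc eps Heps) as (al & Hal & Hd).
  exists (Rmin al x). split; [now apply Rmin_glb_lt|].
  intros y [Hy Hy']. simpl in *. unfold Rdist in *.
  assert (Hb := Rmin_r al x). assert (Hb' := Rmin_l al x).
  assert (Hy'' := Hy'). apply Rabs_def2 in Hy''.
  rewrite !rpow_Rpower by lra. apply Hd. split; [easy|lra].
Qed.

(** Weighted AM-GM for s and 1, from ln t <= t - 1 at t = s/w and t = 1/w, with w the arithmetic
    mean; with weights r and 1 - r the right-hand sides cancel. *)
Lemma weighted_amgm (s r : R) : 0 <= s -> 0 < r <= 1 -> rpow s r <= 1 + r * (s - 1).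
Proof.
intros [Hs|Hs] Hr; [|subst; rewrite rpow_npos; lra].
assert (Hw : 0 < 1 + r * (s - 1)) by nra.
set (w := 1 + r * (s - 1)) in *.
assert (Hln : forall t, 0 < t -> ln t <= t - 1).
{ intros t Ht. generalize (exp_ineq1_le (ln t)). rewrite exp_ln by easy. lra. }
assert (H1 := Hln (s / w) (Rdiv_lt_0_compat _ _ Hs Hw)).
assert (H2 := Hln (/ w) (Rinv_0_lt_compat _ Hw)).
unfold Rdiv in H1. rewrite ln_mult in H1 by (try apply Rinv_0_lt_compat; lra).
rewrite ln_Rinv in H1, H2 by lra.
assert (Hc : r * (s * / w - 1) + (1 - r) * (/ w - 1) = 0) by (unfold w in *; field; lra).
assert (r * ln s <= ln w) by nra.
rewrite rpow_Rpower by easy. unfold Rpower. rewrite <- (exp_ln w) by easy.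
destruct H as [H|H]; [left; now apply exp_increasing | rewrite H; lra].
Qed.

(** Bernoulli's inequality, read off from [weighted_amgm] at s = t^p with exponent 1/p. *)
Lemma rpow_tangent (t p : R) : 1 <= p -> 0 <= t -> 1 + p * (t - 1) <= rpow t p.
Proof.
intros Hp Ht.
assert (Hip : 0 < / p <= 1).
{ split; [apply Rinv_0_lt_compat; lra|]. rewrite <- Rinv_1. apply Rinv_le_contravar; lra. }
assert (H := weighted_amgm (rpow t p) (/ p) (rpow_ge0 _ _) Hip).
rewrite <- (Rmult_1_l (/ p)), rpow_inv_r in H by lra.
rewrite Rmult_1_l in H.
apply Rmult_le_compat_l with (r := p) in H; [|lra].
replace (p * (1 + / p * (rpow t p - 1))) with (p + rpow t p - 1) in H by (field; lra).
lra.
Qed.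

(** The tangent bound at the mean w, rescaled through z/w, is averaged over z = u and z = v; the
    linear terms cancel. *)
Lemma rpow_convex (u v lam mu p : R) : 1 <= p -> 0 <= u -> 0 <= v ->
  0 <= lam -> 0 <= mu -> lam + mu = 1 ->
  rpow (lam * u + mu * v) p <= lam * rpow u p + mu * rpow v p.
Proof.
intros Hp Hu Hv Hl Hm Hs.
assert (Hw0 : 0 <= lam * u + mu * v) by nra.
set (w := lam * u + mu * v) in *.
destruct Hw0 as [Hw|Hw].
2: { rewrite <- Hw, rpow_npos by lra. assert (A := rpow_ge0 u p). assert (B := rpow_ge0 v p). nra. }
assert (T : forall z, 0 <= z -> rpow w p * (1 + p * (z / w - 1)) <= rpow z p).
{ intros z Hz. replace (rpow z p) with (rpow w p * rpow (z / w) p).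
  - apply Rmult_le_compat_l; [apply rpow_ge0|]. apply rpow_tangent; [easy|].
    apply Rdiv_le_0_compat; lra.
  - rewrite <- rpow_mul; [|lra|apply Rdiv_le_0_compat; lra]. f_equal. field; lra. }
assert (T1 := T u Hu). assert (T2 := T v Hv).
assert (E : lam * (1 + p * (u / w - 1)) + mu * (1 + p * (v / w - 1)) = 1).
{ replace mu with (1 - lam) by lra.
  replace (lam * (1 + p * (u / w - 1)) + (1 - lam) * (1 + p * (v / w - 1)))
    with (1 - p + p * (lam * u + (1 - lam) * v) / w) by (field; lra).
  replace (lam * u + (1 - lam) * v) with w by (unfold w; replace mu with (1 - lam) by lra; ring).
  field; lra. }
replace (rpow w p) with (lam * (rpow w p * (1 + p * (u / w - 1))) + mu * (rpow w p * (1 + p * (v / w - 1)))).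
- nra.
- transitivity (rpow w p * (lam * (1 + p * (u / w - 1)) + mu * (1 + p * (v / w - 1)))); [ring|].
  rewrite E; ring.
Qed.

(** Convexity at a/A and b/B with weights A/(A+B) and B/(A+B). Summed over a partition, it gives
    Minkowski's inequality when A and B bound the two l^p norms. *)
Lemma rpow_minkowski_pt (a b A B p : R) : 1 <= p -> 0 <= a -> 0 <= b -> 0 < A -> 0 < B ->
  rpow (a + b) p <= rpow (A + B) p * (A / (A + B) * (rpow a p / rpow A p) + B / (A + B) * (rpow b p / rpow B p)).
Proof.
intros Hp Ha Hb HA HB.
assert (D : forall z Z, 0 <= z -> 0 < Z -> rpow z p / rpow Z p = rpow (z / Z) p).
{ intros z Z Hz HZ. assert (HZ' := rpow_gt0 Z p HZ).
  replace (rpow z p) with (rpow (z / Z) p * rpow Z p); [field; lra|].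
  rewrite <- rpow_mul; [|apply Rdiv_le_0_compat; lra|lra]. f_equal; field; lra. }
rewrite !D by easy.
replace (a + b) with ((A + B) * (A / (A + B) * (a / A) + B / (A + B) * (b / B))) by (field; lra).
assert (0 <= a / A) by (apply Rdiv_le_0_compat; lra).
assert (0 <= b / B) by (apply Rdiv_le_0_compat; lra).
assert (0 <= A / (A + B)) by (apply Rdiv_le_0_compat; lra).
assert (0 <= B / (A + B)) by (apply Rdiv_le_0_compat; lra).
rewrite rpow_mul; [|lra|nra].
apply Rmult_le_compat_l; [apply rpow_ge0|].
apply rpow_convex; try easy. field; lra.
Qed.

(** ** Euclidean and operator norms *)

Lemma fsum_ext (n : nat) (u v : nat -> R) :
  (forall i, (i < n)%nat -> u i = v i) -> fsum n u = fsum n v.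
Proof.
induction n as [|n IH]; intros H; simpl; [easy|].
rewrite H by lia. rewrite IH; [easy|]. intros; apply H; lia.
Qed.

Lemma fsum_plus (n : nat) (u v : nat -> R) : fsum n (fun i => u i + v i) = fsum n u + fsum n v.
Proof. induction n as [|n IH]; simpl; [ring|rewrite IH; ring]. Qed.

Lemma fsum_scal (n : nat) (c : R) (u : nat -> R) : fsum n (fun i => c * u i) = c * fsum n u.
Proof. induction n as [|n IH]; simpl; [ring|rewrite IH; ring]. Qed.

Lemma fsum_le (n : nat) (u v : nat -> R) :
  (forall i, (i < n)%nat -> u i <= v i) -> fsum n u <= fsum n v.
Proof.
induction n as [|n IH]; intros H; simpl; [lra|].
apply Rplus_le_compat; [apply IH; intros; apply H; lia|apply H; lia].
Qed.

Lemma fsum_ge0 (n : nat) (u : nat -> R) : (forall i, (i < n)%nat -> 0 <= u i) -> 0 <= fsum n u.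
Proof.
intros H. apply Rle_trans with (fsum n (fun _ => 0 * 0)).
- rewrite fsum_scal. lra.
- apply fsum_le. intros; rewrite Rmult_0_l; auto.
Qed.

Lemma fsum_term_le (n : nat) (u : nat -> R) (j : nat) :
  (forall i, (i < n)%nat -> 0 <= u i) -> (j < n)%nat -> u j <= fsum n u.
Proof.
induction n as [|n IH]; intros H Hj; [lia|]. simpl.
assert (0 <= fsum n u) by (apply fsum_ge0; intros; apply H; lia).
assert (0 <= u n) by (apply H; lia).
destruct (Nat.eq_dec j n) as [->|Hn]; [lra|].
assert (u j <= fsum n u) by (apply IH; [intros; apply H|]; lia). lra.
Qed.

Lemma fsum_const (n : nat) (c : R) : fsum n (fun _ => c) = INR n * c.
Proof. induction n as [|n IH]; [simpl; ring|]. rewrite S_INR. simpl. rewrite IH. ring. Qed.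

Lemma fsum_Rabs (n : nat) (u : nat -> R) : Rabs (fsum n u) <= fsum n (fun i => Rabs (u i)).
Proof.
induction n as [|n IH]; simpl; [rewrite Rabs_R0; lra|].
eapply Rle_trans; [apply Rabs_triang|]. lra.
Qed.

Definition sqsum (n : nat) (v : vec) : R := fsum n (fun i => v i ^ 2).

Lemma sqsum_ge0 (n : nat) (v : vec) : 0 <= sqsum n v.
Proof. apply fsum_ge0. intros; apply pow2_ge_0. Qed.

Lemma cauchy_schwarz (n : nat) (u v : nat -> R) :
  Rabs (fsum n (fun i => u i * v i)) <= vnorm n u * vnorm n v.
Proof.
unfold vnorm. rewrite <- sqrt_mult_alt by apply sqsum_ge0.
rewrite <- sqrt_Rsqr_abs. apply sqrt_le_1_alt. unfold Rsqr.
induction n as [|n IH]; simpl; [lra|].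
fold (sqsum n u) in *. fold (sqsum n v) in *.
assert (HA := sqsum_ge0 n u). assert (HB := sqsum_ge0 n v).
set (A := sqsum n u) in *. set (B := sqsum n v) in *.
change (fsum n (fun i : nat => u i * (u i * 1))) with A.
change (fsum n (fun i : nat => v i * (v i * 1))) with B.
change (fsum n (fun i : nat => u i * (u i * 1))) with A in IH.
change (fsum n (fun i : nat => v i * (v i * 1))) with B in IH.
set (P := fsum n (fun i => u i * v i)) in *.
set (s := u n). set (t := v n).
(* The new cross term: after squaring, P^2 <= A B reduces it to 4 A B s^2 t^2 <= (A t^2 + B
   s^2)^2. *)
assert (Hk : 2 * (P * (s * t)) <= A * t ^ 2 + B * s ^ 2).
{ assert (H0 : 0 <= A * t ^ 2 + B * s ^ 2) by (assert (H1 := pow2_ge_0 t); assert (H2 := pow2_ge_0 s); nra).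
  apply Rsqr_incr_0_var; [|easy]. unfold Rsqr.
  assert (Hd : 0 <= (A * t ^ 2 - B * s ^ 2) ^ 2) by apply pow2_ge_0.
  assert (Hm : P * P * (s * t) ^ 2 <= A * B * (s * t) ^ 2)
    by (apply Rmult_le_compat_r; [apply pow2_ge_0|easy]).
  nra. }
nra.
Qed.

Lemma vnorm_ge0 (n : nat) (v : vec) : 0 <= vnorm n v.
Proof. apply sqrt_pos. Qed.

Lemma vnorm_ext (n : nat) (u v : vec) :
  (forall i, (i < n)%nat -> u i = v i) -> vnorm n u = vnorm n v.
Proof. intros H. unfold vnorm. f_equal. apply fsum_ext. intros i Hi. now rewrite H. Qed.

Lemma vnorm_sqr (n : nat) (v : vec) : vnorm n v * vnorm n v = sqsum n v.
Proof. apply sqrt_sqrt, sqsum_ge0. Qed.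

Lemma vnorm_triangle (n : nat) (u v : vec) : vnorm n (vadd u v) <= vnorm n u + vnorm n v.
Proof.
apply Rsqr_incr_0_var; [|assert (A := vnorm_ge0 n u); assert (B := vnorm_ge0 n v); lra].
unfold Rsqr. rewrite vnorm_sqr.
assert (E : sqsum n (vadd u v) = sqsum n u + sqsum n v + 2 * fsum n (fun i => u i * v i)).
{ unfold sqsum, vadd. rewrite <- fsum_scal, <- !fsum_plus. apply fsum_ext. intros; ring. }
rewrite E. assert (C := Rle_trans _ _ _ (Rle_abs _) (cauchy_schwarz n u v)).
rewrite <- !vnorm_sqr. lra.
Qed.

Lemma vnorm_add_le (n : nat) (w u v : vec) :
  (forall i, (i < n)%nat -> w i = u i + v i) -> vnorm n w <= vnorm n u + vnorm n v.
Proof.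
intros H. rewrite (vnorm_ext n w (vadd u v)) by exact H. apply vnorm_triangle.
Qed.

Lemma vnorm_add3_le (n : nat) (w u v z : vec) :
  (forall i, (i < n)%nat -> w i = u i + v i + z i) -> vnorm n w <= vnorm n u + vnorm n v + vnorm n z.
Proof.
intros H. eapply Rle_trans; [apply (vnorm_add_le n w (vadd u v) z H)|].
assert (T := vnorm_triangle n u v). lra.
Qed.

Lemma vnorm_scale (n : nat) (c : R) (v : vec) : vnorm n (vscale c v) = Rabs c * vnorm n v.
Proof.
unfold vnorm. rewrite <- sqrt_Rsqr_abs, <- sqrt_mult_alt by apply Rle_0_sqr.
f_equal. rewrite <- fsum_scal. apply fsum_ext. intros; unfold vscale, Rsqr; ring.
Qed.

Lemma vnorm_zero (n : nat) (v : vec) : (forall i, (i < n)%nat -> v i = 0) -> vnorm n v = 0.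
Proof.
intros H. rewrite (vnorm_ext n v (vscale 0 vzero)).
- rewrite vnorm_scale, Rabs_R0; ring.
- intros i Hi. unfold vscale. rewrite H by easy. ring.
Qed.

Lemma vnorm_sub_sym (n : nat) (u v : vec) : vnorm n (vsub u v) = vnorm n (vsub v u).
Proof.
rewrite (vnorm_ext n _ (vscale (-1) (vsub v u))).
- rewrite vnorm_scale, Rabs_left; lra.
- intros; unfold vscale, vsub; ring.
Qed.

Lemma vnorm_sub_triangle (n : nat) (u v w : vec) :
  vnorm n (vsub u w) <= vnorm n (vsub u v) + vnorm n (vsub v w).
Proof. apply vnorm_add_le. intros; unfold vsub; ring. Qed.

Lemma vnorm_le_sub (n : nat) (u v : vec) : vnorm n u <= vnorm n v + vnorm n (vsub u v).
Proof. apply vnorm_add_le. intros; unfold vsub; ring. Qed.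

Lemma Rabs_le_vnorm (n : nat) (v : vec) (i : nat) : (i < n)%nat -> Rabs (v i) <= vnorm n v.
Proof.
intros Hi. rewrite <- sqrt_Rsqr_abs. apply sqrt_le_1_alt.
replace (Rsqr (v i)) with (v i ^ 2) by (unfold Rsqr; ring).
apply (fsum_term_le n (fun i => v i ^ 2)); [intros; apply pow2_ge_0|easy].
Qed.

Lemma vnorm_le_fsum (n : nat) (v : vec) : vnorm n v <= fsum n (fun i => Rabs (v i)).
Proof.
assert (H0 : 0 <= fsum n (fun i => Rabs (v i))) by (apply fsum_ge0; intros; apply Rabs_pos).
apply Rsqr_incr_0_var; [|easy]. unfold Rsqr. rewrite vnorm_sqr. clear H0.
unfold sqsum. induction n as [|n IH]; simpl; [lra|].
assert (H0 : 0 <= fsum n (fun i => Rabs (v i))) by (apply fsum_ge0; intros; apply Rabs_pos).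
assert (H1 := Rabs_pos (v n)).
assert (H2 : v n * (v n * 1) = Rabs (v n) * Rabs (v n)).
{ rewrite <- Rabs_mult, Rabs_pos_eq; nra. }
change (fsum n (fun i => v i * (v i * 1))) with (fsum n (fun i => v i ^ 2)). nra.
Qed.

Lemma vnorm_le_coord (n : nat) (v : vec) (c : R) :
  (forall i, (i < n)%nat -> Rabs (v i) <= c) -> vnorm n v <= INR n * c.
Proof.
intros H. eapply Rle_trans; [apply vnorm_le_fsum|]. rewrite <- fsum_const. now apply fsum_le.
Qed.

Lemma vnorm_eq0 (n : nat) (u v : vec) (i : nat) :
  (i < n)%nat -> vnorm n (vsub u v) <= 0 -> u i = v i.
Proof.
intros Hi H. assert (A := Rabs_le_vnorm n (vsub u v) i Hi).
unfold vsub in A. apply Rminus_diag_uniq. apply Rabs_eq_0.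
assert (B := Rabs_pos (u i - v i)). unfold vsub in H. lra.
Qed.

(** [sup] is chosen by [epsilon] and is meaningful only when a least upper bound exists; this is the
    gate through which its properties are obtained. *)
Lemma sup_lub (E : R -> Prop) : bound E -> (exists s, E s) -> is_lub E (sup E).
Proof.
intros Hb Hn. unfold sup. apply epsilon_spec.
destruct (completeness E Hb Hn) as [s Hs]. now exists s.
Qed.

(** A crude majorant: it bounds the set that defines [opnorm] and later turns entrywise estimates
    into operator norm estimates. *)
Definition entry_sum (r c : nat) (M : mat) : R :=
  fsum r (fun i => fsum c (fun j => Rabs (M i j))).

Lemma matvec_entry_bound (r c : nat) (M : mat) (v : vec) :
  vnorm r (matvec c M v) <= entry_sum r c M * vnorm c v.
Proof.
eapply Rle_trans; [apply vnorm_le_fsum|]. unfold entry_sum.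
rewrite Rmult_comm, <- fsum_scal. apply fsum_le. intros i _.
unfold matvec. eapply Rle_trans; [apply fsum_Rabs|].
rewrite <- fsum_scal. apply fsum_le. intros j Hj. rewrite Rabs_mult, Rmult_comm.
apply Rmult_le_compat_r; [apply Rabs_pos|]. now apply Rabs_le_vnorm.
Qed.

Lemma entry_sum_ge0 (r c : nat) (M : mat) : 0 <= entry_sum r c M.
Proof. apply fsum_ge0. intros. apply fsum_ge0. intros. apply Rabs_pos. Qed.

Lemma opnorm_lub (r c : nat) (M : mat) :
  is_lub (fun s => exists v, vnorm c v <= 1 /\ s = vnorm r (matvec c M v)) (opnorm r c M).
Proof.
apply sup_lub.
- exists (entry_sum r c M). intros s (v & Hv & ->).
  eapply Rle_trans; [apply matvec_entry_bound|].
  rewrite <- (Rmult_1_r (entry_sum r c M)) at 2.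
  apply Rmult_le_compat_l; [apply entry_sum_ge0|easy].
- eexists. exists vzero. split; [|reflexivity]. rewrite vnorm_zero; [lra|easy].
Qed.

Lemma opnorm_ge0 (r c : nat) (M : mat) : 0 <= opnorm r c M.
Proof.
destruct (opnorm_lub r c M) as [H _].
eapply Rle_trans; [apply (vnorm_ge0 r (matvec c M vzero))|].
apply H. exists vzero. split; [|easy]. rewrite vnorm_zero; [lra|easy].
Qed.

Lemma matvec_scale (c : nat) (M : mat) (a : R) (v : vec) :
  matvec c M (vscale a v) = vscale a (matvec c M v).
Proof.
extensionality i. unfold matvec, vscale. rewrite <- fsum_scal.
apply fsum_ext. intros; ring.
Qed.

Lemma matvec_opnorm (r c : nat) (M : mat) (v : vec) :
  vnorm r (matvec c M v) <= opnorm r c M * vnorm c v.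
Proof.
destruct (vnorm_ge0 c v) as [Hv|Hv].
- destruct (opnorm_lub r c M) as [H _].
  assert (Hi := Rinv_0_lt_compat _ Hv).
  assert (H1 : vnorm r (matvec c M (vscale (/ vnorm c v) v)) <= opnorm r c M).
  { apply H. exists (vscale (/ vnorm c v) v). split; [|easy].
    rewrite vnorm_scale, Rabs_pos_eq by lra. rewrite Rinv_l; lra. }
  rewrite matvec_scale, vnorm_scale, Rabs_pos_eq in H1 by lra.
  apply Rmult_le_compat_r with (r := vnorm c v) in H1; [|lra].
  replace (/ vnorm c v * vnorm r (matvec c M v) * vnorm c v) with (vnorm r (matvec c M v)) in H1
    by (field; lra). easy.
- rewrite <- Hv, Rmult_0_r. eapply Rle_trans; [apply matvec_entry_bound|]. rewrite <- Hv. lra.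
Qed.

Lemma opnorm_le (r c : nat) (M : mat) (C : R) : 0 <= C ->
  (forall v, vnorm r (matvec c M v) <= C * vnorm c v) -> opnorm r c M <= C.
Proof.
intros HC H. destruct (opnorm_lub r c M) as [_ H']. apply H'.
intros s (v & Hv & ->). eapply Rle_trans; [apply H|]. nra.
Qed.

Lemma opnorm_entry_sum (r c : nat) (M : mat) : opnorm r c M <= entry_sum r c M.
Proof. apply opnorm_le; [apply entry_sum_ge0|apply matvec_entry_bound]. Qed.

Lemma opnorm_le_entries (r c : nat) (M : mat) (C : R) :
  (forall i j, (i < r)%nat -> (j < c)%nat -> Rabs (M i j) <= C) ->
  opnorm r c M <= INR r * (INR c * C).
Proof.
intros H. eapply Rle_trans; [apply opnorm_entry_sum|]. unfold entry_sum.
rewrite <- fsum_const. apply fsum_le. intros. rewrite <- fsum_const. apply fsum_le. auto.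
Qed.

Lemma matvec_msub (c : nat) (M N : mat) (v : vec) (i : nat) :
  matvec c (msub M N) v i = matvec c M v i - matvec c N v i.
Proof.
unfold matvec, msub. replace (fsum c (fun j => M i j * v j) - fsum c (fun j => N i j * v j))
  with (fsum c (fun j => M i j * v j) + (-1) * fsum c (fun j => N i j * v j)) by ring.
rewrite <- fsum_scal, <- fsum_plus. apply fsum_ext. intros; ring.
Qed.

Lemma matvec_vsub (c : nat) (M : mat) (u v : vec) (i : nat) :
  matvec c M (vsub u v) i = matvec c M u i - matvec c M v i.
Proof.
unfold matvec, vsub. replace (fsum c (fun j => M i j * u j) - fsum c (fun j => M i j * v j))
  with (fsum c (fun j => M i j * u j) + (-1) * fsum c (fun j => M i j * v j)) by ring.
rewrite <- fsum_scal, <- fsum_plus. apply fsum_ext. intros; ring.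
Qed.

Lemma opnorm_le_msub (r c : nat) (M N : mat) : opnorm r c M <= opnorm r c N + opnorm r c (msub M N).
Proof.
assert (H1 := opnorm_ge0 r c N). assert (H2 := opnorm_ge0 r c (msub M N)).
apply opnorm_le; [lra|]. intros v.
eapply Rle_trans; [apply (vnorm_add_le r _ (matvec c N v) (matvec c (msub M N) v))|].
- intros. rewrite matvec_msub. ring.
- assert (A := matvec_opnorm r c N v). assert (B := matvec_opnorm r c (msub M N) v). lra.
Qed.

Lemma Rabs_le_opnorm (r c : nat) (M : mat) (i j : nat) :
  (i < r)%nat -> (j < c)%nat -> Rabs (M i j) <= opnorm r c M.
Proof.
(* [e] is the j-th basis vector, whose image under M has i-th coordinate M i j. *)
intros Hi Hj. set (e := fun k => if Nat.eq_dec k j then 1 else 0).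
assert (He : forall n (w : nat -> R), fsum n (fun k => w k * e k) = if lt_dec j n then w j else 0).
{ intros n w. induction n as [|n IH]; simpl; [destruct (lt_dec j 0); [lia|easy]|].
  rewrite IH. unfold e. destruct (lt_dec j n), (lt_dec j (S n)), (Nat.eq_dec n j); subst; try lia; ring. }
assert (Hn : vnorm c e = 1).
{ unfold vnorm. rewrite <- sqrt_1. f_equal.
  rewrite (fsum_ext c _ (fun k => e k * e k)) by (intros; ring).
  rewrite (He c e). destruct (lt_dec j c); [|lia]. unfold e. destruct (Nat.eq_dec j j); [easy|lia]. }
assert (Hm : matvec c M e i = M i j).
{ unfold matvec. rewrite (He c (fun k => M i k)). destruct (lt_dec j c); [easy|lia]. }
rewrite <- Hm. eapply Rle_trans; [now apply (Rabs_le_vnorm r)|].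
eapply Rle_trans; [apply matvec_opnorm|]. rewrite Hn. lra.
Qed.

(** ** Sums over partitions *)

Fixpoint lsum (phi : R -> R -> R) (t : R) (l : list R) : R :=
  match l with
  | nil => 0
  | s :: l' => phi t s + lsum phi s l'
  end.

Lemma incr_to_le (s t : R) (l : list R) : incr_to s l t -> s <= t.
Proof.
revert s; induction l as [|u l IH]; simpl; intros s H; [lra|].
destruct H as [H1 H2]. apply IH in H2. lra.
Qed.

Lemma incr_to_app (s u t : R) (l l' : list R) :
  incr_to s l u -> incr_to u l' t -> incr_to s (l ++ l') t.
Proof.
revert s; induction l as [|v l IH]; simpl; intros s H H'; [now subst|].
destruct H; auto.
Qed.

Lemma incr_to_exists (s t : R) : s <= t -> exists l, incr_to s l t.
Proof.
intros [H|H]; [exists (t :: nil); now split|exists nil; easy].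
Qed.

(** Isolates the last interval, whose right end is moved in the proof of left continuity of the
    variation. *)
Lemma incr_to_last (s t : R) (l : list R) : incr_to s l t -> s < t ->
  exists l0 w, l = l0 ++ t :: nil /\ incr_to s l0 w /\ w < t.
Proof.
revert s; induction l as [|u l IH]; simpl; intros s H Hst; [lra|].
destruct H as [H1 H2].
destruct (incr_to_le _ _ _ H2) as [Hut|Hut].
- destruct (IH u H2 Hut) as (l0 & w & -> & Hl & Hw).
  exists (u :: l0), w. repeat split; auto.
- subst. exists nil, s. repeat split; try easy. destruct l as [|v l]; [easy|].
  destruct H2 as [H2 H3]. apply incr_to_le in H3. lra.
Qed.

Lemma lsum_app (phi : R -> R -> R) (s u : R) (l l' : list R) :
  incr_to s l u -> lsum phi s (l ++ l') = lsum phi s l + lsum phi u l'.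
Proof.
revert s; induction l as [|v l IH]; simpl; intros s H; [subst; ring|].
destruct H as [_ H]. rewrite IH by easy. ring.
Qed.

Lemma lsum_le (phi psi : R -> R -> R) (s t : R) (l : list R) :
  (forall u v, s <= u < v -> v <= t -> phi u v <= psi u v) ->
  incr_to s l t -> lsum phi s l <= lsum psi s l.
Proof.
revert s; induction l as [|v l IH]; simpl; intros s H Hl; [lra|].
destruct Hl as [Hs Hl]. assert (Hv := incr_to_le _ _ _ Hl).
apply Rplus_le_compat; [apply H; lra|].
apply IH; [|easy]. intros; apply H; lra.
Qed.

Lemma lsum_superadd (om : R -> R -> R) (s t : R) (l : list R) :
  (forall u, s <= u <= t -> 0 <= om u u) ->
  (forall u v w, s <= u <= v -> v <= w <= t -> om u v + om v w <= om u w) ->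
  incr_to s l t -> lsum om s l <= om s t.
Proof.
revert s; induction l as [|v l IH]; simpl; intros s H0 H Hl; [subst; apply H0; lra|].
destruct Hl as [Hs Hl]. assert (Hv := incr_to_le _ _ _ Hl).
assert (lsum om v l <= om v t).
{ apply IH; [| |easy]; intros; [apply H0|apply H]; lra. }
assert (om s v + om v t <= om s t) by (apply H; lra). lra.
Qed.

Lemma lsum_ge0 (phi : R -> R -> R) (s : R) (l : list R) :
  (forall u v, 0 <= phi u v) -> 0 <= lsum phi s l.
Proof.
intros H; revert s; induction l as [|v l IH]; simpl; intros s; [lra|].
specialize (H s v). specialize (IH v). lra.
Qed.

Lemma lsum_lin (a b : R) (phi psi : R -> R -> R) (s : R) (l : list R) :
  lsum (fun u v => a * phi u v + b * psi u v) s l = a * lsum phi s l + b * lsum psi s l.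
Proof.
revert s; induction l as [|v l IH]; simpl; intros s; [ring|]. rewrite IH. ring.
Qed.

(** ** Continuous functions on a segment *)

Definition cont_in (f : R -> R) (s t : R) : Prop :=
  forall t0, s <= t0 <= t -> forall eps, 0 < eps -> exists del, 0 < del /\
    forall u, s <= u <= t -> Rabs (u - t0) < del -> Rabs (f u - f t0) < eps.

(** Freezing the argument at the end points extends a function continuous on [s,t] to one continuous
    on the line, to which the Heine and intermediate value theorems apply. *)
Definition clamp (s t u : R) : R := Rmax s (Rmin t u).

Lemma clamp_in (s t u : R) : s <= t -> s <= clamp s t u <= t.
Proof.
intros H. unfold clamp. split; [apply Rmax_l|]. apply Rmax_lub; [easy|apply Rmin_l].
Qed.

Lemma clamp_id (s t u : R) : s <= u <= t -> clamp s t u = u.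
Proof. intros H. unfold clamp. rewrite Rmin_right, Rmax_right; lra. Qed.

Lemma clamp_lip (s t u v : R) : Rabs (clamp s t u - clamp s t v) <= Rabs (u - v).
Proof.
unfold clamp, Rmax, Rmin, Rabs.
destruct (Rle_dec t u), (Rle_dec t v);
repeat match goal with |- context [Rle_dec ?a ?b] => destruct (Rle_dec a b) end;
repeat match goal with |- context [Rcase_abs ?a] => destruct (Rcase_abs a) end; lra.
Qed.

Lemma cont_in_clamp (f : R -> R) (s t : R) : s <= t -> cont_in f s t ->
  continuity (fun u => f (clamp s t u)).
Proof.
intros Hst Hf x eps Heps.
destruct (Hf (clamp s t x) (clamp_in s t x Hst) eps Heps) as (del & Hd & H).
exists del. split; [easy|]. intros y [_ Hy]. simpl in *. unfold Rdist in *.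
apply H; [now apply clamp_in|]. eapply Rle_lt_trans; [apply clamp_lip|easy].
Qed.

Lemma cont_in_unif (f : R -> R) (s t : R) : s <= t -> cont_in f s t ->
  forall eps, 0 < eps -> exists del, 0 < del /\
    forall u v, s <= u <= t -> s <= v <= t -> Rabs (u - v) < del -> Rabs (f u - f v) < eps.
Proof.
intros Hst Hf eps Heps.
assert (Hc := cont_in_clamp f s t Hst Hf).
destruct (@Heine_cor2 (fun u => f (clamp s t u)) s t (fun u _ => Hc u) (mkposreal eps Heps)) as [del Hd].
exists del. split; [apply cond_pos|]. intros u v Hu Hv Huv.
specialize (Hd u v Hu Hv Huv). simpl in Hd. now rewrite !clamp_id in Hd by easy.
Qed.

Lemma cont_in_ivt (f : R -> R) (s t c : R) : s <= t -> cont_in f s t ->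
  f s <= c <= f t -> exists u, s <= u <= t /\ f u = c.
Proof.
intros Hst Hf Hc.
destruct (IVT_gen (fun u => f (clamp s t u)) s t c (cont_in_clamp f s t Hst Hf)) as (u & Hu & Hfu).
- rewrite !clamp_id by lra. rewrite Rmin_left, Rmax_right by lra. easy.
- rewrite Rmin_left, Rmax_right in Hu by easy.
  exists u. split; [easy|]. now rewrite clamp_id in Hfu.
Qed.

Lemma cont_in_sub (f : R -> R) (s t s' t' : R) :
  cont_in f s t -> s <= s' -> t' <= t -> cont_in f s' t'.
Proof.
intros H Hs Ht t0 H0 eps Heps. destruct (H t0 ltac:(lra) eps Heps) as (del & Hd & Hd').
exists del. split; [easy|]. intros; apply Hd'; lra.
Qed.

Lemma cont_in_continuity (f : R -> R) (s t : R) : continuity f -> cont_in f s t.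
Proof.
intros Hf t0 _ eps Heps. destruct (Hf t0 eps Heps) as (al & Hal & H).
exists al. split; [easy|]. intros u _ Hu.
destruct (Req_dec u t0) as [->|Hn].
- now rewrite Rminus_diag, Rabs_R0.
- apply H. split; [|easy]. split; [exact I|]. now apply not_eq_sym.
Qed.

Lemma cont_in_lin (f1 f2 : R -> R) (c1 c2 s t : R) :
  cont_in f1 s t -> cont_in f2 s t -> cont_in (fun u => c1 * f1 u + c2 * f2 u) s t.
Proof.
intros H1 H2 t0 H0 eps Heps.
set (M := 1 + Rabs c1 + Rabs c2).
assert (HM : 0 < M) by (unfold M; assert (A := Rabs_pos c1); assert (B := Rabs_pos c2); lra).
assert (He : 0 < eps / M) by now apply Rdiv_lt_0_compat.
destruct (H1 t0 H0 _ He) as (d1 & Hd1 & K1).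
destruct (H2 t0 H0 _ He) as (d2 & Hd2 & K2).
exists (Rmin d1 d2). split; [now apply Rmin_glb_lt|]. intros u Hu Hut.
assert (G1 := K1 u Hu (Rlt_le_trans _ _ _ Hut (Rmin_l _ _))).
assert (G2 := K2 u Hu (Rlt_le_trans _ _ _ Hut (Rmin_r _ _))).
replace (c1 * f1 u + c2 * f2 u - (c1 * f1 t0 + c2 * f2 t0))
  with (c1 * (f1 u - f1 t0) + c2 * (f2 u - f2 t0)) by ring.
eapply Rle_lt_trans; [apply Rabs_triang|]. rewrite !Rabs_mult.
assert (A := Rabs_pos c1). assert (B := Rabs_pos c2).
assert (E : eps = M * (eps / M)) by (field; lra).
rewrite E. unfold M at 1. nra.
Qed.

Lemma cont_in_comp_rpow (f : R -> R) (s t q : R) : 0 < q ->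
  cont_in f s t -> cont_in (fun u => rpow (f u) q) s t.
Proof.
intros Hq Hf t0 H0 eps Heps.
destruct (rpow_continuous q (f t0) Hq eps Heps) as (al & Hal & H).
destruct (Hf t0 H0 al Hal) as (del & Hd & Hd').
exists del. split; [easy|]. intros u Hu Hut.
destruct (Req_dec (f u) (f t0)) as [->|Hn].
- now rewrite Rminus_diag, Rabs_R0.
- apply H. split; [|now apply Hd']. split; [exact I|]. now apply not_eq_sym.
Qed.

(** ** The p-variation of a continuous path *)

Section Variation.

Context (r : nat) (p : R) (x : R -> vec) (a b : R) (hp : 1 <= p) (hx : Cpvar r p x a b).

Definition inc (r : nat) (x : R -> vec) (u v : R) : R := vnorm r (vsub (x v) (x u)).

(** The p-th power, rather than the seminorm, is superadditive in the interval, that is, a control;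
    the seminorm itself is subadditive. *)
Definition pvar_pow (r : nat) (p : R) (x : R -> vec) (s t : R) : R := sup (pvar_sums r p x s t).

Lemma inc_sym (u v : R) : inc r x u v = inc r x v u.
Proof. apply vnorm_sub_sym. Qed.

Lemma inc_ge0 (u v : R) : 0 <= inc r x u v.
Proof. apply vnorm_ge0. Qed.

Lemma inc_refl (u : R) : inc r x u u = 0.
Proof. apply vnorm_zero. intros; unfold vsub; ring. Qed.

Lemma inc_triangle (u v w : R) : inc r x u w <= inc r x u v + inc r x v w.
Proof. unfold inc. rewrite Rplus_comm. apply vnorm_sub_triangle. Qed.

Let ip (u v : R) : R := rpow (inc r x u v) p.

Lemma pv_sum_lsum (t : R) (l : list R) :
  pv_sum r p x t l = lsum (fun u v => rpow (inc r x u v) p) t l.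
Proof. revert t; induction l as [|s l IH]; simpl; intros t; [easy|]. now rewrite IH. Qed.

Local Notation V := (pvar_pow r p x).

(** A partition of [s,t] extends to one of [a,b] by adding nonnegative terms, so the single bound in
    [finite_pvar] serves every subinterval. *)
Lemma pvar_pow_lub (s t : R) : a <= s <= t -> t <= b -> is_lub (pvar_sums r p x s t) (V s t).
Proof.
intros Hs Ht. apply sup_lub.
- destruct hx as [_ [C HC]]. exists C. intros z (l & Hl & ->).
  destruct (incr_to_exists a s ltac:(lra)) as [l0 Hl0].
  destruct (incr_to_exists t b ltac:(lra)) as [l1 Hl1].
  assert (HP : partition a b (l0 ++ (l ++ l1))).
  { apply incr_to_app with s; [easy|]. now apply incr_to_app with t. }
  apply Rle_trans with (pv_sum r p x a (l0 ++ (l ++ l1))); [|apply HC; eexists; split; [exact HP|easy]].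
  rewrite !pv_sum_lsum, (lsum_app _ a s) by easy. rewrite (lsum_app _ s t) by easy.
  assert (H : forall u l, 0 <= lsum (fun u v => rpow (inc r x u v) p) u l).
  { intros. apply lsum_ge0. intros; apply rpow_ge0. }
  assert (A := H a l0). assert (B := H t l1). lra.
- destruct (incr_to_exists s t ltac:(lra)) as [l Hl]. eexists. exists l. now split.
Qed.

Lemma pvar_pow_upper (s t : R) (l : list R) : a <= s <= t -> t <= b -> incr_to s l t ->
  lsum ip s l <= V s t.
Proof.
intros Hs Ht Hl. apply (pvar_pow_lub s t Hs Ht). exists l. split; [easy|]. now rewrite pv_sum_lsum.
Qed.

Lemma pvar_pow_least (s t C : R) : a <= s <= t -> t <= b ->
  (forall l, incr_to s l t -> lsum ip s l <= C) -> V s t <= C.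
Proof.
intros Hs Ht H. apply (pvar_pow_lub s t Hs Ht). intros z (l & Hl & ->).
rewrite pv_sum_lsum. now apply H.
Qed.

Lemma pvar_pow_approx (s t eps : R) : a <= s <= t -> t <= b -> 0 < eps ->
  exists l, incr_to s l t /\ V s t - eps < lsum ip s l.
Proof.
intros Hs Ht He. apply NNPP. intros Hn.
assert (V s t <= V s t - eps); [|lra].
apply pvar_pow_least; [easy|easy|]. intros l Hl. apply Rnot_lt_le. intros Hlt.
apply Hn. now exists l.
Qed.

Lemma ip_ge0 (u v : R) : 0 <= ip u v.
Proof. apply rpow_ge0. Qed.

Lemma pvar_pow_ge0 (s t : R) : a <= s <= t -> t <= b -> 0 <= V s t.
Proof.
intros Hs Ht. destruct (incr_to_exists s t ltac:(lra)) as [l Hl].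
eapply Rle_trans; [|apply (pvar_pow_upper s t l); easy]. apply lsum_ge0, ip_ge0.
Qed.

Lemma pvar_pow_refl (s : R) : a <= s <= b -> V s s = 0.
Proof.
intros Hs. apply Rle_antisym; [|apply pvar_pow_ge0; lra].
apply pvar_pow_least; [lra|lra|]. intros [|u l] Hl; simpl; [lra|].
destruct Hl as [H1 H2]. apply incr_to_le in H2. lra.
Qed.

Lemma pvar_pow_superadd (s u t : R) : a <= s <= u -> u <= t <= b -> V s u + V u t <= V s t.
Proof.
intros Hs Ht. apply Rle_plus_epsilon. intros eps He.
destruct (pvar_pow_approx s u (eps / 2)) as (l1 & Hl1 & H1); try lra.
destruct (pvar_pow_approx u t (eps / 2)) as (l2 & Hl2 & H2); try lra.
assert (H := pvar_pow_upper s t (l1 ++ l2) ltac:(lra) ltac:(lra) (incr_to_app _ _ _ _ _ Hl1 Hl2)).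
rewrite (lsum_app _ s u) in H by easy. lra.
Qed.

Lemma pvar_pow_mono (s s' t' t : R) : a <= s <= s' -> s' <= t' <= t -> t <= b -> V s' t' <= V s t.
Proof.
intros Hs Ht Hb.
assert (A := pvar_pow_superadd s s' t ltac:(lra) ltac:(lra)).
assert (B := pvar_pow_superadd s' t' t ltac:(lra) ltac:(lra)).
assert (C := pvar_pow_ge0 s s' ltac:(lra) ltac:(lra)).
assert (D := pvar_pow_ge0 t' t ltac:(lra) ltac:(lra)). lra.
Qed.

Lemma inc_pow_le (s t : R) : a <= s <= t -> t <= b -> rpow (inc r x s t) p <= V s t.
Proof.
intros Hs Ht. destruct (proj2 Hs) as [Hst|Hst].
- assert (H := pvar_pow_upper s t (t :: nil) Hs Ht (conj Hst eq_refl)). simpl in H.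
  unfold ip in H. lra.
- subst. rewrite inc_refl, rpow_npos by lra. apply pvar_pow_ge0; lra.
Qed.

Lemma inc_le_semi (s t : R) : a <= s <= t -> t <= b -> inc r x s t <= pvar_semi r p x s t.
Proof.
intros Hs Ht. rewrite <- (rpow_inv_r (inc r x s t) p) by (try apply inc_ge0; lra).
apply rpow_le; [apply Rdiv_lt_0_compat; lra|]. now apply inc_pow_le.
Qed.

Lemma semi_pow (s t : R) : a <= s <= t -> t <= b -> rpow (pvar_semi r p x s t) p = V s t.
Proof. intros. apply rpow_inv_l; [lra|now apply pvar_pow_ge0]. Qed.

Lemma semi_ge0 (s t : R) : 0 <= pvar_semi r p x s t.
Proof. apply rpow_ge0. Qed.

Lemma semi_mono (s s' t' t : R) : a <= s <= s' -> s' <= t' <= t -> t <= b ->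
  pvar_semi r p x s' t' <= pvar_semi r p x s t.
Proof. intros. apply rpow_le; [apply Rdiv_lt_0_compat; lra|]. now apply pvar_pow_mono. Qed.

Lemma semi_refl (s : R) : a <= s <= b -> pvar_semi r p x s s = 0.
Proof. intros. unfold pvar_semi. fold (V s s). rewrite pvar_pow_refl by easy. apply rpow_npos; lra. Qed.

(** Summing [rpow_minkowski_pt] over a partition. The increments are split into two parts, each with
    its own l^p bound. *)
Lemma semi_minkowski (s t A B : R) (al be : R -> R -> R) : a <= s <= t -> t <= b ->
  0 <= A -> 0 <= B ->
  (forall u v, 0 <= al u v) -> (forall u v, 0 <= be u v) ->
  (forall u v, s <= u < v -> v <= t -> inc r x u v <= al u v + be u v) ->
  (forall l, incr_to s l t -> lsum (fun u v => rpow (al u v) p) s l <= rpow A p) ->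
  (forall l, incr_to s l t -> lsum (fun u v => rpow (be u v) p) s l <= rpow B p) ->
  pvar_semi r p x s t <= A + B.
Proof.
intros Hs Ht HA HB Hal Hbe Hinc SA SB.
apply Rle_plus_epsilon. intros eps He.
(* Both bounds are enlarged by eps/2 because the pointwise inequality divides by them. *)
replace (A + B + eps) with ((A + eps / 2) + (B + eps / 2)) by field.
assert (HA' : 0 < A + eps / 2) by lra. assert (HB' : 0 < B + eps / 2) by lra.
assert (MA : rpow A p <= rpow (A + eps / 2) p) by (apply rpow_le; lra).
assert (MB : rpow B p <= rpow (B + eps / 2) p) by (apply rpow_le; lra).
set (A' := A + eps / 2) in *. set (B' := B + eps / 2) in *.
apply rpow_le_le_inv; [lra|now apply pvar_pow_ge0|lra|].
apply pvar_pow_least; [easy|easy|]. intros l Hl.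
assert (PA := rpow_gt0 A' p HA'). assert (PB := rpow_gt0 B' p HB').
set (ca := rpow (A' + B') p * (A' / (A' + B') / rpow A' p)).
set (cb := rpow (A' + B') p * (B' / (A' + B') / rpow B' p)).
apply Rle_trans with (lsum (fun u v => ca * rpow (al u v) p + cb * rpow (be u v) p) s l).
- apply (lsum_le _ _ s t); [|easy]. intros u v Hu Hv.
  eapply Rle_trans; [apply rpow_le with (y := al u v + be u v); [lra|now apply Hinc]|].
  eapply Rle_trans; [apply (rpow_minkowski_pt _ _ A' B'); auto|].
  right. unfold ca, cb. field. repeat split; lra.
- rewrite lsum_lin. specialize (SA l Hl). specialize (SB l Hl).
  assert (Hca : 0 <= ca).
  { unfold ca. apply Rmult_le_pos; [apply rpow_ge0|]. repeat apply Rdiv_le_0_compat; lra. }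
  assert (Hcb : 0 <= cb).
  { unfold cb. apply Rmult_le_pos; [apply rpow_ge0|]. repeat apply Rdiv_le_0_compat; lra. }
  replace (rpow (A' + B') p) with (ca * rpow A' p + cb * rpow B' p).
  + apply Rplus_le_compat; apply Rmult_le_compat_l; lra.
  + unfold ca, cb. field. repeat split; lra.
Qed.

Lemma semi_subadd (s u t : R) : a <= s <= u -> u <= t <= b ->
  pvar_semi r p x s t <= pvar_semi r p x s u + pvar_semi r p x u t.
Proof.
intros Hs Ht.
(* x_w - x_v is the sum of the increments of x stopped at u and of x started at u. *)
set (al := fun v w => pvar_semi r p x (Rmin v u) (Rmin w u)).
set (be := fun v w => pvar_semi r p x (Rmax v u) (Rmax w u)).
assert (Hmin : forall v w, v <= w -> Rmin v u <= Rmin w u) by (intros; now apply Rle_min_compat_r).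
assert (Hmax : forall v w, v <= w -> Rmax v u <= Rmax w u) by (intros; now apply Rle_max_compat_r).
assert (Hmin' : forall v, s <= v <= t -> s <= Rmin v u <= t).
{ intros v Hv. split; [apply Rmin_glb; lra|]. eapply Rle_trans; [apply Rmin_l|lra]. }
assert (Hmax' : forall v, s <= v <= t -> s <= Rmax v u <= t).
{ intros v Hv. split; [|apply Rmax_lub; lra]. eapply Rle_trans; [|apply Rmax_l]; lra. }
apply semi_minkowski with al be; try lra; try (intros; apply semi_ge0).
- intros v w Hv Hw.
  assert (Hvt := Hmin' v ltac:(lra)). assert (Hwt := Hmin' w ltac:(lra)).
  assert (Hvt' := Hmax' v ltac:(lra)). assert (Hwt' := Hmax' w ltac:(lra)).
  apply Rle_trans with (inc r x (Rmin v u) (Rmin w u) + inc r x (Rmax v u) (Rmax w u)).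
  + apply vnorm_add_le. intros i _. unfold vsub, Rmin, Rmax.
    destruct (Rle_dec v u), (Rle_dec w u); try lra.
  + apply Rplus_le_compat; apply inc_le_semi; try lra.
    * split; [lra|apply Hmin; lra].
    * split; [lra|apply Hmax; lra].
- intros l Hl. rewrite semi_pow by lra.
  replace (V s u) with (V (Rmin s u) (Rmin t u)) by (rewrite Rmin_left, Rmin_right; lra || easy).
  eapply Rle_trans; [|apply (lsum_superadd (fun v w => V (Rmin v u) (Rmin w u)) s t l); [| |easy]].
  + apply (lsum_le _ _ s t); [|easy]. intros v w Hv Hw. unfold al. rewrite semi_pow; [lra| |].
    * split; [apply Rle_trans with s; [lra|now apply Hmin'; lra]|apply Hmin; lra].
    * eapply Rle_trans; [apply Hmin'|]; lra.
  + intros v Hv. rewrite pvar_pow_refl; [lra|]. assert (A := Hmin' v Hv). lra.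
  + intros v w z Hv Hz. apply pvar_pow_superadd.
    * split; [assert (A := Hmin' v ltac:(lra)); lra|apply Hmin; lra].
    * split; [apply Hmin; lra|]. assert (A := Hmin' z ltac:(lra)). lra.
- intros l Hl. rewrite semi_pow by lra.
  replace (V u t) with (V (Rmax s u) (Rmax t u)) by (rewrite Rmax_right, Rmax_left; lra || easy).
  eapply Rle_trans; [|apply (lsum_superadd (fun v w => V (Rmax v u) (Rmax w u)) s t l); [| |easy]].
  + apply (lsum_le _ _ s t); [|easy]. intros v w Hv Hw. unfold be. rewrite semi_pow; [lra| |].
    * split; [assert (A := Hmax' v ltac:(lra)); lra|apply Hmax; lra].
    * assert (A := Hmax' w ltac:(lra)); lra.
  + intros v Hv. rewrite pvar_pow_refl; [lra|]. assert (A := Hmax' v Hv). lra.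
  + intros v w z Hv Hz. apply pvar_pow_superadd.
    * split; [assert (A := Hmax' v ltac:(lra)); lra|apply Hmax; lra].
    * split; [apply Hmax; lra|]. assert (A := Hmax' z ltac:(lra)). lra.
Qed.

Lemma inc_pow_continuous (w t eps : R) : a <= t <= b -> 0 < eps -> exists del, 0 < del /\
  forall u, a <= u <= b -> Rabs (u - t) < del -> Rabs (ip w u - ip w t) < eps.
Proof.
intros Ht He.
assert (Hc : cont_in (fun u => inc r x w u) a b).
{ intros t0 H0 e0 He0. destruct hx as [Hc _]. destruct (Hc t0 H0 e0 He0) as (del & Hd & H).
  exists del. split; [easy|]. intros u Hu Hut. specialize (H u Hu Hut).
  assert (A := inc_triangle w t0 u). assert (B := inc_triangle w u t0).
  rewrite (inc_sym u t0) in B. fold (inc r x t0 u) in H. apply Rabs_def1; lra. }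
exact (cont_in_comp_rpow _ a b p ltac:(lra) Hc t Ht eps He).
Qed.

(** In a near-optimal partition of [s,t] the last point t is moved to u; only the last term changes,
    and it depends continuously on u. *)
Lemma pvar_pow_left (s t eps : R) : a <= s < t -> t <= b -> 0 < eps -> exists del, 0 < del /\
  forall u, s <= u <= t -> t - u < del -> V s t - V s u < eps.
Proof.
intros Hs Ht He.
destruct (pvar_pow_approx s t (eps / 2)) as (l & Hl & H); try lra.
destruct (incr_to_last s t l Hl ltac:(lra)) as (l0 & w & -> & Hl0 & Hw).
assert (Hsw := incr_to_le _ _ _ Hl0).
destruct (inc_pow_continuous w t (eps / 2)) as (del & Hd & Hc); try lra.
exists (Rmin del (t - w)). split; [apply Rmin_glb_lt; lra|]. intros u Hu Hut.
assert (A := Rmin_l del (t - w)). assert (B := Rmin_r del (t - w)).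
assert (Hu' : Rabs (ip w u - ip w t) < eps / 2) by (apply Hc; [lra|apply Rabs_def1; lra]).
apply Rabs_def2 in Hu'.
assert (Hup := pvar_pow_upper s u (l0 ++ u :: nil) ltac:(lra) ltac:(lra)
  ltac:(apply incr_to_app with w; [easy|split; [lra|easy]])).
rewrite (lsum_app _ s w) in H, Hup by easy. simpl in H, Hup. lra.
Qed.

(** In a near-optimal partition of [s,b] the first point s is moved to u. The resulting sum over
    [u,b] is still close to V s b, and superadditivity leaves almost nothing for V s u. *)
Lemma pvar_pow_right0 (s eps : R) : a <= s < b -> 0 < eps -> exists del, 0 < del /\
  forall u, s <= u <= b -> u - s < del -> V s u < eps.
Proof.
intros Hs He.
destruct (pvar_pow_approx s b (eps / 2)) as (l & Hl & H); try lra.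
destruct l as [|w l]; [simpl in Hl; lra|]. destruct Hl as [Hw Hl].
assert (Hwb := incr_to_le _ _ _ Hl). simpl in H.
destruct (inc_pow_continuous w s (eps / 2)) as (del & Hd & Hc); try lra.
exists (Rmin del (w - s)). split; [apply Rmin_glb_lt; lra|]. intros u Hu Hut.
assert (A := Rmin_l del (w - s)). assert (B := Rmin_r del (w - s)).
assert (Hu' : Rabs (ip w u - ip w s) < eps / 2) by (apply Hc; [lra|apply Rabs_def1; lra]).
apply Rabs_def2 in Hu'. unfold ip in Hu', H at 1. rewrite (inc_sym w u), (inc_sym w s) in Hu'.
assert (Hup := pvar_pow_upper u b (w :: l) ltac:(lra) ltac:(lra) ltac:(split; [lra|easy])).
simpl in Hup. unfold ip in Hup at 1.
assert (S := pvar_pow_superadd s u b ltac:(lra) ltac:(lra)). lra.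
Qed.

Lemma pvar_pow_cont (s t : R) : a <= s <= t -> t <= b -> cont_in (fun u => V s u) s t.
Proof.
intros Hs Ht t0 H0 eps He.
assert (HL : exists del, 0 < del /\ forall u, s <= u <= t0 -> t0 - u < del -> V s t0 - V s u < eps).
{ destruct (Req_dec s t0) as [<-|Hn].
  - exists 1. split; [lra|]. intros u Hu _. replace u with s by lra. lra.
  - apply pvar_pow_left; lra. }
assert (HR : exists del, 0 < del /\ forall u, t0 <= u <= t -> u - t0 < del -> V s u - V s t0 < eps).
{ destruct (Req_dec t0 b) as [->|Hn].
  - exists 1. split; [lra|]. intros u Hu _. replace u with b by lra. lra.
  (* Right continuity: V t0 u is small, subadditivity bounds the growth of the seminorm from t0 to u
     by its p-th root, and continuity of the p-th power returns to V. *)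
  - destruct (rpow_continuous p (pvar_semi r p x s t0) ltac:(lra) eps He) as (eta & Heta & Hc).
    destruct (pvar_pow_right0 t0 (rpow eta p)) as (del & Hd & Hr); [lra|now apply rpow_gt0|].
    exists del. split; [easy|]. intros u Hu Hut.
    assert (Hsm : pvar_semi r p x t0 u < eta).
    { rewrite <- (rpow_inv_r eta p) by lra. apply rpow_lt; [apply Rdiv_lt_0_compat; lra|].
      split; [apply pvar_pow_ge0; lra|apply Hr; lra]. }
    assert (Hsub := semi_subadd s t0 u ltac:(lra) ltac:(lra)).
    assert (Hm : pvar_semi r p x s t0 <= pvar_semi r p x s u) by (apply semi_mono; lra).
    destruct (Req_dec (pvar_semi r p x s t0) (pvar_semi r p x s u)) as [E|E].
    + rewrite <- (semi_pow s u), <- (semi_pow s t0), E by lra. lra.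
    + assert (Hd' : Rabs (rpow (pvar_semi r p x s u) p - rpow (pvar_semi r p x s t0) p) < eps).
      { apply Hc. split; [split; [exact I|easy]|]. simpl. unfold Rdist. apply Rabs_def1; lra. }
      rewrite !semi_pow in Hd' by lra. apply Rabs_def2 in Hd'. lra. }
destruct HL as (d1 & Hd1 & H1). destruct HR as (d2 & Hd2 & H2).
exists (Rmin d1 d2). split; [now apply Rmin_glb_lt|]. intros u Hu Hut.
assert (A := Rmin_l d1 d2). assert (B := Rmin_r d1 d2). apply Rabs_def2 in Hut.
destruct (Rle_lt_dec u t0).
- assert (V s u <= V s t0) by (apply pvar_pow_mono; lra).
  assert (V s t0 - V s u < eps) by (apply H1; lra). apply Rabs_def1; lra.
- assert (V s t0 <= V s u) by (apply pvar_pow_mono; lra).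
  assert (V s u - V s t0 < eps) by (apply H2; lra). apply Rabs_def1; lra.
Qed.

Lemma semi_cont (s t : R) : a <= s <= t -> t <= b -> cont_in (fun u => pvar_semi r p x s u) s t.
Proof.
intros. apply (cont_in_comp_rpow (fun u => V s u)); [apply Rdiv_lt_0_compat; lra|].
now apply pvar_pow_cont.
Qed.

End Variation.

(** ** Greedy times *)

Lemma is_inf_exists (E : R -> Prop) (lo : R) :
  (forall x, E x -> lo <= x) -> (exists x, E x) -> exists m, is_inf E m.
Proof.
intros Hlo [x0 Hx0].
destruct (completeness (fun y => E (- y))) as [M [HM HM']].
- exists (- lo). intros y Hy. apply Hlo in Hy. lra.
- exists (- x0). now rewrite Ropp_involutive.
- exists (- M). split.
  + intros x Hx. assert (- x <= M) by (apply HM; now rewrite Ropp_involutive). lra.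
  + intros m' Hm'. assert (M <= - m'); [|lra]. apply HM'. intros y Hy. apply Hm' in Hy. lra.
Qed.

Section Greedy.

Context (m : nat) (p gam : R) (x : R -> vec) (a b : R).
Context (hp : 1 <= p) (hgam : 0 < gam) (hab : a < b) (hx : Cpvar m p x a b).

(** By continuity of the variation in its right end, the infimum of the level set still has
    variation gam; if the level set is empty, the intermediate value theorem keeps the variation at
    most gam up to b. *)
Lemma next_time_spec (tau : R) : a <= tau <= b ->
  let t := next_time m p gam x b tau in
  tau <= t <= b /\ pvar_semi m p x tau t <= gam /\ (t = b \/ pvar_semi m p x tau t = gam).
Proof.
intros Ht. unfold next_time.
set (S := fun t => tau < t <= b /\ pvar_semi m p x tau t = gam).
set (P := fun s => ((exists t, S t) /\ is_inf S s) \/ ((~ exists t, S t) /\ s = b)).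
assert (HP : P (epsilon (inhabits b) P)).
{ apply epsilon_spec. destruct (classic (exists t, S t)) as [H|H].
  - destruct (is_inf_exists S tau) as [s Hs]; [intros y [Hy _]; lra|easy|]. exists s. now left.
  - exists b. now right. }
change (epsilon (inhabits b) _) with (epsilon (inhabits b) P).
destruct HP as [[[t0 Ht0] Hinf]|[Hn E]].
- set (s := epsilon (inhabits b) P) in *. destruct Hinf as [Hlow Hgr].
  assert (Hs0 : s <= t0) by now apply Hlow. assert (Ht0' := proj1 Ht0).
  assert (Hts : tau <= s) by (apply Hgr; intros y [Hy _]; lra).
  simpl. rewrite Rmin_right by lra.
  assert (E : pvar_semi m p x tau s = gam).
  { apply NNPP. intros Hne.
    assert (He : 0 < Rabs (pvar_semi m p x tau s - gam)) by (apply Rabs_pos_lt; lra).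
    destruct (semi_cont m p x a b hp hx tau b ltac:(lra) ltac:(lra) s ltac:(lra) _ He) as (del & Hd & Hc).
    assert (Hex : exists t, S t /\ t < s + del).
    { apply NNPP. intros Hno. assert (s + del <= s); [|lra]. apply Hgr. intros y Hy.
      apply Rnot_lt_le. intros Hlt. apply Hno. now exists y. }
    destruct Hex as (t & HS & Htd). assert (Hst := Hlow t HS). destruct HS as [Hr HS].
    assert (Hb := Hc t ltac:(lra) ltac:(apply Rabs_def1; lra)).
    rewrite HS, Rabs_minus_sym in Hb. lra. }
  split; [lra|]. split; [lra|now right].
- rewrite E. simpl. rewrite Rmin_right by lra.
  split; [lra|]. split; [|now left].
  apply Rnot_lt_le. intros Hlt.
  destruct (cont_in_ivt (fun u => pvar_semi m p x tau u) tau b gam) as (u & Hu & Hg); [lra| | |].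
  + apply (semi_cont m p x a b hp hx); lra.
  + rewrite (semi_refl m p x a b) by easy. lra.
  + apply Hn. exists u. split; [|easy]. split; [|lra].
    destruct (proj1 Hu) as [|Hc]; [easy|]. subst u.
    rewrite (semi_refl m p x a b hx) in Hg by easy. lra.
Qed.

Local Notation tau := (greedy_tau m p gam x a b).

Lemma greedy_tau_in (k : nat) : a <= tau k <= b.
Proof.
induction k as [|k IH]; simpl; [lra|]. destruct (next_time_spec _ IH) as [H _]. simpl in H. lra.
Qed.

Lemma greedy_tau_step (k : nat) :
  tau k <= tau (S k) <= b /\ pvar_semi m p x (tau k) (tau (S k)) <= gam.
Proof.
destruct (next_time_spec _ (greedy_tau_in k)) as (H1 & H2 & _). now split.
Qed.

(** Each step that stops short of b consumes gam^p of the superadditive quantity V, whose total over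
    [a,b] is finite. *)
Lemma greedy_tau_finite : exists n, tau n = b.
Proof.
apply NNPP. intros Hn.
assert (H : forall k, INR k * rpow gam p <= pvar_pow m p x a (tau k)).
{ intros k; induction k as [|k IH].
  - simpl. rewrite Rmult_0_l. apply (pvar_pow_ge0 m p x a b hx); lra.
  - rewrite S_INR.
    destruct (next_time_spec _ (greedy_tau_in k)) as (H1 & _ & [H3|H3]).
    + exfalso. apply Hn. now exists (S k).
    + assert (Hk := greedy_tau_in k).
      change (next_time m p gam x b (tau k)) with (tau (S k)) in H3, H1. simpl in H3, H1.
      assert (A := pvar_pow_superadd m p x a b hx a (tau k) (tau (S k)) ltac:(lra) ltac:(simpl; lra)).
      simpl in A. rewrite <- (semi_pow m p x a b hp hx (tau k)), H3 in A by lra. simpl. lra. }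
destruct (archimed (pvar_pow m p x a b / rpow gam p)) as [Ha _].
assert (Hg := rpow_gt0 gam p hgam).
set (z := up (pvar_pow m p x a b / rpow gam p)) in *.
assert (Hz : pvar_pow m p x a b < INR (Z.to_nat z) * rpow gam p).
{ apply Rmult_lt_reg_r with (/ rpow gam p); [now apply Rinv_0_lt_compat|].
  rewrite Rmult_assoc, Rinv_r, Rmult_1_r by lra. fold (pvar_pow m p x a b / rpow gam p).
  eapply Rlt_le_trans; [exact Ha|]. rewrite INR_IZR_INZ.
  apply IZR_le. lia. }
specialize (H (Z.to_nat z)).
assert (M := pvar_pow_mono m p x a b hx a a (tau (Z.to_nat z)) b).
assert (Hk := greedy_tau_in (Z.to_nat z)). specialize (M ltac:(lra) ltac:(lra) ltac:(lra)). lra.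
Qed.

End Greedy.

(** Descending to the least index shows that the choice by [epsilon] is not a default value; index 0
    is excluded because the greedy sequence starts at a < b. *)
Lemma N_greedy_spec (m : nat) (p Cg : R) (x : R -> vec) (a b : R) :
  1 <= p -> 0 < / (2 * (Kc p + 1) * Cg) -> a < b -> Cpvar m p x a b ->
  (1 <= N_greedy m p Cg x a b)%nat /\
  greedy_tau m p (/ (2 * (Kc p + 1) * Cg)) x a b (N_greedy m p Cg x a b) = b.
Proof.
intros hp hg hab hx. unfold N_greedy. set (gam := / (2 * (Kc p + 1) * Cg)) in *.
set (P := fun n => (1 <= n)%nat /\ greedy_tau m p gam x a b n = b /\
            forall k, (1 <= k < n)%nat -> greedy_tau m p gam x a b k <> b).
assert (HP : P (epsilon (inhabits O) P)).
{ apply epsilon_spec.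
  destruct (greedy_tau_finite m p gam x a b hp hg hab hx) as [n Hn].
  induction n as [n IH] using (well_founded_induction Wf_nat.lt_wf).
  destruct (classic (exists k, (1 <= k < n)%nat /\ greedy_tau m p gam x a b k = b)) as [(k & Hk & E)|Hno].
  - apply (IH k); [lia|easy].
  - exists n. split; [|split; [easy|]].
    + destruct n; [simpl in Hn; lra|lia].
    + intros k Hk E. apply Hno. now exists k. }
destruct HP as (H1 & H2 & _). now split.
Qed.

(** ** The Young-Loeve estimate with its sharp constant *)

Lemma RS_sum_app (term : R -> R -> vec) (s u : R) (l l' : list R) (i : nat) :
  incr_to s l u -> RS_sum term s (l ++ l') i = RS_sum term s l i + RS_sum term u l' i.
Proof.
revert s; induction l as [|v l IH]; simpl; intros s H.
- subst. unfold vzero. ring.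
- destruct H as [_ H]. unfold vadd. rewrite IH by easy. ring.
Qed.

Lemma RS_sum_vadd (t1 t2 : R -> R -> vec) (s : R) (l : list R) (i : nat) :
  RS_sum (fun u v => vadd (t1 u v) (t2 u v)) s l i = RS_sum t1 s l i + RS_sum t2 s l i.
Proof.
revert s; induction l as [|v l IH]; simpl; intros s; [unfold vzero; ring|].
unfold vadd in *. rewrite IH. ring.
Qed.

Lemma mesh_app_lt (s u eta : R) (l l' : list R) :
  incr_to s l u -> mesh s l < eta -> mesh u l' < eta -> mesh s (l ++ l') < eta.
Proof.
revert s; induction l as [|v l IH]; simpl; intros s H H1 H2; [now subst|].
destruct H as [_ H]. apply Rmax_lub_lt.
- eapply Rle_lt_trans; [apply Rmax_l|exact H1].
- apply IH; [easy| |easy]. eapply Rle_lt_trans; [apply Rmax_r|exact H1].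
Qed.

Lemma mesh_app_le (s u eta : R) (l l' : list R) :
  incr_to s l u -> mesh s l <= eta -> mesh u l' <= eta -> mesh s (l ++ l') <= eta.
Proof.
revert s; induction l as [|v l IH]; simpl; intros s H H1 H2; [now subst|].
destruct H as [_ H]. apply Rmax_lub.
- eapply Rle_trans; [apply Rmax_l|exact H1].
- apply IH; [easy| |easy]. eapply Rle_trans; [apply Rmax_r|exact H1].
Qed.

(** The origin of the ratio 2^(1-th): two halves, each contributing (D/2)^th. *)
Lemma rpow_half (D th : R) : 0 <= D -> 2 * rpow (D / 2) th = Rpower 2 (1 - th) * rpow D th.
Proof.
intros HD. unfold Rdiv. rewrite rpow_mul, (rpow_Rpower (/ 2)) by lra.
unfold Rminus. rewrite Rpower_plus, Rpower_1, Rpower_Ropp by lra.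
unfold Rpower at 1. rewrite ln_Rinv by lra.
replace (th * - ln 2) with (- (th * ln 2)) by ring. rewrite exp_Ropp. fold (Rpower 2 th). ring.
Qed.

Lemma Rpower_2_lt1 (th : R) : 1 < th -> 0 < Rpower 2 (1 - th) < 1.
Proof.
intros H. split; [apply exp_pos|]. apply Rlt_le_trans with (Rpower 2 0); [apply Rpower_lt; lra|rewrite Rpower_O; lra].
Qed.

(* Halving the control F, rather than removing points one by one, gives the
   geometric series with sum K = 1/(1 - 2^(1-th)). *)
Lemma halving_partition (d : nat) (F : R -> R) (s t e c th : R) (Xi : R -> R -> vec) :
  cont_in F s t -> 0 < e -> (forall u v, s <= u <= v -> v <= t -> e * (v - u) <= F v - F u) ->
  1 < th -> 0 <= c ->
  (forall u w v, s <= u <= w -> w <= v <= t ->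
     vnorm d (vsub (Xi u v) (vadd (Xi u w) (Xi w v))) <= c * rpow (F v - F u) th) ->
  forall (n : nat) s' t', s <= s' < t' -> t' <= t ->
  exists l, incr_to s' l t' /\ mesh s' l <= (F t' - F s') / e / 2 ^ n /\
    vnorm d (vsub (RS_sum Xi s' l) (Xi s' t')) <= c * / (1 - Rpower 2 (1 - th)) * rpow (F t' - F s') th.
Proof.
intros HF He Hinc Hth Hc HXi n.
assert (Hrho := Rpower_2_lt1 th Hth). set (rho := Rpower 2 (1 - th)) in *.
set (K := / (1 - rho)).
assert (HK : 0 < K) by (apply Rinv_0_lt_compat; lra).
(* The fixed-point equation that closes the induction: one defect at the top plus the errors of two
   halves reproduce the constant K, whatever the depth n. *)
assert (HK' : 1 + K * rho = K) by (unfold K; field; lra).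
induction n as [|n IH]; intros s' t' Hs Ht.
- exists (t' :: nil). assert (Hd := Hinc s' t' ltac:(lra) ltac:(lra)).
  split; [now split|]. split.
  + simpl. rewrite Rdiv_1_r. rewrite Rmax_left by lra.
    apply Rmult_le_reg_l with e; [easy|]. replace (e * ((F t' - F s') / e)) with (F t' - F s') by (field; lra). easy.
  + rewrite vnorm_zero; [|intros; unfold vsub; simpl; unfold vadd, vzero; ring].
    repeat apply Rmult_le_pos; try lra. apply rpow_ge0.
- assert (Hd := Hinc s' t' ltac:(lra) ltac:(lra)).
  assert (HD : 0 < F t' - F s').
  { assert (0 < e * (t' - s')) by (apply Rmult_lt_0_compat; lra). lra. }
  (* The split is at the midpoint of the values of F; the lower bound e (v - u) converts halved
     F-increments into a halved bound on the mesh. *)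
  destruct (cont_in_ivt F s' t' ((F s' + F t') / 2)) as (w & Hw & HFw); [lra| |lra|].
  { apply cont_in_sub with s t; lra || easy. }
  assert (Hw1 : s' < w).
  { destruct (proj1 Hw) as [|E]; [easy|]. exfalso. rewrite <- E in HFw. lra. }
  assert (Hw2 : w < t').
  { destruct (proj2 Hw) as [|E]; [easy|]. exfalso. rewrite E in HFw. lra. }
  destruct (IH s' w) as (l1 & P1 & M1 & E1); [lra|lra|].
  destruct (IH w t') as (l2 & P2 & M2 & E2); [lra|lra|].
  replace (F w - F s') with ((F t' - F s') / 2) in * by lra.
  replace (F t' - F w) with ((F t' - F s') / 2) in * by lra.
  set (D := F t' - F s') in *.
  assert (Hpow : 0 < 2 ^ n) by (apply pow_lt; lra).
  replace (D / 2 / e / 2 ^ n) with (D / e / 2 ^ S n) in * by (simpl; field; lra).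
  exists (l1 ++ l2). split; [now apply incr_to_app with w|]. split; [now apply mesh_app_le with w|].
  assert (HX := HXi s' w t' ltac:(lra) ltac:(lra)). fold D in HX.
  eapply Rle_trans.
  { apply (vnorm_add3_le d _ (vsub (RS_sum Xi s' l1) (Xi s' w)) (vsub (RS_sum Xi w l2) (Xi w t'))
      (vscale (-1) (vsub (Xi s' t') (vadd (Xi s' w) (Xi w t'))))).
    intros i _. unfold vsub, vscale, vadd. rewrite (RS_sum_app _ s' w) by easy. ring. }
  rewrite vnorm_scale, Rabs_left by lra.
  assert (Hh := rpow_half D th ltac:(lra)). fold rho in Hh.
  apply Rle_trans with (c * K * (2 * rpow (D / 2) th) + c * rpow D th); [fold K in E1, E2; lra|].
  rewrite Hh. right.
  transitivity (c * rpow D th * (1 + K * rho)); [ring|]. rewrite HK'. ring.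
Qed.

Lemma fine_partition (s t eta : R) : s <= t -> 0 < eta -> exists l, incr_to s l t /\ mesh s l < eta.
Proof.
intros [Hst|<-] Heta; [|exists nil; now split].
destruct (Pow_x_infinity 2 ltac:(rewrite Rabs_pos_eq; lra) (2 * (t - s) / eta)) as [N HN].
specialize (HN N (le_n N)). rewrite Rabs_pos_eq in HN by (apply pow_le; lra).
assert (Hp : 0 < 2 ^ N) by (apply pow_lt; lra).
(* Only the mesh estimate is wanted: the control is the identity, the summand is zero and the
   dimension is 0. *)
destruct (halving_partition 0 (fun u => u) s t 1 0 2 (fun _ _ => vzero)) with (n := N) (s' := s) (t' := t)
  as (l & Hl & Hm & _); try lra.
- apply cont_in_continuity. apply derivable_continuous, derivable_id.
- intros. lra.
- intros. rewrite vnorm_zero; [lra|]. intros; lia.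
- exists l. split; [easy|]. eapply Rle_lt_trans; [exact Hm|].
  rewrite Rdiv_1_r. apply Rmult_lt_reg_r with (2 ^ N); [easy|].
  unfold Rdiv at 1. rewrite Rmult_assoc, Rinv_l, Rmult_1_r by lra.
  apply Rge_le in HN. apply Rmult_le_compat_l with (r := eta) in HN; [|lra].
  replace (eta * (2 * (t - s) / eta)) with (2 * (t - s)) in HN by (field; lra). lra.
Qed.

(** [Phi] acts as a primitive of |w - v0|: its increments dominate the local errors, which telescope
    along any partition. *)
Lemma RS_drift_bound (d : nat) (w : R -> vec) (v0 : vec) (Phi : R -> R) (s t : R) (l : list R) :
  (forall u v, s <= u <= v -> v <= t -> vnorm d (vsub (w u) v0) * (v - u) <= Phi v - Phi u) ->
  incr_to s l t ->
  vnorm d (vsub (RS_sum (fun u v => vscale (v - u) (w u)) s l) (vscale (t - s) v0)) <= Phi t - Phi s.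
Proof.
revert s; induction l as [|v l IH]; simpl; intros s H Hl.
- subst. rewrite vnorm_zero; [lra|]. intros; unfold vsub, vscale, vzero; ring.
- destruct Hl as [Hs Hl]. assert (Hv := incr_to_le _ _ _ Hl).
  eapply Rle_trans; [apply (vnorm_add_le d _ (vscale (v - s) (vsub (w s) v0))
    (vsub (RS_sum (fun u v => vscale (v - u) (w u)) v l) (vscale (t - v) v0)))|].
  + intros; unfold vsub, vscale, vadd; ring.
  + rewrite vnorm_scale, Rabs_pos_eq by lra.
    assert (A := H s v ltac:(lra) ltac:(lra)).
    assert (B := IH v ltac:(intros; apply H; lra) Hl). lra.
Qed.

Lemma le_continuous_limit (h : R -> R) (y : R) :
  continuity_pt h 0 -> (forall e, 0 < e -> y <= h e) -> y <= h 0.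
Proof.
intros Hc H. apply Rle_plus_epsilon. intros eps He.
destruct (Hc eps He) as (al & Hal & Hd).
specialize (Hd (al / 2)). simpl in Hd. unfold Rdist in Hd.
assert (Hd' : Rabs (h (al / 2) - h 0) < eps).
{ apply Hd. split; [split; [exact I|lra]|]. rewrite Rabs_pos_eq; lra. }
apply Rabs_def2 in Hd'. specialize (H (al / 2) ltac:(lra)). lra.
Qed.

(** Both integrals of the equation in one Riemann sum, so that an increment of a solution is the
    limit of sums of a single term. *)
Definition eqn_term (m : nat) (hd : vec -> vec) (g : vec -> mat) (x z : R -> vec) (u v : R) : vec :=
  vadd (vscale (v - u) (hd (z u))) (matvec m (g (z u)) (vsub (x v) (x u))).

Section YoungBound.

Context (d m : nat) (p a b Cg : R) (hd : vec -> vec) (g : vec -> mat) (x z : R -> vec).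
Context (hp : 1 < p < 2) (hCg : 0 <= Cg) (hg : lipschitz_m d m g Cg).
Context (hx : Cpvar m p x a b) (hz : Cpvar d p z a b).
Context (hRS : forall s t, a <= s < t -> t <= b -> is_RS_integral d (eqn_term m hd g x z) s t (vsub (z t) (z s))).

Let Vz := pvar_pow d p z.
Let Vx := pvar_pow m p x.

(** The sewing defect is a product of an increment of z and one of x. Weighted AM-GM bounds it by
    the power 2/p of an increment of [F]. The weight lam is left free for optimisation, and the
    slope e makes [F] strictly increasing, as halving requires. *)
Lemma young_bound_control (s t lam e : R) (v0 : vec) (Phi : R -> R) : a <= s < t -> t <= b ->
  (forall u v, s <= u <= v -> v <= t -> vnorm d (vsub (hd (z u)) v0) * (v - u) <= Phi v - Phi u) ->
  0 < lam -> 0 < e ->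
  vnorm d (vsub (vsub (z t) (z s)) (vadd (vscale (t - s) v0) (matvec m (g (z s)) (vsub (x t) (x s)))))
  <= Phi t - Phi s + Cg * Kc p * rpow ((lam * Vz s t + / lam * Vx s t) / 2 + e * (t - s)) (2 / p).
Proof.
intros Hs Ht HPhi Hlam He.
set (F := fun u => lam / 2 * Vz s u + / lam / 2 * Vx s u + e * (u - s)).
set (Xi := fun u v => matvec m (g (z u)) (vsub (x v) (x u))).
assert (Hil := Rinv_0_lt_compat _ Hlam).
assert (Hth : 1 < 2 / p).
{ apply Rmult_lt_reg_r with p; [lra|]. unfold Rdiv. rewrite Rmult_assoc, Rinv_l; lra. }
assert (HFc : cont_in F s t).
{ unfold F. intros t0 H0 eps Heps.
  apply (cont_in_lin (fun u => lam / 2 * Vz s u + / lam / 2 * Vx s u) (fun u => u - s) 1 e s t) in H0; [|clear t0 H0 eps Heps|clear t0 H0 eps Heps].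
  - destruct (H0 eps Heps) as (del & Hd & H). exists del. split; [easy|]. intros u Hu Hut.
    specialize (H u Hu Hut). now rewrite !Rmult_1_l in H.
  - apply cont_in_lin; [apply (pvar_pow_cont d p z a b)|apply (pvar_pow_cont m p x a b)]; try easy; lra.
  - apply cont_in_continuity, derivable_continuous. reg. }
(* Superadditivity turns variations over subintervals into increments of functions of one variable,
   the variations started at s. *)
assert (HF : forall u w v, s <= u <= w -> w <= v -> v <= t ->
  (lam * Vz u w + / lam * Vx w v) / 2 + e * (v - u) <= F v - F u).
{ intros u w v Hu Hw Hv. unfold F, Vz, Vx.
  assert (A1 := pvar_pow_superadd d p z a b hz s u v ltac:(lra) ltac:(lra)).
  assert (A2 := pvar_pow_mono d p z a b hz u u w v ltac:(lra) ltac:(lra) ltac:(lra)).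
  assert (B1 := pvar_pow_superadd m p x a b hx s u v ltac:(lra) ltac:(lra)).
  assert (B2 := pvar_pow_mono m p x a b hx u w v v ltac:(lra) ltac:(lra) ltac:(lra)).
  assert (A3 := Rmult_le_compat_l lam _ _ ltac:(lra) (Rle_trans _ _ _ (Rplus_le_compat_l _ _ _ A2) A1)).
  assert (B3 := Rmult_le_compat_l (/ lam) _ _ ltac:(lra) (Rle_trans _ _ _ (Rplus_le_compat_l _ _ _ B2) B1)).
  lra. }
assert (HV0 : forall u v, s <= u <= v -> v <= t -> 0 <= Vz u v /\ 0 <= Vx u v).
{ intros. split; [apply (pvar_pow_ge0 d p z a b hz)|apply (pvar_pow_ge0 m p x a b hx)]; lra. }
assert (HXi : forall u w v, s <= u <= w -> w <= v <= t ->
     vnorm d (vsub (Xi u v) (vadd (Xi u w) (Xi w v))) <= Cg * rpow (F v - F u) (2 / p)).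
{ intros u w v Hu Hw.
  (* Inserting w leaves the defect (g(z_u) - g(z_w)) (x_v - x_w). *)
  rewrite (vnorm_ext d _ (matvec m (msub (g (z u)) (g (z w))) (vsub (x v) (x w)))).
  2: { intros i _. unfold Xi. rewrite matvec_msub. unfold vadd. rewrite !matvec_vsub.
       unfold vsub at 1. rewrite !matvec_vsub. ring. }
  eapply Rle_trans; [apply matvec_opnorm|].
  destruct (HV0 u w ltac:(lra) ltac:(lra)) as [A1 _].
  destruct (HV0 w v ltac:(lra) ltac:(lra)) as [_ A2].
  assert (HD := HF u w v Hu ltac:(lra) ltac:(lra)).
  set (D := F v - F u) in *.
  apply Rle_trans with ((Cg * rpow (Vz u w) (1 / p)) * rpow (Vx w v) (1 / p)).
  - apply Rmult_le_compat; [apply opnorm_ge0|apply vnorm_ge0| |].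
    + eapply Rle_trans; [apply hg|]. apply Rmult_le_compat_l; [easy|].
      rewrite vnorm_sub_sym. apply (inc_le_semi d p z a b); try easy; lra.
    + apply (inc_le_semi m p x a b); try easy; lra.
  - rewrite Rmult_assoc. apply Rmult_le_compat_l; [easy|].
    rewrite <- rpow_mul by easy. replace (2 / p) with (1 / p + 1 / p) by (field; lra).
    assert (Hev : 0 <= e * (v - u)) by (apply Rmult_le_pos; lra).
    assert (HD0 : 0 <= D).
    { assert (0 <= lam * Vz u w) by (apply Rmult_le_pos; lra).
      assert (0 <= / lam * Vx w v) by (apply Rmult_le_pos; lra). lra. }
    rewrite rpow_add, <- rpow_mul by easy. apply rpow_le; [apply Rdiv_lt_0_compat; lra|].
    assert (Hsq : Vz u w * Vx w v <= ((lam * Vz u w + / lam * Vx w v) / 2) * ((lam * Vz u w + / lam * Vx w v) / 2)).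
    { replace (Vz u w * Vx w v) with ((lam * Vz u w) * (/ lam * Vx w v)) by (field; lra).
      set (A := lam * Vz u w). set (B := / lam * Vx w v).
      assert (0 <= (A - B) ^ 2) by apply pow2_ge_0. nra. }
    eapply Rle_trans; [exact Hsq|].
    assert (0 <= (lam * Vz u w + / lam * Vx w v) / 2).
    { assert (0 <= lam * Vz u w) by (apply Rmult_le_pos; lra).
      assert (0 <= / lam * Vx w v) by (apply Rmult_le_pos; lra). lra. }
    apply Rmult_le_compat; lra. }
assert (HFe : forall u v, s <= u <= v -> v <= t -> e * (v - u) <= F v - F u).
{ intros u v Hu Hv. assert (A := HF u u v ltac:(lra) ltac:(lra) Hv).
  destruct (HV0 u u ltac:(lra) ltac:(lra)) as [A1 _]. destruct (HV0 u v ltac:(lra) ltac:(lra)) as [_ A2].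
  assert (0 <= lam * Vz u u) by (apply Rmult_le_pos; lra).
  assert (0 <= / lam * Vx u v) by (apply Rmult_le_pos; lra). lra. }
apply Rle_plus_epsilon. intros eps Heps.
destruct (hRS s t Hs Ht eps Heps) as (eta & Heta & HI).
(* Depth N brings the mesh, at most (F t - F s)/(e 2^N), below eta, so the Riemann sum is within eps
   of the increment of z. *)
destruct (Pow_x_infinity 2 ltac:(rewrite Rabs_pos_eq; lra) (2 * ((F t - F s) / e) / eta)) as [N HN].
specialize (HN N (le_n N)). rewrite Rabs_pos_eq in HN by (apply pow_le; lra).
assert (Hp : 0 < 2 ^ N) by (apply pow_lt; lra).
destruct (halving_partition d F s t e Cg (2 / p) Xi HFc He HFe Hth hCg HXi N s t) as (l & Hl & Hm & HE); [lra|lra|].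
assert (HFst : 0 < (F t - F s) / e).
{ apply Rdiv_lt_0_compat; [|easy]. assert (A := HFe s t ltac:(lra) ltac:(lra)).
  assert (0 < e * (t - s)) by (apply Rmult_lt_0_compat; lra). lra. }
assert (Hmesh : mesh s l < eta).
{ eapply Rle_lt_trans; [exact Hm|]. set (q := (F t - F s) / e) in *.
  apply Rmult_lt_reg_r with (2 ^ N); [easy|].
  unfold Rdiv at 1. rewrite Rmult_assoc, Rinv_l, Rmult_1_r by lra.
  apply Rge_le in HN. apply Rmult_le_compat_l with (r := eta) in HN; [|lra].
  replace (eta * (2 * q / eta)) with (2 * q) in HN by (field; lra). lra. }
specialize (HI l Hl Hmesh).
assert (HDr := RS_drift_bound d (fun u => hd (z u)) v0 Phi s t l HPhi Hl).
assert (HF0 : F t - F s = (lam * Vz s t + / lam * Vx s t) / 2 + e * (t - s)).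
{ unfold F, Vz, Vx. rewrite (pvar_pow_refl d p z a b), (pvar_pow_refl m p x a b) by (easy || lra). field; lra. }
rewrite HF0 in HE.
set (T := fun u v : R => vscale (v - u) (hd (z u))) in *.
change (matvec m (g (z s)) (vsub (x t) (x s))) with (Xi s t).
eapply Rle_trans.
{ apply (vnorm_add3_le d _ (vsub (RS_sum T s l) (vscale (t - s) v0)) (vsub (RS_sum Xi s l) (Xi s t))
    (vscale (-1) (vsub (RS_sum (eqn_term m hd g x z) s l) (vsub (z t) (z s))))).
  intros i _. assert (E : RS_sum (eqn_term m hd g x z) s l i = RS_sum T s l i + RS_sum Xi s l i)
    by apply (RS_sum_vadd T Xi).
  unfold vsub, vscale, vadd. rewrite E. ring. }
rewrite vnorm_scale, Rabs_left by lra.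
unfold Kc. lra.
Qed.

(** The weight sqrt B / sqrt A turns the arithmetic mean of the two variations into the geometric
    one, which yields the product of seminorms. Shifting both variations by e keeps the weight
    defined when one of them vanishes; then e tends to 0. *)
Lemma young_bound (s t : R) (v0 : vec) (Phi : R -> R) : a <= s < t -> t <= b ->
  (forall u v, s <= u <= v -> v <= t -> vnorm d (vsub (hd (z u)) v0) * (v - u) <= Phi v - Phi u) ->
  vnorm d (vsub (vsub (z t) (z s)) (vadd (vscale (t - s) v0) (matvec m (g (z s)) (vsub (x t) (x s)))))
  <= Phi t - Phi s + Cg * Kc p * (pvar_semi d p z s t * pvar_semi m p x s t).
Proof.
intros Hs Ht HPhi.
assert (Hz0 : 0 <= Vz s t) by (apply (pvar_pow_ge0 d p z a b hz); lra).
assert (Hx0 : 0 <= Vx s t) by (apply (pvar_pow_ge0 m p x a b hx); lra).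
set (h := fun e => Phi t - Phi s + Cg * Kc p * rpow (sqrt ((Vz s t + e) * (Vx s t + e)) + e * (t - s)) (2 / p)).
assert (Hpp : 0 < 2 / p) by (apply Rdiv_lt_0_compat; lra).
assert (E0 : h 0 = Phi t - Phi s + Cg * Kc p * (pvar_semi d p z s t * pvar_semi m p x s t)).
{ unfold h. rewrite !Rplus_0_r, Rmult_0_l, Rplus_0_r. do 2 f_equal.
  replace (2 / p) with (1 / p + 1 / p) by (field; lra).
  rewrite rpow_add, <- rpow_mul, sqrt_sqrt by (try apply sqrt_pos; try apply Rmult_le_pos; easy).
  now apply rpow_mul. }
rewrite <- E0. apply le_continuous_limit.
- unfold h. apply continuity_pt_plus; [apply continuity_pt_const; now intros ? ?|].
  apply continuity_pt_mult; [apply continuity_pt_const; now intros ? ?|].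
  apply (continuity_pt_comp (fun e => sqrt ((Vz s t + e) * (Vx s t + e)) + e * (t - s)) (fun y => rpow y (2 / p)));
    [|now apply rpow_continuous].
  apply continuity_pt_plus; [|apply derivable_continuous_pt; reg].
  apply (continuity_pt_comp (fun e => (Vz s t + e) * (Vx s t + e)) sqrt).
  + apply derivable_continuous_pt; reg.
  + apply continuity_pt_sqrt. rewrite !Rplus_0_r. now apply Rmult_le_pos.
- intros e He. unfold h.
  set (A := Vz s t + e). set (B := Vx s t + e).
  assert (HA : 0 < A) by (unfold A; lra). assert (HB : 0 < B) by (unfold B; lra).
  assert (HAs := sqrt_lt_R0 _ HA). assert (HBs := sqrt_lt_R0 _ HB).
  assert (HK : 0 <= Cg * Kc p).
  { apply Rmult_le_pos; [easy|]. left. apply Rinv_0_lt_compat.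
    assert (H1 : 1 < 2 / p)
      by (apply Rmult_lt_reg_r with p; [lra|]; unfold Rdiv; rewrite Rmult_assoc, Rinv_l; lra).
    assert (G := Rpower_2_lt1 (2 / p) H1). lra. }
  eapply Rle_trans; [apply (young_bound_control s t (sqrt B / sqrt A) e v0 Phi Hs Ht HPhi)|];
    [now apply Rdiv_lt_0_compat|easy|].
  apply Rplus_le_compat_l, Rmult_le_compat_l; [easy|]. apply rpow_le; [easy|].
  apply Rplus_le_compat_r.
  rewrite sqrt_mult by lra.
  apply Rle_trans with ((sqrt B / sqrt A * A + / (sqrt B / sqrt A) * B) / 2).
  + assert (0 < sqrt B / sqrt A) by now apply Rdiv_lt_0_compat.
    assert (0 < / (sqrt B / sqrt A)) by now apply Rinv_0_lt_compat.
    assert (sqrt B / sqrt A * Vz s t <= sqrt B / sqrt A * A) by (apply Rmult_le_compat_l; [lra|unfold A; lra]).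
    assert (/ (sqrt B / sqrt A) * Vx s t <= / (sqrt B / sqrt A) * B) by (apply Rmult_le_compat_l; [lra|unfold B; lra]).
    lra.
  + right. rewrite <- (sqrt_sqrt A) at 2 by lra. rewrite <- (sqrt_sqrt B) at 3 by lra. field; lra.
Qed.

End YoungBound.

(** [is_solution] speaks of integrals from a only. A fine partition of [a,s] is put in front of the
    given one of [s,t], and the Riemann sums over [a,s] are subtracted. *)
Lemma is_solution_RS (d m : nat) (p : R) (A : mat) (f : vec -> vec) (g : vec -> mat)
    (x : R -> vec) (a b : R) (ya : vec) (z : R -> vec) (s t : R) :
  is_solution d m p A f g x a b ya z -> a <= s < t -> t <= b ->
  is_RS_integral d (eqn_term m (fun u => vadd (matvec d A u) (f u)) g x z) s t (vsub (z t) (z s)).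
Proof.
intros [_ Hz] Hs Ht eps Heps. set (hd := fun u => vadd (matvec d A u) (f u)).
destruct (Hz s ltac:(lra)) as (I1 & I2 & H1 & H2 & E).
destruct (Hz t ltac:(lra)) as (J1 & J2 & G1 & G2 & E').
assert (He : 0 < eps / 4) by lra.
destruct (H1 _ He) as (e1 & He1 & K1). destruct (H2 _ He) as (e2 & He2 & K2).
destruct (G1 _ He) as (e3 & He3 & K3). destruct (G2 _ He) as (e4 & He4 & K4).
set (eta := Rmin (Rmin e1 e2) (Rmin e3 e4)).
assert (M1 : eta <= Rmin e1 e2) by apply Rmin_l. assert (M2 : eta <= Rmin e3 e4) by apply Rmin_r.
assert (N1 := Rmin_l e1 e2). assert (N2 := Rmin_r e1 e2). assert (N3 := Rmin_l e3 e4). assert (N4 := Rmin_r e3 e4).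
assert (Heta : 0 < eta) by (repeat apply Rmin_glb_lt; easy).
exists eta. split; [easy|]. intros l Hl Hm.
destruct (fine_partition a s eta ltac:(lra) Heta) as (l0 & Hl0 & Hm0).
assert (Hm1 := mesh_app_lt a s eta l0 l Hl0 Hm0 Hm).
assert (Hp := incr_to_app a s t l0 l Hl0 Hl).
specialize (K1 l0 Hl0 ltac:(lra)). specialize (K2 l0 Hl0 ltac:(lra)).
specialize (K3 _ Hp ltac:(lra)). specialize (K4 _ Hp ltac:(lra)).
set (T1 := fun u v : R => vscale (v - u) (vadd (matvec d A (z u)) (f (z u)))) in *.
set (T2 := fun u v : R => matvec m (g (z u)) (vsub (x v) (x u))) in *.
eapply Rle_lt_trans.
{ apply (vnorm_add_le d _
    (vadd (vsub (RS_sum T1 a (l0 ++ l)) J1) (vscale (-1) (vsub (RS_sum T1 a l0) I1)))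
    (vadd (vsub (RS_sum T2 a (l0 ++ l)) J2) (vscale (-1) (vsub (RS_sum T2 a l0) I2)))).
  intros i Hi.
  assert (ES : RS_sum (eqn_term m hd g x z) s l i
    = RS_sum T1 s l i + RS_sum T2 s l i) by apply (RS_sum_vadd T1 T2).
  unfold vsub, vscale, vadd. rewrite ES, (E i Hi), (E' i Hi), !(RS_sum_app _ a s) by easy. ring. }
assert (Q1 := vnorm_triangle d (vsub (RS_sum T1 a (l0 ++ l)) J1) (vscale (-1) (vsub (RS_sum T1 a l0) I1))).
assert (Q2 := vnorm_triangle d (vsub (RS_sum T2 a (l0 ++ l)) J2) (vscale (-1) (vsub (RS_sum T2 a l0) I2))).
rewrite vnorm_scale, Rabs_left in Q1, Q2 by lra. lra.
Qed.

(** ** A priori bounds *)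

(** Continuous induction: nonnegativity up to v improves to the margin eps at v, which by continuity
    carries it beyond v. The supremum of the good points is therefore t. *)
Lemma cont_in_bootstrap (psi : R -> R) (s t eps : R) : s <= t -> 0 < eps -> cont_in psi s t ->
  0 <= psi s ->
  (forall v, s <= v <= t -> (forall u, s <= u <= v -> 0 <= psi u) -> eps <= psi v) ->
  forall v, s <= v <= t -> 0 <= psi v.
Proof.
intros Hst He Hc H0 H.
set (E := fun v => s <= v <= t /\ forall u, s <= u <= v -> 0 <= psi u).
assert (Es : E s).
{ split; [lra|]. intros u Hu. replace u with s by lra. easy. }
destruct (completeness E) as [w [Hw Hw']].
- exists t. intros v [Hv _]. lra.
- now exists s.
- assert (Hsw : s <= w) by now apply Hw.
  assert (Hwt : w <= t) by (apply Hw'; intros v [Hv _]; lra).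
  assert (Hlt : forall u, s <= u < w -> 0 <= psi u).
  { intros u Hu. apply NNPP. intros Hn. assert (w <= u); [|lra].
    apply Hw'. intros v [Hv Hv']. apply Rnot_lt_le. intros Huv. apply Hn, Hv'. lra. }
  assert (Ew : E w).
  { split; [lra|]. intros u Hu. destruct (Rlt_le_dec u w) as [|Hge]; [apply Hlt; lra|].
    replace u with w by lra. apply Rnot_lt_le. intros Hneg.
    destruct (Hc w ltac:(lra) (- psi w) ltac:(lra)) as (del & Hd & Hd').
    destruct (Req_dec s w) as [<-|Hsw']; [lra|].
    assert (A := Rmax_l s (w - del / 2)). assert (B := Rmax_r s (w - del / 2)).
    assert (C : Rmax s (w - del / 2) < w) by (apply Rmax_lub_lt; lra).
    assert (D := Hd' (Rmax s (w - del / 2)) ltac:(lra) ltac:(apply Rabs_def1; lra)).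
    assert (F := Hlt (Rmax s (w - del / 2)) ltac:(lra)). apply Rabs_def2 in D. lra. }
  assert (w = t).
  { apply NNPP. intros Hne. assert (Hpw := H w ltac:(lra) (proj2 Ew)).
    destruct (Hc w ltac:(lra) eps He) as (del & Hd & Hd').
    set (v := Rmin t (w + del / 2)).
    assert (A : v <= t) by apply Rmin_l. assert (B : v <= w + del / 2) by apply Rmin_r.
    assert (C : w < v) by (apply Rmin_glb_lt; lra).
    assert (Ev : E v); [|apply Hw in Ev; lra].
    split; [lra|]. intros u Hu. destruct (Rle_lt_dec u w); [apply (proj2 Ew); lra|].
    assert (D := Hd' u ltac:(lra) ltac:(apply Rabs_def1; lra)). apply Rabs_def2 in D. lra. }
  subst w. intros v Hv. apply (proj2 Ew). lra.
Qed.

Lemma rpow_superadd (u v p : R) : 1 < p -> 0 <= u -> 0 <= v -> rpow u p + rpow v p <= rpow (u + v) p.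
Proof.
intros Hp Hu Hv. replace p with (1 + (p - 1)) by ring. rewrite !rpow_add, !rpow_1 by lra.
assert (A : rpow u (p - 1) <= rpow (u + v) (p - 1)) by (apply rpow_le; lra).
assert (B : rpow v (p - 1) <= rpow (u + v) (p - 1)) by (apply rpow_le; lra). nra.
Qed.

Lemma Kc_gt0 (p : R) : 1 < p < 2 -> 0 < Kc p.
Proof.
intros Hp. apply Rinv_0_lt_compat.
assert (H1 : 1 < 2 / p)
  by (apply Rmult_lt_reg_r with p; [lra|]; unfold Rdiv; rewrite Rmult_assoc, Rinv_l; lra).
assert (G := Rpower_2_lt1 (2 / p) H1). lra.
Qed.

Section Apriori.

Context (d m : nat) (p a b L f0 Cg : R) (hd : vec -> vec) (g : vec -> mat) (x z : R -> vec).
Context (hp : 1 < p < 2) (hab : a < b) (hL : 0 < L) (hCg : 0 < Cg) (hg : lipschitz_m d m g Cg).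
Context (hhd : forall u, vnorm d (hd u) <= L * vnorm d u + f0).
Context (hx : Cpvar m p x a b) (hz : Cpvar d p z a b).
Context (hRS : forall s t, a <= s < t -> t <= b -> is_RS_integral d (eqn_term m hd g x z) s t (vsub (z t) (z s))).

Let K := Kc p.
Let gam := / (2 * (K + 1) * Cg).
Let G0 := opnorm d m (g vzero).

Lemma g_growth (u : vec) : opnorm d m (g u) <= G0 + Cg * vnorm d u.
Proof.
eapply Rle_trans; [apply (opnorm_le_msub d m _ (g vzero))|]. apply Rplus_le_compat_l.
eapply Rle_trans; [apply hg|]. right. f_equal. apply vnorm_ext. intros; unfold vsub, vzero; ring.
Qed.

Lemma drift_const_ge0 : 0 <= f0.
Proof.
assert (H := hhd vzero). rewrite (vnorm_zero d vzero) in H by easy.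
assert (A := vnorm_ge0 d (hd vzero)). lra.
Qed.

Lemma vnorm_le_semi (s u t : R) : a <= s <= u -> u <= t <= b ->
  vnorm d (z u) <= vnorm d (z s) + pvar_semi d p z s t.
Proof.
intros Hs Ht. eapply Rle_trans; [apply (vnorm_le_sub d (z u) (z s))|]. apply Rplus_le_compat_l.
apply Rle_trans with (pvar_semi d p z s u).
- apply (inc_le_semi d p z a b); lra || easy.
- apply (semi_mono d p z a b); lra || easy.
Qed.

(** Minkowski's inequality separates the drift, dominated by [Phi], from a multiple of the variation
    of x. The coefficient K + 1 is the sum of K from the Young bound and 1 from the growth of g
    along z. *)
Lemma apriori_variation (s v : R) (Phi : R -> R) : a <= s < v -> v <= b ->
  (forall u w, s <= u <= w -> w <= v -> vnorm d (hd (z u)) * (w - u) <= Phi w - Phi u) ->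
  pvar_semi d p z s v <= (Phi v - Phi s) +
    (G0 + Cg * vnorm d (z s) + (K + 1) * Cg * pvar_semi d p z s v) * pvar_semi m p x s v.
Proof.
intros Hs Hv HPhi.
assert (HK : 0 < K) by now apply Kc_gt0.
assert (HG0 : 0 <= G0) by apply opnorm_ge0.
assert (HZ := semi_ge0 d p z s v). assert (HX := semi_ge0 m p x s v).
assert (Hzs := vnorm_ge0 d (z s)).
set (Z := pvar_semi d p z s v) in *. set (X := pvar_semi m p x s v) in *.
set (c := G0 + Cg * vnorm d (z s) + (K + 1) * Cg * Z).
assert (Hc : 0 <= c).
{ unfold c. assert (0 <= Cg * vnorm d (z s)) by (apply Rmult_le_pos; lra).
  assert (0 <= (K + 1) * Cg * Z) by (repeat apply Rmult_le_pos; lra). lra. }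
assert (HPhi0 : forall u w, s <= u <= w -> w <= v -> 0 <= Phi w - Phi u).
{ intros u w Hu Hw. eapply Rle_trans; [|apply HPhi; easy].
  apply Rmult_le_pos; [apply vnorm_ge0|lra]. }
(* [semi_minkowski] asks for functions nonnegative at all pairs, while [Phi] is known to increase
   only on [s,v]; hence the absolute value. *)
apply (semi_minkowski d p z a b) with (fun u w => Rabs (Phi w - Phi u)) (fun u w => c * pvar_semi m p x u w);
  try (exact hz); try lra.
- apply HPhi0; lra.
- now apply Rmult_le_pos.
- intros; apply Rabs_pos.
- intros; apply Rmult_le_pos; [easy|apply rpow_ge0].
- intros u w Hu Hw. rewrite Rabs_pos_eq by (apply HPhi0; lra).
  assert (Hyb := young_bound d m p a b Cg hd g x z hp ltac:(lra) hg hx hz hRS u w vzero Phi ltac:(lra) ltac:(lra)).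
  assert (HZ' : pvar_semi d p z u w <= Z) by (apply (semi_mono d p z a b); lra || easy).
  assert (HZ0 := semi_ge0 d p z u w). assert (HX0 := semi_ge0 m p x u w).
  set (Xuw := pvar_semi m p x u w) in *.
  assert (Hzu : vnorm d (z u) <= vnorm d (z s) + Z) by (apply vnorm_le_semi; lra).
  assert (Hgx : vnorm d (matvec m (g (z u)) (vsub (x w) (x u))) <= (G0 + Cg * (vnorm d (z s) + Z)) * Xuw).
  { eapply Rle_trans; [apply matvec_opnorm|].
    apply Rmult_le_compat; [apply opnorm_ge0|apply vnorm_ge0| |].
    - eapply Rle_trans; [apply g_growth|]. apply Rplus_le_compat_l, Rmult_le_compat_l; lra.
    - apply (inc_le_semi m p x a b); lra || easy. }
  apply Rle_trans with (Phi w - Phi u + Cg * Kc p * (Z * Xuw) + (G0 + Cg * (vnorm d (z s) + Z)) * Xuw).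
  + eapply Rle_trans; [|apply Rplus_le_compat; [|exact Hgx]].
    * apply vnorm_add_le with (u := vsub (vsub (z w) (z u)) (vadd (vscale (w - u) vzero)
        (matvec m (g (z u)) (vsub (x w) (x u))))).
      intros i _. unfold vsub at 1 2 3, vadd, vscale, vzero. ring.
    * eapply Rle_trans; [apply Hyb|].
      -- intros u' w' Hu' Hw'. rewrite (vnorm_ext d _ (hd (z u'))).
         ++ apply HPhi; lra.
         ++ intros; unfold vsub, vzero; ring.
      -- apply Rplus_le_compat_l, Rmult_le_compat_l; [fold K; apply Rmult_le_pos; lra|].
         now apply Rmult_le_compat_r.
  + right. unfold c. fold K. ring.
- intros l Hl.
  rewrite <- (Rabs_pos_eq (Phi v - Phi s)) by (apply HPhi0; lra).
  apply (lsum_superadd (fun u w => rpow (Rabs (Phi w - Phi u)) p)); [| |easy].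
  + intros; apply rpow_ge0.
  + intros u w t Hu Hw.
    rewrite !Rabs_pos_eq by (apply HPhi0; lra).
    replace (Phi t - Phi u) with ((Phi w - Phi u) + (Phi t - Phi w)) by ring.
    apply rpow_superadd; [lra|apply HPhi0; lra|apply HPhi0; lra].
- intros l Hl. rewrite rpow_mul by easy. unfold X. rewrite (semi_pow m p x a b) by (easy || lra).
  apply Rle_trans with (lsum (fun u w => rpow c p * pvar_pow m p x u w + 0 * 0) s l).
  + apply (lsum_le _ _ s v); [|easy]. intros u w Hu Hw.
    rewrite rpow_mul by (easy || apply rpow_ge0). rewrite (semi_pow m p x a b) by (easy || lra). lra.
  + rewrite (lsum_lin (rpow c p) 0 (pvar_pow m p x) (fun _ _ => 0)), Rmult_0_l, Rplus_0_r.
    apply Rmult_le_compat_l; [apply rpow_ge0|].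
    apply lsum_superadd; [| |easy].
    * intros u Hu. rewrite (pvar_pow_refl m p x a b) by (easy || lra). lra.
    * intros u w t Hu Hw. apply (pvar_pow_superadd m p x a b); lra || easy.
Qed.

(* Gronwall's lemma is replaced by a comparison with the exact solution
   G of G' = 2(L G + f0), which is convex. *)
Lemma apriori_step (s t : R) : a <= s < t -> t <= b -> pvar_semi m p x s t <= gam ->
  vnorm d (z s) + pvar_semi d p z s t
  <= ((1 + / (K + 1)) * vnorm d (z s) + (f0 / L + G0 / ((K + 1) * Cg))) * exp (2 * L * (t - s)).
Proof.
intros Hs Ht HX.
assert (HK : 0 < K) by now apply Kc_gt0.
assert (HG0 : 0 <= G0) by apply opnorm_ge0.
assert (Hf0 := drift_const_ge0).
assert (Hzs := vnorm_ge0 d (z s)).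
set (n0 := vnorm d (z s)) in *.
set (A0 := (1 + / (K + 1)) * n0 + G0 / ((K + 1) * Cg)).
assert (HKC : 0 < (K + 1) * Cg) by (apply Rmult_lt_0_compat; lra).
assert (HiK : 0 < / (K + 1)) by (apply Rinv_0_lt_compat; lra).
assert (HG0' : 0 <= G0 / ((K + 1) * Cg)) by (apply Rdiv_le_0_compat; lra).
assert (HfL : 0 <= f0 / L) by (apply Rdiv_le_0_compat; lra).
assert (HA0 : n0 <= A0) by (unfold A0; nra).
(* The additional eps raises the comparison function at s and supplies the margin that
   [cont_in_bootstrap] requires. *)
assert (Main : forall eps, 0 < eps ->
  n0 + pvar_semi d p z s t <= (A0 + f0 / L + eps) * exp (2 * L * (t - s)) - f0 / L).
{ intros eps Heps.
  set (c := A0 + f0 / L + eps). assert (Hc : 0 < c) by (unfold c; lra).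
  set (G := fun u => c * exp (2 * L * (u - s)) - f0 / L).
  assert (HGs : G s = A0 + eps).
  { unfold G, c. rewrite Rminus_diag, Rmult_0_r, exp_0. ring. }
  assert (Hconv : forall u w, u <= w -> 2 * (L * G u + f0) * (w - u) <= G w - G u).
  { intros u w Huw. unfold G.
    replace (2 * L * (w - s)) with (2 * L * (u - s) + 2 * L * (w - u)) by ring. rewrite exp_plus.
    assert (E1 := exp_ineq1_le (2 * L * (w - u))).
    assert (E2 : 0 < c * exp (2 * L * (u - s))) by (apply Rmult_lt_0_compat; [easy|apply exp_pos]).
    set (ce := c * exp (2 * L * (u - s))) in *.
    replace (c * (exp (2 * L * (u - s)) * exp (2 * L * (w - u)))) with (ce * exp (2 * L * (w - u))) by (unfold ce; ring).
    replace (2 * (L * (ce - f0 / L) + f0) * (w - u)) with (ce * (2 * L * (w - u))) by (field; lra).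
    nra. }
  cut (forall v, s <= v <= t -> 0 <= 1 * G v + -1 * (n0 + pvar_semi d p z s v)).
  { intros H. specialize (H t ltac:(lra)). unfold G in H. fold c. lra. }
  apply cont_in_bootstrap with eps; [lra|easy| | |].
  - apply cont_in_lin.
    + apply cont_in_continuity, derivable_continuous. unfold G. reg.
    + intros t0 Ht0 e He. destruct (semi_cont d p z a b ltac:(lra) hz s t ltac:(lra) ltac:(lra) t0 Ht0 e He) as (del & Hd & H).
      exists del. split; [easy|]. intros u Hu Hut.
      replace (n0 + pvar_semi d p z s u - (n0 + pvar_semi d p z s t0)) with
        (pvar_semi d p z s u - pvar_semi d p z s t0) by ring. now apply H.
  - rewrite HGs, (semi_refl d p z a b) by (easy || lra). lra.
  - intros v Hv Hle.
    destruct (Req_dec s v) as [<-|Hne].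
    { rewrite HGs, (semi_refl d p z a b) by (easy || lra). lra. }
    assert (HXv : pvar_semi m p x s v <= gam).
    { eapply Rle_trans; [|exact HX]. apply (semi_mono m p x a b); lra || easy. }
    assert (HXv0 := semi_ge0 m p x s v). assert (HZ0 := semi_ge0 d p z s v).
    assert (HV := apriori_variation s v (fun u => G u / 2) ltac:(lra) ltac:(lra)).
    fold n0 in HV. set (Z := pvar_semi d p z s v) in *.
    set (cc := G0 + Cg * n0 + (K + 1) * Cg * Z) in *.
    assert (Hcc : 0 <= cc).
    { unfold cc. assert (0 <= Cg * n0) by (apply Rmult_le_pos; lra).
      assert (0 <= (K + 1) * Cg * Z) by (repeat apply Rmult_le_pos; lra). lra. }
    assert (HV' : Z <= G v / 2 - G s / 2 + cc * gam).
    { eapply Rle_trans; [apply HV|].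
      - intros u w Hu Hw. assert (Hu' := Hle u ltac:(lra)).
        assert (Hzu : vnorm d (z u) <= n0 + pvar_semi d p z s u) by (apply vnorm_le_semi; lra).
        assert (Hb := hhd (z u)). assert (Hcv := Hconv u w ltac:(lra)).
        assert (Hm : vnorm d (hd (z u)) <= L * G u + f0).
        { eapply Rle_trans; [exact Hb|]. apply Rplus_le_compat_r, Rmult_le_compat_l; lra. }
        apply Rmult_le_compat_r with (r := w - u) in Hm; [|lra]. lra.
      - apply Rplus_le_compat_l. now apply Rmult_le_compat_l. }
    (* The choice of gam: the term in Z becomes Z/2 and is absorbed on the left. Doubling what
       remains produces the coefficients 1/(K+1) and G0/((K+1) Cg) of A0, and G/2 becomes G. *)
    assert (E : cc * gam = G0 / ((K + 1) * Cg) / 2 + / (K + 1) * n0 / 2 + Z / 2).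
    { unfold cc, gam. field. lra. }
    rewrite E in HV'. unfold A0 in HGs. lra. }
apply Rle_plus_epsilon. intros eps Heps.
assert (HE := exp_pos (2 * L * (t - s))).
assert (M := Main (eps / exp (2 * L * (t - s))) (Rdiv_lt_0_compat _ _ Heps HE)).
replace ((A0 + f0 / L + eps / exp (2 * L * (t - s))) * exp (2 * L * (t - s)))
  with ((A0 + f0 / L) * exp (2 * L * (t - s)) + eps) in M by (field; lra).
unfold A0 in M. lra.
Qed.

Local Notation tau := (greedy_tau m p gam x a b).
Let al := alphac p.
Let M0 := f0 / L + G0 / ((K + 1) * Cg).

(** The sum of |z_a| and the seminorm up to tau k is propagated instead of the supremum: it
    dominates every |z_u| and is subadditive, so a single recursion serves both final bounds. *)
Lemma apriori_greedy (k : nat) :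
  vnorm d (z a) + pvar_semi d p z a (tau k)
  <= (vnorm d (z a) + M0 * INR k) * exp (al * INR k + 2 * L * (tau k - a)).
Proof.
assert (HK : 0 < K) by now apply Kc_gt0.
assert (Hgam : 0 < gam).
{ apply Rinv_0_lt_compat. repeat apply Rmult_lt_0_compat; lra. }
assert (HiK : 0 < / (K + 1)) by (apply Rinv_0_lt_compat; lra).
assert (Hal : exp al = 1 + / (K + 1)) by (unfold al, alphac; rewrite exp_ln; [easy|fold K; lra]).
assert (HM0 : 0 <= M0).
{ unfold M0. assert (0 <= f0 / L) by (apply Rdiv_le_0_compat; [apply drift_const_ge0|lra]).
  assert (0 <= G0 / ((K + 1) * Cg)); [|lra].
  apply Rdiv_le_0_compat; [apply opnorm_ge0|apply Rmult_lt_0_compat; lra]. }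
assert (Hal0 : 0 <= al).
{ destruct (Rle_lt_dec 0 al) as [|Hn]; [easy|]. apply exp_increasing in Hn. rewrite exp_0, Hal in Hn. lra. }
assert (Hza := vnorm_ge0 d (z a)).
induction k as [|k IH].
- simpl. rewrite (semi_refl d p z a b) by (easy || lra).
  rewrite Rmult_0_r, Rminus_diag, !Rmult_0_r, !Rplus_0_r, exp_0. lra.
- assert (Hk := greedy_tau_in m p gam x a b ltac:(lra) Hgam hab hx k).
  destruct (greedy_tau_step m p gam x a b ltac:(lra) Hgam hab hx k) as [Hk1 Hk2].
  rewrite S_INR. set (s := tau k) in *. set (t := tau (S k)) in *.
  set (n := INR k) in *. assert (Hn : 0 <= n) by apply pos_INR.
  set (D := exp (2 * L * (t - s))).
  assert (HD : 1 <= D).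
  { unfold D. assert (E := exp_ineq1_le (2 * L * (t - s))).
    assert (0 <= 2 * L * (t - s)) by (apply Rmult_le_pos; lra). lra. }
  set (Phi := vnorm d (z a) + pvar_semi d p z a s) in *.
  assert (Hzs : vnorm d (z s) <= Phi) by (apply vnorm_le_semi; lra).
  assert (Hzs0 := vnorm_ge0 d (z s)).
  assert (Hstep : vnorm d (z a) + pvar_semi d p z a t <= (exp al * Phi + M0) * D).
  { destruct (proj1 Hk1) as [Hst|Hst].
    - assert (H := apriori_step s t ltac:(lra) ltac:(lra) Hk2). rewrite <- Hal in H. fold M0 D in H.
      assert (Hsub := semi_subadd d p z a b ltac:(lra) hz a s t ltac:(lra) ltac:(lra)).
      apply Rle_trans with (Phi - vnorm d (z s) + (exp al * vnorm d (z s) + M0) * D); [unfold Phi; lra|].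
      assert (He1 : 1 <= exp al * D) by (rewrite Hal; nra).
      assert (0 <= (exp al * D - 1) * (Phi - vnorm d (z s))) by (apply Rmult_le_pos; lra). nra.
    (* A step of length zero, as happens once b is reached: the right-hand side only grows. *)
    - rewrite <- Hst. fold Phi. assert (HPhi : 0 <= Phi) by lra. rewrite Hal.
      assert (H1 : 0 <= / (K + 1) * Phi) by (apply Rmult_le_pos; lra).
      rewrite <- (Rmult_1_r Phi) at 1. apply Rmult_le_compat; lra. }
  eapply Rle_trans; [exact Hstep|].
  replace (exp (al * (n + 1) + 2 * L * (t - a)))
    with (exp al * exp (al * n + 2 * L * (s - a)) * D).
  2: { unfold D. rewrite <- !exp_plus. f_equal. ring. }
  set (E := exp (al * n + 2 * L * (s - a))) in *.
  (* This lets the newly added M0 be multiplied by the exponential, which turns the factor n of M0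
     into n + 1. *)
  assert (HE : 1 <= exp al * E).
  { unfold E. rewrite <- exp_plus.
    assert (E1 := exp_ineq1_le (al + (al * n + 2 * L * (s - a)))).
    assert (0 <= al * n) by (apply Rmult_le_pos; lra).
    assert (0 <= 2 * L * (s - a)) by (apply Rmult_le_pos; lra). lra. }
  rewrite <- Rmult_assoc. apply Rmult_le_compat_r; [lra|].
  assert (Hea := exp_pos al).
  apply Rmult_le_compat_l with (r := exp al) in IH; [|lra]. nra.
Qed.

Lemma apriori_final :
  let N := INR (N_greedy m p Cg x a b) in
  let B := (vnorm d (z a) + M0 * N) * exp (al * N + 2 * L * (b - a)) in
  sup_norm d z a b <= B /\ pvar_norm d p z a b <= B * rpow N ((p - 1) / p).
Proof.
intros N B.
assert (HK : 0 < K) by now apply Kc_gt0.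
assert (Hgam : 0 < gam).
{ apply Rinv_0_lt_compat. repeat apply Rmult_lt_0_compat; lra. }
destruct (N_greedy_spec m p Cg x a b ltac:(lra) Hgam hab hx) as [HN HNb].
assert (H := apriori_greedy (N_greedy m p Cg x a b)).
unfold gam, K in H. rewrite HNb in H. fold N B in H.
assert (HN1 : 1 <= N) by (apply (le_INR 1); easy).
split.
- assert (HL : is_lub (fun s => exists t, a <= t <= b /\ s = vnorm d (z t)) (sup_norm d z a b)).
  { apply sup_lub.
    - exists B. intros s (t & Ht & ->). eapply Rle_trans; [|exact H]. apply vnorm_le_semi; lra.
    - exists (vnorm d (z a)), a. split; [lra|easy]. }
  apply HL. intros s (t & Ht & ->). eapply Rle_trans; [|exact H]. apply vnorm_le_semi; lra.
- unfold pvar_norm. eapply Rle_trans; [exact H|].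
  assert (HB : 0 <= B).
  { eapply Rle_trans; [|exact H]. assert (A1 := vnorm_ge0 d (z a)). assert (A2 := semi_ge0 d p z a b). lra. }
  (* The full norm is already at most B, and N >= 1 makes the remaining factor at least 1. *)
  assert (1 <= rpow N ((p - 1) / p)); [|nra].
  apply Rle_trans with (rpow 1 ((p - 1) / p)); [rewrite rpow_one; lra|].
  apply rpow_le; [apply Rdiv_lt_0_compat; lra|easy].
Qed.

End Apriori.

(** ** Discrete sewing *)

(** The sum of the geometric series of ratio (2/3)^(th-1). Integer intervals cannot always be halved
    exactly, so 2/3 takes the place of 1/2. *)
Definition sewing_const (th : R) : R := / (1 - rpow (2 / 3) (th - 1)).

Lemma sewing_const_spec (th : R) : 1 < th ->
  0 < sewing_const th /\ 1 + sewing_const th * rpow (2 / 3) (th - 1) = sewing_const th.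
Proof.
intros Hth. assert (H : rpow (2 / 3) (th - 1) < rpow 1 (th - 1)) by (apply rpow_lt; lra).
rewrite rpow_one in H. unfold sewing_const. split; [apply Rinv_0_lt_compat; lra|field; lra].
Qed.

(** One factor u is kept outside the power: the shares u and 1 - u of the two pieces then add up to
    1, and only the remaining exponent th - 1 is estimated by 2/3. *)
Lemma rpow_split_le (u l th : R) : 1 < th -> 0 <= u <= 2 / 3 -> 0 <= l ->
  rpow (u * l) th <= u * rpow (2 / 3) (th - 1) * rpow l th.
Proof.
intros Hth Hu Hl. replace th with (1 + (th - 1)) at 1 3 by ring.
assert (Hul : 0 <= u * l) by (apply Rmult_le_pos; lra).
rewrite !rpow_add, !rpow_1 by lra.
assert (H : rpow (u * l) (th - 1) <= rpow (2 / 3 * l) (th - 1)).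
{ apply rpow_le; [lra|]. apply Rmult_le_compat_r; lra. }
rewrite (rpow_mul (2 / 3)) in H by lra.
apply Rmult_le_compat_l with (r := u * l) in H; [|easy]. lra.
Qed.

(* Intervals are split at their middle index; the larger half is at most 2/3 of the whole. *)
Lemma discrete_sewing (d : nat) (th h c : R) (Rm : nat -> nat -> vec) (i0 j0 : nat) :
  1 < th -> 0 < h -> 0 <= c ->
  (forall k, (i0 <= k < j0)%nat -> vnorm d (Rm k (S k)) = 0) ->
  (forall i k j, (i0 <= i < k)%nat -> (k < j <= j0)%nat ->
     vnorm d (vsub (Rm i j) (vadd (Rm i k) (Rm k j))) <= c * rpow ((INR j - INR i) * h) th) ->
  forall i j, (i0 <= i < j)%nat -> (j <= j0)%nat ->
  vnorm d (Rm i j) <= sewing_const th * c * rpow ((INR j - INR i) * h) th.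
Proof.
intros Hth Hh Hc H1 Hd.
destruct (sewing_const_spec th Hth) as [HK HK']. set (K := sewing_const th) in *.
assert (Main : forall n i j, (j - i = n)%nat -> (i0 <= i < j)%nat -> (j <= j0)%nat ->
  vnorm d (Rm i j) <= K * c * rpow ((INR j - INR i) * h) th).
{ intros n. induction n as [n IH] using (well_founded_induction Wf_nat.lt_wf).
  intros i j Hn Hi Hj.
  destruct (Nat.eq_dec n 1) as [->|Hn1].
  - replace j with (S i) by lia. rewrite H1 by lia.
    repeat apply Rmult_le_pos; try lra. apply rpow_ge0.
  (* The share 2/3 is attained at n = 3, which splits into 1 and 2. *)
  - destruct (Nat.Even_or_Odd n) as [[k Hk]|[k Hk]].
    all: assert (Hsplit : forall k', (i < k' < j)%nat -> (3 * (k' - i) <= 2 * n)%nat -> (3 * (j - k') <= 2 * n)%nat ->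
      vnorm d (Rm i j) <= K * c * rpow ((INR j - INR i) * h) th).
    1, 3: intros k' Hk' Ha Hb;
      assert (Ea := IH (k' - i)%nat ltac:(lia) i k' eq_refl ltac:(lia) ltac:(lia));
      assert (Eb := IH (j - k')%nat ltac:(lia) k' j eq_refl ltac:(lia) ltac:(lia));
      assert (Ed := Hd i k' j ltac:(lia) ltac:(lia));
      apply le_INR in Ha, Hb; rewrite !mult_INR, minus_INR in Ha by lia; rewrite !mult_INR, minus_INR in Hb by lia;
      rewrite <- Hn, minus_INR in Ha, Hb by lia; simpl in Ha, Hb;
      assert (Li : INR i < INR k') by (apply lt_INR; lia);
      assert (Lj : INR k' < INR j) by (apply lt_INR; lia);
      set (len := INR j - INR i) in *;
      assert (Hlen : 0 < len) by (unfold len; lra);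
      set (u := (INR k' - INR i) / len);
      assert (Hu : u * len = INR k' - INR i) by (unfold u; field; lra);
      assert (Hu0 : 0 <= u) by (apply Rdiv_le_0_compat; lra);
      assert (Hu1 : u <= 2 / 3) by (apply Rmult_le_reg_r with len; lra);
      assert (Hu2 : 1 / 3 <= u) by (apply Rmult_le_reg_r with len; unfold len in *; lra);
      replace ((INR k' - INR i) * h) with (u * (len * h)) in Ea by (rewrite <- Hu; ring);
      replace ((INR j - INR k') * h) with ((1 - u) * (len * h)) in Eb
        by (replace (INR j - INR k') with (len - u * len) by (unfold len in *; lra); ring);
      assert (Hlh : 0 <= len * h) by (apply Rmult_le_pos; lra);
      assert (Sa := rpow_split_le u (len * h) th Hth ltac:(lra) Hlh);
      assert (Sb := rpow_split_le (1 - u) (len * h) th Hth ltac:(lra) Hlh);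
      set (rho := rpow (2 / 3) (th - 1)) in *;
      set (P := rpow (len * h) th) in *;
      assert (HKc : 0 <= K * c) by (apply Rmult_le_pos; lra);
      apply Rmult_le_compat_l with (r := K * c) in Sa; [|easy];
      apply Rmult_le_compat_l with (r := K * c) in Sb; [|easy];
      eapply Rle_trans; [apply (vnorm_add3_le d _ (vsub (Rm i j) (vadd (Rm i k') (Rm k' j))) (Rm i k') (Rm k' j));
        intros; unfold vsub, vadd; ring|];
      apply Rle_trans with (c * P * (1 + K * rho)); [lra|rewrite HK'; right; ring].
    + apply (Hsplit (i + k)%nat); lia.
    + apply (Hsplit (i + k)%nat); lia. }
intros i j Hi Hj. now apply (Main (j - i)%nat).
Qed.

(** ** Linear growth and Hoelder regularity of discrete schemes *)

Definition vsum (dd : nat -> vec) (j : nat) : vec := fun l => fsum j (fun k => dd k l).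

Lemma vsum_bound (d : nat) (dd : nat -> vec) (e : R) (i j : nat) : (i <= j)%nat ->
  (forall k, (i <= k < j)%nat -> vnorm d (dd k) <= e) ->
  vnorm d (vsub (vsum dd j) (vsum dd i)) <= (INR j - INR i) * e.
Proof.
intros Hij. induction Hij as [|j Hij IH]; intros H.
- rewrite vnorm_zero; [lra|]. intros; unfold vsub; ring.
- eapply Rle_trans; [apply (vnorm_add_le d _ (vsub (vsum dd j) (vsum dd i)) (dd j))|].
  + intros l _. unfold vsub, vsum. simpl. ring.
  + rewrite S_INR. assert (A := IH ltac:(intros; apply H; lia)). assert (B := H j ltac:(lia)). lra.
Qed.

(** The drift sums are removed exactly, so this remainder vanishes on single steps, and its sewing
    defect is (G_k - G_i) (X_j - X_k), with no drift contribution. *)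
Definition scheme_rem (m : nat) (W dd : nat -> vec) (G : nat -> mat) (X : nat -> vec) (i j : nat) : vec :=
  vsub (vsub (vsub (W j) (W i)) (vsub (vsum dd j) (vsum dd i))) (matvec m (G i) (vsub (X j) (X i))).

Section Scheme.

(* W is either an Euler scheme, with dd the drift increments and G = g(W), or the
   difference of two schemes, with G the difference of the two values of g and kap
   the size of the errors. *)
Context (d m N : nat) (q h c kap del : R) (W dd X : nat -> vec) (G : nat -> mat).
Context (hq : / 2 < q < 1) (hh : 0 < h) (hc : 0 <= c) (hk : 0 <= kap).
Context (hdel : 0 < del <= 1).
Context (hdelq : 4 * (1 + 2 * c) * (1 + sewing_const (2 * q)) * rpow del q <= 1).
Context (hX : forall i j, (i <= j <= N)%nat -> vnorm m (vsub (X j) (X i)) <= rpow ((INR j - INR i) * h) q).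
Context (hW : forall k l, (k < N)%nat -> (l < d)%nat ->
  W (S k) l = W k l + dd k l + matvec m (G k) (vsub (X (S k)) (X k)) l).
Context (hdd : forall k, (k < N)%nat -> vnorm d (dd k) <= (kap + c * vnorm d (W k)) * h).
Context (hG : forall k, (k <= N)%nat -> opnorm d m (G k) <= kap + c * vnorm d (W k)).
Context (hGG : forall i k, (i <= k <= N)%nat -> (INR k - INR i) * h <= del ->
  opnorm d m (msub (G k) (G i)) <= c * vnorm d (vsub (W k) (W i))
    + c * (vnorm d (W i) + vnorm d (W k)) * rpow ((INR k - INR i) * h) q).

Let K := sewing_const (2 * q).
Let CH := 4 * (1 + 2 * c).

Lemma scheme_rem_step (k : nat) : (k < N)%nat -> vnorm d (scheme_rem m W dd G X k (S k)) = 0.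
Proof.
intros Hk. apply vnorm_zero. intros l Hl. unfold scheme_rem, vsub at 1 2 3 4, vsum. simpl.
rewrite (hW k l Hk Hl). ring.
Qed.

Lemma len_ge0 (i j : nat) : (i <= j)%nat -> 0 <= (INR j - INR i) * h.
Proof. intros H. apply le_INR in H. apply Rmult_le_pos; lra. Qed.

Lemma len_mono (i i' j' j : nat) : (i <= i')%nat -> (i' <= j')%nat -> (j' <= j)%nat ->
  (INR j' - INR i') * h <= (INR j - INR i) * h.
Proof. intros H1 H2 H3. apply le_INR in H1, H2, H3. apply Rmult_le_compat_r; lra. Qed.

Lemma scheme_rem_bound (S0 : R) (i0 j1 j2 : nat) : (j1 <= N)%nat -> (j2 <= S j1)%nat -> (j2 <= N)%nat ->
  (INR j1 - INR i0) * h <= del -> 0 <= S0 ->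
  (forall i k, (i0 <= i <= k)%nat -> (k <= j1)%nat ->
     vnorm d (vsub (W k) (W i)) <= CH * S0 * rpow ((INR k - INR i) * h) q) ->
  (forall k, (i0 <= k <= j1)%nat -> vnorm d (W k) <= 2 * S0) ->
  forall i j, (i0 <= i < j)%nat -> (j <= j2)%nat ->
  vnorm d (scheme_rem m W dd G X i j) <= K * (c * (CH + 4) * S0) * rpow ((INR j - INR i) * h) (2 * q).
Proof.
intros Hj1 Hj2 Hj2N Hwin HS Hhol Hsup.
assert (HCH : 0 <= CH) by (unfold CH; lra).
apply discrete_sewing; [lra|easy| | |].
- repeat apply Rmult_le_pos; lra.
- intros k Hk. apply scheme_rem_step. lia.
- intros i k j Hi Hj.
  rewrite (vnorm_ext d _ (matvec m (msub (G k) (G i)) (vsub (X j) (X k)))).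
  2: { intros l _. unfold scheme_rem, vadd. unfold vsub at 1 2 3 4 5 7 8 9 10 12 13 14 15.
       rewrite matvec_msub, !matvec_vsub. ring. }
  eapply Rle_trans; [apply matvec_opnorm|].
  assert (Hl1 := len_ge0 i k ltac:(lia)). assert (Hl2 := len_ge0 k j ltac:(lia)).
  assert (Hl3 := len_mono i i k j ltac:(lia) ltac:(lia) ltac:(lia)).
  assert (Hl4 := len_mono i k j j ltac:(lia) ltac:(lia) ltac:(lia)).
  assert (Hl5 := len_mono i0 i k j1 ltac:(lia) ltac:(lia) ltac:(lia)).
  replace (2 * q) with (q + q) by ring. rewrite rpow_add, <- Rmult_assoc.
  apply Rmult_le_compat; [apply opnorm_ge0|apply vnorm_ge0| |].
  + eapply Rle_trans; [apply hGG; [lia|lra]|].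
    assert (A := Hhol i k ltac:(lia) ltac:(lia)).
    assert (B1 := Hsup i ltac:(lia)). assert (B2 := Hsup k ltac:(lia)).
    assert (P0 := rpow_ge0 ((INR k - INR i) * h) q).
    assert (P1 : rpow ((INR k - INR i) * h) q <= rpow ((INR j - INR i) * h) q) by (apply rpow_le; lra).
    set (P := rpow ((INR k - INR i) * h) q) in *.
    (* c CH comes from the Hoelder bound on W, and 4c from the two values of W in the second term,
       each at most 2 S0. *)
    apply Rle_trans with (c * (CH + 4) * S0 * P).
    * apply Rmult_le_compat_l with (r := c) in A; [|easy].
      assert (B : c * (vnorm d (W i) + vnorm d (W k)) * P <= c * (4 * S0) * P).
      { apply Rmult_le_compat_r; [easy|]. apply Rmult_le_compat_l; lra. }
      lra.
    * apply Rmult_le_compat_l; [|easy]. repeat apply Rmult_le_pos; lra.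
  + eapply Rle_trans; [apply hX; lia|]. apply rpow_le; lra.
Qed.

(** On a window of clock length del the Hoelder constant is proportional to S0. Drift and
    first-order term contribute (1+2c) S0 each and the sewing remainder 2 (1+2c) S0, in total CH
    S0. *)
Lemma scheme_window (i0 j0 : nat) : (i0 <= j0 <= N)%nat -> (INR j0 - INR i0) * h <= del ->
  let S0 := vnorm d (W i0) + kap in
  (forall i j, (i0 <= i <= j)%nat -> (j <= j0)%nat ->
     vnorm d (vsub (W j) (W i)) <= CH * S0 * rpow ((INR j - INR i) * h) q) /\
  (forall i j, (i0 <= i < j)%nat -> (j <= j0)%nat ->
     vnorm d (scheme_rem m W dd G X i j) <= K * (c * (CH + 4) * S0) * rpow ((INR j - INR i) * h) (2 * q)) /\
  (forall i, (i0 <= i <= j0)%nat -> vnorm d (W i) <= vnorm d (W i0) + S0).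
Proof.
intros Hj0 Hwin S0.
assert (HW0 := vnorm_ge0 d (W i0)).
assert (HS : 0 <= S0) by (unfold S0; lra).
destruct (sewing_const_spec (2 * q) ltac:(lra)) as [HK _]. fold K in HK.
assert (HCH : 0 < CH) by (unfold CH; lra).
assert (Hdq0 := rpow_ge0 del q).
(* The first inequality keeps the increments of W over the window below S0, so W stays below 2 S0;
   the second makes the sewing remainder small enough for the Hoelder induction. *)
assert (HKd : 4 * (1 + 2 * c) * rpow del q <= 1 /\ 4 * (1 + 2 * c) * K * rpow del q <= 1).
{ fold K in hdelq.
  assert (0 <= 4 * (1 + 2 * c) * rpow del q) by (apply Rmult_le_pos; lra).
  assert (0 <= 4 * (1 + 2 * c) * K * rpow del q) by (repeat apply Rmult_le_pos; lra). lra. }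
destruct HKd as [Hd1 Hd2].
assert (Hsup : forall j1, (j1 <= j0)%nat ->
  (forall i k, (i0 <= i <= k)%nat -> (k <= j1)%nat ->
     vnorm d (vsub (W k) (W i)) <= CH * S0 * rpow ((INR k - INR i) * h) q) ->
  forall k, (i0 <= k <= j1)%nat -> vnorm d (W k) <= vnorm d (W i0) + S0).
{ intros j1 Hj1 Hhol k Hk. eapply Rle_trans; [apply (vnorm_le_sub d (W k) (W i0))|].
  apply Rplus_le_compat_l. eapply Rle_trans; [apply Hhol; lia|].
  assert (A := len_mono i0 i0 k j0 ltac:(lia) ltac:(lia) ltac:(lia)).
  assert (B : rpow ((INR k - INR i0) * h) q <= rpow del q) by (apply rpow_le; lra).
  apply Rmult_le_compat_l with (r := CH * S0) in B; [|apply Rmult_le_pos; lra].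
  eapply Rle_trans; [exact B|]. fold CH in Hd1. apply Rmult_le_compat_l with (r := S0) in Hd1; [|easy]. lra. }
(* The sewing defect of (i, k, j1) only involves W up to k < j1, so the Hoelder bound
   propagates from j1 - 1 to j1 with the same constant. *)
assert (Hhol : forall n j1, (j1 = i0 + n)%nat -> (j1 <= j0)%nat ->
  forall i k, (i0 <= i <= k)%nat -> (k <= j1)%nat ->
     vnorm d (vsub (W k) (W i)) <= CH * S0 * rpow ((INR k - INR i) * h) q).
{ induction n as [|n IH]; intros j1 Hj Hj1 i k Hi Hk.
  - rewrite vnorm_zero; [repeat apply Rmult_le_pos; try lra; apply rpow_ge0|].
    intros l _. replace k with i by lia. unfold vsub. ring.
  - specialize (IH (i0 + n)%nat eq_refl ltac:(lia)).
    destruct (Nat.eq_dec k j1) as [->|Hne]; [|apply IH; lia].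
    destruct (Nat.eq_dec i j1) as [->|Hne'].
    { rewrite vnorm_zero; [repeat apply Rmult_le_pos; try lra; apply rpow_ge0|].
      intros l _. unfold vsub. ring. }
    assert (Hsup' := Hsup (i0 + n)%nat ltac:(lia) IH).
    assert (Hw1 := len_mono i0 i0 (i0 + n) j0 ltac:(lia) ltac:(lia) ltac:(lia)).
    assert (HR := scheme_rem_bound S0 i0 (i0 + n) j1 ltac:(lia) ltac:(lia) ltac:(lia) ltac:(lra) HS IH
      ltac:(intros k0 Hk0; assert (A := Hsup' k0 Hk0); unfold S0 in *; lra) i j1 ltac:(lia) ltac:(lia)).
    assert (HD : vnorm d (vsub (vsum dd j1) (vsum dd i)) <= (INR j1 - INR i) * ((1 + 2 * c) * S0 * h)).
    { apply vsum_bound; [lia|]. intros k Hk'. eapply Rle_trans; [apply hdd; lia|].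
      apply Rmult_le_compat_r; [lra|]. assert (A := Hsup' k ltac:(lia)).
      apply Rmult_le_compat_l with (r := c) in A; [|easy]. unfold S0 in *.
      assert (0 <= c * kap) by (apply Rmult_le_pos; lra). lra. }
    assert (HGX : vnorm d (matvec m (G i) (vsub (X j1) (X i))) <= (1 + 2 * c) * S0 * rpow ((INR j1 - INR i) * h) q).
    { eapply Rle_trans; [apply matvec_opnorm|]. apply Rmult_le_compat; [apply opnorm_ge0|apply vnorm_ge0| |apply hX; lia].
      eapply Rle_trans; [apply hG; lia|]. assert (A := Hsup' i ltac:(lia)).
      apply Rmult_le_compat_l with (r := c) in A; [|easy]. unfold S0 in *.
      assert (0 <= c * kap) by (apply Rmult_le_pos; lra). lra. }
    assert (Hl0 := len_ge0 i j1 ltac:(lia)).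
    assert (Hl1 := len_mono i0 i j1 j0 ltac:(lia) ltac:(lia) ltac:(lia)).
    set (len := (INR j1 - INR i) * h) in *.
    assert (HP0 := rpow_ge0 len q).
    assert (HP1 : len <= rpow len q).
    { rewrite <- (rpow_1 len) at 1 by easy. replace 1 with (q + (1 - q)) by ring. rewrite rpow_add.
      rewrite <- (Rmult_1_r (rpow len q)) at 2. apply Rmult_le_compat_l; [easy|].
      apply rpow_le_one; lra. }
    assert (HP2 : rpow len (2 * q) <= rpow len q * rpow del q).
    { replace (2 * q) with (q + q) by ring. rewrite rpow_add. apply Rmult_le_compat_l; [easy|]. apply rpow_le; lra. }
    set (P := rpow len q) in *.
    eapply Rle_trans.
    { apply (vnorm_add3_le d _ (vsub (vsum dd j1) (vsum dd i)) (matvec m (G i) (vsub (X j1) (X i)))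
        (scheme_rem m W dd G X i j1)).
      intros l _. unfold scheme_rem. unfold vsub at 1 2 4 5 6 7. ring. }
    assert (Hc1 : 0 <= K * (c * (CH + 4) * S0)) by (repeat apply Rmult_le_pos; lra).
    apply Rmult_le_compat_l with (r := K * (c * (CH + 4) * S0)) in HP2; [|easy].
    assert (Hc2 : K * (c * (CH + 4) * S0) * (P * rpow del q) <= 2 * (1 + 2 * c) * S0 * P).
    { assert (HSP : 0 <= S0 * P) by now apply Rmult_le_pos.
      assert (H8 : c * (CH + 4) * (K * rpow del q) <= 2 * (1 + 2 * c)).
      { assert (Hk0 : 0 <= K * rpow del q) by (apply Rmult_le_pos; lra).
        apply Rle_trans with (2 * c * (4 * (1 + 2 * c) * K * rpow del q)).
        - unfold CH. replace (2 * c * (4 * (1 + 2 * c) * K * rpow del q)) with (c * (8 * (1 + 2 * c)) * (K * rpow del q)) by ring.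
          apply Rmult_le_compat_r; [easy|]. apply Rmult_le_compat_l; lra.
        - apply Rmult_le_compat_l with (r := 2 * c) in Hd2; lra. }
      apply Rmult_le_compat_r with (r := S0 * P) in H8; [|easy]. lra. }
    assert (HcS : 0 <= (1 + 2 * c) * S0) by (apply Rmult_le_pos; lra).
    apply Rmult_le_compat_l with (r := (1 + 2 * c) * S0) in HP1; [|easy].
    replace ((INR j1 - INR i) * ((1 + 2 * c) * S0 * h)) with ((1 + 2 * c) * S0 * len) in HD by (unfold len; ring).
    unfold CH. unfold CH in HR, HP2, Hc2. lra. }
specialize (Hhol (j0 - i0)%nat j0 ltac:(lia) ltac:(lia)).
assert (Hsup' := Hsup j0 ltac:(lia) Hhol).
split; [easy|]. split; [|easy].
apply scheme_rem_bound with j0; try lia; try easy.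
intros k Hk. assert (A := Hsup' k Hk). unfold S0 in *. lra.
Qed.

(** By [scheme_window], |W| + kap at most doubles across a block of N0 steps. Refining the grid
    lengthens the blocks in steps but not in clock time, so the number of doublings does not depend
    on the mesh. *)
Lemma scheme_blocks (N0 B : nat) : INR N0 * h <= del -> (N = B * N0)%nat ->
  forall k i, (i <= k * N0)%nat -> (i <= N)%nat -> vnorm d (W i) + kap <= 2 ^ k * (vnorm d (W O) + kap).
Proof.
intros HN0 HN. induction k as [|k IH]; intros i Hi HiN.
- replace i with O by lia. simpl. lra.
- simpl pow. destruct (le_lt_dec i (k * N0)) as [Hle|Hlt].
  + assert (A := IH i Hle HiN). assert (0 <= vnorm d (W i)) by apply vnorm_ge0. lra.
  + assert (A := IH (k * N0)%nat ltac:(lia) ltac:(lia)).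
    destruct (scheme_window (k * N0) i) as (_ & _ & H); [lia| |].
    * eapply Rle_trans; [|exact HN0]. apply Rmult_le_compat_r; [lra|].
      assert (INR i <= INR (k * N0 + N0)) by (apply le_INR; simpl in Hi; lia).
      rewrite plus_INR in H. lra.
    * specialize (H i ltac:(lia)). lra.
Qed.

End Scheme.

(** ** Euler schemes along the intrinsic clock of the driver *)

Lemma rpow_small (A q : R) : 0 <= A -> 0 < q -> exists del, 0 < del <= 1 /\ A * rpow del q <= 1.
Proof.
intros HA Hq. assert (HiA : 0 < / (1 + A)) by (apply Rinv_0_lt_compat; lra).
assert (HiA1 : / (1 + A) * (1 + A) = 1) by (field; lra).
exists (rpow (/ (1 + A)) (1 / q)). split; [split|].
- now apply rpow_gt0.
- apply rpow_le_one; [apply Rdiv_lt_0_compat; lra|]. nra.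
- rewrite rpow_inv_l by lra. nra.
Qed.

Lemma level_small (T del : R) : 0 < T -> 0 < del -> exists n0, forall n, (n0 <= n)%nat -> T / 2 ^ n <= del.
Proof.
intros HT Hd. destruct (Pow_x_infinity 2 ltac:(rewrite Rabs_pos_eq; lra) (T / del)) as [N HN].
exists N. intros n Hn. specialize (HN n Hn). rewrite Rabs_pos_eq in HN by (apply pow_le; lra).
assert (Hp : 0 < 2 ^ n) by (apply pow_lt; lra).
apply Rmult_le_reg_r with (2 ^ n); [easy|]. unfold Rdiv. rewrite Rmult_assoc, Rinv_l, Rmult_1_r by lra.
apply Rge_le in HN. apply Rmult_le_compat_l with (r := del) in HN; [|lra].
replace (del * (T / del)) with T in HN by (field; lra). lra.
Qed.

(** Since C = C' (1 - r), the increments telescope against C' E n. The limit is the supremum of u n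
    - C' E n, each of which lies below every u k + C' E k. *)
Lemma geometric_limit (u E : nat -> R) (C r : R) (n0 : nat) : 0 < r < 1 -> 0 <= C ->
  (forall n, 0 < E n) -> (forall n, E (S n) = r * E n) ->
  (forall n, (n0 <= n)%nat -> Rabs (u (S n) - u n) <= C * E n) ->
  exists l, forall n, (n0 <= n)%nat -> Rabs (u n - l) <= C / (1 - r) * E n.
Proof.
intros Hr HC HE HS Hu. set (C' := C / (1 - r)).
assert (HC' : 0 <= C') by (apply Rdiv_le_0_compat; lra).
assert (HCC : C' * (1 - r) = C) by (unfold C'; field; lra).
assert (Hstep : forall k n, (n0 <= n)%nat -> Rabs (u (n + k)%nat - u n) <= C' * E n - C' * E (n + k)%nat).
{ induction k as [|k IH]; intros n Hn.
  - rewrite Nat.add_0_r, Rminus_diag, Rabs_R0. lra.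
  - rewrite Nat.add_succ_r. assert (A := IH n Hn). assert (B := Hu (n + k)%nat ltac:(lia)).
    rewrite HS, <- HCC in *.
    replace (u (S (n + k)) - u n) with ((u (S (n + k)) - u (n + k)%nat) + (u (n + k)%nat - u n)) by ring.
    eapply Rle_trans; [apply Rabs_triang|]. lra. }
assert (Hle : forall n k, (n0 <= n)%nat -> (n0 <= k)%nat -> u n - C' * E n <= u k + C' * E k).
{ intros n k Hn Hk. assert (En := HE n). assert (Ek := HE k).
  assert (Pn : 0 <= C' * E n) by (apply Rmult_le_pos; lra). assert (Pk : 0 <= C' * E k) by (apply Rmult_le_pos; lra).
  destruct (le_lt_dec n k) as [H|H].
  - assert (A := Hstep (k - n)%nat n Hn). replace (n + (k - n))%nat with k in A by lia.
    apply Rcomplements.Rabs_le_between in A. lra.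
  - assert (A := Hstep (n - k)%nat k Hk). replace (k + (n - k))%nat with n in A by lia.
    apply Rcomplements.Rabs_le_between in A. lra. }
destruct (completeness (fun z => exists n, (n0 <= n)%nat /\ z = u n - C' * E n)) as [l [Hl Hl']].
- exists (u n0 + C' * E n0). intros z (n & Hn & ->). now apply Hle.
- exists (u n0 - C' * E n0), n0. split; [lia|easy].
- exists l. intros n Hn.
  assert (u n - C' * E n <= l) by (apply Hl; now exists n).
  assert (l <= u n + C' * E n) by (apply Hl'; intros z (k & Hk & ->); now apply Hle).
  apply Rabs_le. lra.
Qed.

Section Euler.

Context (d m : nat) (p a b L Cg C4 : R) (hd : vec -> vec) (g : vec -> mat) (x : R -> vec) (ya : vec).
Context (hp : 1 < p < 2) (hab : a < b) (hL : 0 <= L) (hCg : 0 <= Cg) (hC4 : 0 <= C4).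
Context (hhd : lipschitz_v d hd L) (hg : lipschitz_m d m g Cg) (hx : Cpvar m p x a b).
Context (hfour : forall u v u' v', opnorm d m (msub (msub (g u) (g v)) (msub (g u') (g v')))
  <= C4 * (vnorm d (vsub (vsub u v) (vsub u' v'))
     + vnorm d (vsub u' v') * (vnorm d (vsub u u') + vnorm d (vsub v v')))).

Let q := 1 / p.

Lemma inv_p_bounds : / 2 < q < 1.
Proof.
unfold q. split.
- apply Rmult_lt_reg_r with p; [lra|]. unfold Rdiv. rewrite Rmult_1_l, Rinv_l; lra.
- apply Rmult_lt_reg_r with p; [lra|]. unfold Rdiv. rewrite Rmult_1_l, Rinv_l; lra.
Qed.

Lemma hd_growth (u : vec) : vnorm d (hd u) <= L * vnorm d u + vnorm d (hd vzero).
Proof.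
eapply Rle_trans; [apply (vnorm_le_sub d _ (hd vzero))|]. rewrite Rplus_comm. apply Rplus_le_compat_r.
eapply Rle_trans; [apply hhd|]. right. f_equal. apply vnorm_ext. intros; unfold vsub, vzero; ring.
Qed.

(* The summand t - a makes the clock strictly increasing, hence invertible. *)
Definition clock (m : nat) (p : R) (x : R -> vec) (a t : R) : R := pvar_pow m p x a t + (t - a).
Let F := clock m p x a.
Let T := F b.

Lemma clock_start : F a = 0.
Proof. unfold F, clock. rewrite (pvar_pow_refl m p x a b) by (easy || lra). ring. Qed.

Lemma clock_incr (s t : R) : a <= s <= t -> t <= b -> pvar_pow m p x s t + (t - s) <= F t - F s.
Proof.
intros Hs Ht. unfold F, clock.
assert (A := pvar_pow_superadd m p x a b hx a s t ltac:(lra) ltac:(lra)). lra.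
Qed.

Lemma clock_dominates (s t : R) : a <= s <= t -> t <= b ->
  t - s <= F t - F s /\ pvar_pow m p x s t <= F t - F s /\ 0 <= F t - F s.
Proof.
intros Hs Ht. assert (A := clock_incr s t Hs Ht).
assert (B := pvar_pow_ge0 m p x a b hx s t ltac:(lra) ltac:(lra)). lra.
Qed.

Lemma clock_semi (s t : R) : a <= s <= t -> t <= b -> pvar_semi m p x s t <= rpow (F t - F s) q.
Proof.
intros Hs Ht. apply rpow_le; [assert (A := inv_p_bounds); fold q; lra|]. now apply clock_dominates.
Qed.

Lemma clock_inc (s t : R) : a <= s <= t -> t <= b -> vnorm m (vsub (x t) (x s)) <= rpow (F t - F s) q.
Proof.
intros Hs Ht. eapply Rle_trans; [|now apply clock_semi].
apply (inc_le_semi m p x a b); lra || easy.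
Qed.

Lemma clock_end_gt0 : 0 < T.
Proof.
destruct (clock_dominates a b) as (A & _ & _); try lra. rewrite clock_start in A. unfold T. lra.
Qed.

Lemma clock_cont : cont_in F a b.
Proof.
intros t0 H0 eps Heps.
assert (Hl : continuity (fun u => u - a)) by reg.
destruct (cont_in_lin (fun u => pvar_pow m p x a u) (fun u => u - a) 1 1 a b
  (pvar_pow_cont m p x a b ltac:(lra) hx a b ltac:(lra) ltac:(lra))
  (cont_in_continuity _ a b Hl) t0 H0 eps Heps) as (del & Hd & H).
exists del. split; [easy|]. intros u Hu Hut. specialize (H u Hu Hut). now rewrite !Rmult_1_l in H.
Qed.

Definition clock_inv (m : nat) (p : R) (x : R -> vec) (a b u : R) : R :=
  epsilon (inhabits a) (fun t => a <= t <= b /\ clock m p x a t = u).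

Lemma clock_inv_spec (u : R) : 0 <= u <= T -> a <= clock_inv m p x a b u <= b /\ F (clock_inv m p x a b u) = u.
Proof.
intros Hu. apply (epsilon_spec (inhabits a) (fun t => a <= t <= b /\ clock m p x a t = u)).
apply (cont_in_ivt (clock m p x a) a b u); [lra|exact clock_cont|].
fold F T. rewrite clock_start. exact Hu.
Qed.

(** * Dyadic grids, equidistant in clock time *)

Definition grid_step (m : nat) (p : R) (x : R -> vec) (a b : R) (n : nat) : R := clock m p x a b / 2 ^ n.
Definition grid (m : nat) (p : R) (x : R -> vec) (a b : R) (n i : nat) : R :=
  clock_inv m p x a b (INR i * grid_step m p x a b n).

Local Notation h := (grid_step m p x a b).
Local Notation tau := (grid m p x a b).

Lemma grid_step_gt0 (n : nat) : 0 < h n.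
Proof. apply Rdiv_lt_0_compat; [apply clock_end_gt0|apply pow_lt; lra]. Qed.

Lemma grid_step_total (n : nat) : INR (2 ^ n) * h n = T.
Proof.
unfold grid_step. rewrite pow_INR. replace (INR 2) with 2 by (simpl; ring). fold F T.
field. apply pow_nonzero; lra.
Qed.

Lemma grid_spec (n i : nat) : (i <= 2 ^ n)%nat -> a <= tau n i <= b /\ F (tau n i) = INR i * h n.
Proof.
intros Hi. apply clock_inv_spec. assert (H := grid_step_gt0 n). split.
- apply Rmult_le_pos; [apply pos_INR|lra].
- rewrite <- (grid_step_total n). apply le_INR in Hi. apply Rmult_le_compat_r; lra.
Qed.

Lemma clock_le_inv (s t : R) : a <= s <= b -> a <= t <= b -> F s <= F t -> s <= t.
Proof.
intros Hs Ht H. apply Rnot_lt_le. intros Hlt.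
destruct (clock_dominates t s) as (A & _ & _); lra.
Qed.

Lemma grid_mono (n i j : nat) : (i <= j <= 2 ^ n)%nat -> tau n i <= tau n j.
Proof.
intros H. destruct (grid_spec n i ltac:(lia)) as [A A']. destruct (grid_spec n j ltac:(lia)) as [B B'].
apply clock_le_inv; [easy|easy|]. rewrite A', B'. apply Rmult_le_compat_r.
- assert (G := grid_step_gt0 n). lra.
- apply le_INR; lia.
Qed.

Lemma grid_incr (n i j : nat) : (i <= j <= 2 ^ n)%nat ->
  0 <= tau n j - tau n i <= (INR j - INR i) * h n /\
  vnorm m (vsub (x (tau n j)) (x (tau n i))) <= rpow ((INR j - INR i) * h n) q.
Proof.
intros H. assert (M := grid_mono n i j H).
destruct (grid_spec n i ltac:(lia)) as [A A']. destruct (grid_spec n j ltac:(lia)) as [B B'].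
destruct (clock_dominates (tau n i) (tau n j)) as (D1 & _ & _); [lra|lra|].
assert (E := clock_inc (tau n i) (tau n j) ltac:(lra) ltac:(lra)).
rewrite A', B' in D1, E. replace ((INR j - INR i) * h n) with (INR j * h n - INR i * h n) by ring.
split; [lra|easy].
Qed.

Lemma grid_start (n : nat) : tau n 0 = a.
Proof.
destruct (grid_spec n 0 ltac:(lia)) as [A A']. simpl in A'. rewrite Rmult_0_l in A'.
destruct (clock_dominates a (tau n 0)) as (D1 & _ & _); [lra|lra|]. rewrite clock_start in D1. lra.
Qed.

Lemma grid_step_S (n : nat) : h n = 2 * h (S n).
Proof. unfold grid_step. simpl. field. apply pow_nonzero; lra. Qed.

Lemma grid_refine (n i : nat) : tau (S n) (2 * i) = tau n i.
Proof. unfold grid. f_equal. rewrite mult_INR, (grid_step_S n). simpl. ring. Qed.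

Lemma grid_step_antitone (n n' : nat) : (n <= n')%nat -> h n' <= h n.
Proof.
intros H. induction H as [|n' H IH]; [lra|]. assert (A := grid_step_S n'). assert (B := grid_step_gt0 (S n')). lra.
Qed.

Lemma grid_block (n n0 : nat) : (n0 <= n)%nat -> INR (2 ^ (n - n0)) * h n = h n0.
Proof.
intros H. unfold grid_step. rewrite pow_INR. replace (INR 2) with 2 by (simpl; ring).
replace n with (n0 + (n - n0))%nat at 2 by lia. rewrite pow_add.
field. split; apply pow_nonzero; lra.
Qed.

(** * The Euler scheme: uniform bounds and stability *)

Fixpoint euler (d m : nat) (hd : vec -> vec) (g : vec -> mat) (x : R -> vec) (tm : nat -> R) (ya : vec) (i : nat) : vec :=
  match i with
  | O => ya
  | S k => let y := euler d m hd g x tm ya k in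
           vadd y (vadd (vscale (tm (S k) - tm k) (hd y)) (matvec m (g y) (vsub (x (tm (S k))) (x (tm k)))))
  end.

Local Notation Y n := (euler d m hd g x (tau n) ya).

(** Replaces the full drift sum by the drift frozen at the left end, which is how [scheme_rem] is
    converted into [davie]. *)
Lemma vsum_const_sub (tm : nat -> R) (w : nat -> vec) (v0 : vec) (i j l : nat) : (i <= j)%nat ->
  vsum (fun k => vscale (tm (S k) - tm k) (vsub (w k) v0)) j l
  - vsum (fun k => vscale (tm (S k) - tm k) (vsub (w k) v0)) i l
  = vsum (fun k => vscale (tm (S k) - tm k) (w k)) j l
  - vsum (fun k => vscale (tm (S k) - tm k) (w k)) i l - (tm j - tm i) * v0 l.
Proof.
intros H. induction H as [|j H IH]; [ring|].
unfold vsum in *. simpl. unfold vscale, vsub in *. lra.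
Qed.

Lemma len_le_pow (len : R) : 0 <= len <= 1 -> len <= rpow len q.
Proof.
intros H. assert (Hq := inv_p_bounds). rewrite <- (rpow_1 len) at 1 by lra.
replace 1 with (q + (1 - q)) by ring. rewrite rpow_add.
rewrite <- (Rmult_1_r (rpow len q)) at 2. apply Rmult_le_compat_l; [apply rpow_ge0|].
apply rpow_le_one; lra.
Qed.

(** The error of one Euler step from s to t, in the sense of Davie. A bound by a power of the clock
    increment greater than 1 makes the errors over a fine partition sum to something small. *)
Definition davie (d m : nat) (hd : vec -> vec) (g : vec -> mat) (x : R -> vec) (u v : vec) (s t : R) : vec :=
  vsub (vsub v u) (vadd (vscale (t - s) (hd u)) (matvec m (g u) (vsub (x t) (x s)))).

Lemma euler_bound : exists (n1 : nat) (C : R), 0 <= C /\ h n1 <= 1 /\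
  forall n, (n1 <= n)%nat ->
  (forall i, (i <= 2 ^ n)%nat -> vnorm d (Y n i) <= C) /\
  (forall i j, (i <= j <= 2 ^ n)%nat -> (INR j - INR i) * h n <= h n1 ->
    vnorm d (vsub (Y n j) (Y n i)) <= C * rpow ((INR j - INR i) * h n) q /\
    vnorm d (davie d m hd g x (Y n i) (Y n j) (tau n i) (tau n j)) <= C * rpow ((INR j - INR i) * h n) (2 * q)).
Proof.
assert (Hq := inv_p_bounds).
set (f0 := vnorm d (hd vzero)). set (G0 := opnorm d m (g vzero)).
assert (Hf0 : 0 <= f0) by apply vnorm_ge0. assert (HG0 : 0 <= G0) by apply opnorm_ge0.
set (c := L + Cg). set (kap := f0 + G0). set (K := sewing_const (2 * q)).
destruct (sewing_const_spec (2 * q) ltac:(lra)) as [HK _]. fold K in HK.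
assert (Hc : 0 <= c) by (unfold c; lra). assert (Hkap : 0 <= kap) by (unfold kap; lra).
destruct (rpow_small (4 * (1 + 2 * c) * (1 + K)) q) as (del & Hdel & Hdelq);
  [repeat apply Rmult_le_pos; lra|lra|].
destruct (level_small T del clock_end_gt0 ltac:(lra)) as [n1 Hn1].
assert (Hh1 : h n1 <= del) by (apply Hn1; lia).
set (CH := 4 * (1 + 2 * c)).
assert (HCH : 0 <= CH) by (unfold CH; lra).
(* 2^n1 blocks of clock length h n1 cover the whole clock interval, and each doubles |Y| + kap at
   most. *)
set (M := 2 ^ (2 ^ n1) * (vnorm d ya + kap)).
assert (HM : 0 <= M).
{ apply Rmult_le_pos; [apply pow_le; lra|]. assert (A := vnorm_ge0 d ya). lra. }
assert (HCM : 0 <= CH * M) by now apply Rmult_le_pos.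
set (CR := K * (c * (CH + 4) * M)).
assert (HCR : 0 <= CR).
{ unfold CR. apply Rmult_le_pos; [lra|]. apply Rmult_le_pos; [apply Rmult_le_pos; lra|easy]. }
exists n1, (M + CH * M + CR + L * (CH * M)).
assert (HLM : 0 <= L * (CH * M)) by now apply Rmult_le_pos.
split; [lra|]. split; [lra|]. intros n Hn.
assert (Hh := grid_step_gt0 n).
set (dd := fun k => vscale (tau n (S k) - tau n k) (hd (Y n k))).
assert (hXn : forall i j, (i <= j <= 2 ^ n)%nat ->
  vnorm m (vsub (x (tau n j)) (x (tau n i))) <= rpow ((INR j - INR i) * h n) q)
  by (intros i j Hij; now apply grid_incr).
assert (hWn : forall k l, (k < 2 ^ n)%nat -> (l < d)%nat ->
  Y n (S k) l = Y n k l + dd k l + matvec m (g (Y n k)) (vsub (x (tau n (S k))) (x (tau n k))) l).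
{ intros k l _ _. simpl euler. unfold vadd at 1 2. unfold dd. ring. }
assert (hddn : forall k, (k < 2 ^ n)%nat -> vnorm d (dd k) <= (kap + c * vnorm d (Y n k)) * h n).
{ intros k Hk. unfold dd. rewrite vnorm_scale.
  destruct (grid_incr n k (S k) ltac:(lia)) as [Hi _]. rewrite S_INR in Hi.
  rewrite Rabs_pos_eq, Rmult_comm by lra.
  apply Rmult_le_compat; [apply vnorm_ge0|lra| |lra].
  assert (A := hd_growth (Y n k)). fold f0 in A. unfold kap, c.
  assert (0 <= Cg * vnorm d (Y n k)) by (apply Rmult_le_pos; [lra|apply vnorm_ge0]). lra. }
assert (hGn : forall k, (k <= 2 ^ n)%nat -> opnorm d m (g (Y n k)) <= kap + c * vnorm d (Y n k)).
{ intros k _. eapply Rle_trans; [apply (g_growth d m Cg g hg)|]. fold G0. unfold kap, c.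
  assert (0 <= L * vnorm d (Y n k)) by (apply Rmult_le_pos; [lra|apply vnorm_ge0]). lra. }
assert (hGGn : forall i k, (i <= k <= 2 ^ n)%nat -> (INR k - INR i) * h n <= del ->
  opnorm d m (msub (g (Y n k)) (g (Y n i))) <= c * vnorm d (vsub (Y n k) (Y n i))
    + c * (vnorm d (Y n i) + vnorm d (Y n k)) * rpow ((INR k - INR i) * h n) q).
{ intros i k _ _. eapply Rle_trans; [apply hg|].
  assert (A1 := vnorm_ge0 d (Y n i)). assert (A2 := vnorm_ge0 d (Y n k)).
  assert (A3 := vnorm_ge0 d (vsub (Y n k) (Y n i))).
  assert (A4 := rpow_ge0 ((INR k - INR i) * h n) q).
  assert (0 <= c * (vnorm d (Y n i) + vnorm d (Y n k)) * rpow ((INR k - INR i) * h n) q)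
    by (repeat apply Rmult_le_pos; lra).
  assert (0 <= L * vnorm d (vsub (Y n k) (Y n i))) by now apply Rmult_le_pos.
  unfold c in *. lra. }
assert (Hsup : forall i, (i <= 2 ^ n)%nat -> vnorm d (Y n i) + kap <= M).
{ intros i Hi. unfold M.
  assert (EN : (2 ^ n = 2 ^ n1 * 2 ^ (n - n1))%nat) by (rewrite <- Nat.pow_add_r; f_equal; lia).
  apply (scheme_blocks d m (2 ^ n) q (h n) c kap del (Y n) dd (fun k => x (tau n k)) (fun k => g (Y n k))
    Hq Hh Hc Hkap Hdel Hdelq hXn hWn hddn hGn hGGn (2 ^ (n - n1)) (2 ^ n1)); try easy.
  - rewrite grid_block by easy. lra.
  - rewrite <- EN. easy. }
split.
{ intros i Hi. specialize (Hsup i Hi). lra. }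
intros i j Hij Hlen.
destruct (scheme_window d m (2 ^ n) q (h n) c kap del (Y n) dd (fun k => x (tau n k)) (fun k => g (Y n k))
    Hq Hh Hc Hkap Hdel Hdelq hXn hWn hddn hGn hGGn i j ltac:(lia) ltac:(lra)) as (H1 & H2 & _).
fold CH K in H1, H2.
assert (Hl0 := len_ge0 (h n) Hh i j ltac:(lia)).
assert (HSi := Hsup i ltac:(lia)). assert (HS0 : 0 <= vnorm d (Y n i) + kap) by (assert (A := vnorm_ge0 d (Y n i)); lra).
assert (Hhol : forall k, (i <= k <= j)%nat -> vnorm d (vsub (Y n k) (Y n i)) <= CH * M * rpow ((INR j - INR i) * h n) q).
{ intros k Hk. eapply Rle_trans; [apply H1; lia|]. apply Rmult_le_compat.
  - now apply Rmult_le_pos.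
  - apply rpow_ge0.
  - now apply Rmult_le_compat_l.
  - apply rpow_le; [lra|]. apply (len_mono (h n) Hh); lia. }
set (len := (INR j - INR i) * h n) in *.
assert (HP0 := rpow_ge0 len q). assert (HP2 := rpow_ge0 len (2 * q)).
split.
{ eapply Rle_trans; [apply Hhol; lia|]. apply Rmult_le_compat_r; [easy|]. lra. }
destruct (Nat.eq_dec i j) as [<-|Hne].
{ rewrite vnorm_zero; [apply Rmult_le_pos; lra|]. intros l _.
  unfold davie, vsub at 1 2, vadd, vscale. rewrite matvec_vsub. ring. }
(* The Davie error is the sewing remainder plus the sum of the drift increments hd(Y_k) - hd(Y_i),
   which is of order len^(1+q) and hence at most of order len^(2q). *)
eapply Rle_trans.
{ apply (vnorm_add_le d _ (scheme_rem m (Y n) dd (fun k => g (Y n k)) (fun k => x (tau n k)) i j)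
    (vsub (vsum (fun k => vscale (tau n (S k) - tau n k) (vsub (hd (Y n k)) (hd (Y n i)))) j)
          (vsum (fun k => vscale (tau n (S k) - tau n k) (vsub (hd (Y n k)) (hd (Y n i)))) i))).
  intros l _. assert (E := vsum_const_sub (tau n) (fun k => hd (Y n k)) (hd (Y n i)) i j l ltac:(lia)).
  cbv beta in E. fold dd in E. unfold vsub at 1. rewrite E. unfold davie, scheme_rem, vsub, vadd, vscale. ring. }
assert (B1 : vnorm d (scheme_rem m (Y n) dd (fun k => g (Y n k)) (fun k => x (tau n k)) i j) <= CR * rpow len (2 * q)).
{ eapply Rle_trans; [apply H2; lia|]. apply Rmult_le_compat_r; [easy|].
  unfold CR. apply Rmult_le_compat_l; [lra|]. apply Rmult_le_compat_l; [|easy].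
  apply Rmult_le_pos; lra. }
assert (B2 := vsum_bound d (fun k => vscale (tau n (S k) - tau n k) (vsub (hd (Y n k)) (hd (Y n i))))
  (h n * (L * (CH * M * rpow len q))) i j ltac:(lia)).
assert (B3 : len * (L * (CH * M * rpow len q)) <= L * (CH * M) * rpow len (2 * q)).
{ replace (2 * q) with (q + q) by ring. rewrite rpow_add.
  assert (A := len_le_pow len ltac:(lra)).
  apply Rmult_le_compat_r with (r := L * (CH * M * rpow len q)) in A;
    [|apply Rmult_le_pos; [easy|now apply Rmult_le_pos]]. lra. }
assert (0 <= M * rpow len (2 * q)) by now apply Rmult_le_pos.
assert (0 <= CH * M * rpow len (2 * q)) by now apply Rmult_le_pos.
eapply Rle_trans; [apply Rplus_le_compat; [exact B1|apply B2]|].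
- intros k Hk. rewrite vnorm_scale. destruct (grid_incr n k (S k) ltac:(lia)) as [Hi _]. rewrite S_INR in Hi.
  rewrite Rabs_pos_eq by lra. apply Rmult_le_compat; [lra|apply vnorm_ge0|lra|].
  eapply Rle_trans; [apply hhd|]. apply Rmult_le_compat_l; [easy|]. apply Hhol; lia.
- replace ((INR j - INR i) * (h n * (L * (CH * M * rpow len q)))) with (len * (L * (CH * M * rpow len q)))
    by (unfold len; ring). lra.
Qed.

(** The scheme estimates for W = Z - Y, with kap the error e per unit of clock time. The Hoelder
    bounds of both schemes enter c through the four-point inequality, and the resulting factor
    2^(2^n0) does not depend on n. *)
Lemma euler_stability (CZ : R) (nZ : nat) : 0 <= CZ -> exists (n0 : nat) (C : R), 0 <= C /\
  forall n Z eps e, (n0 <= n)%nat -> 0 <= e ->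
  (forall k l, (k < 2 ^ n)%nat -> (l < d)%nat ->
    Z (S k) l = Z k l + (tau n (S k) - tau n k) * hd (Z k) l
       + matvec m (g (Z k)) (vsub (x (tau n (S k))) (x (tau n k))) l + eps k l) ->
  (forall k, (k < 2 ^ n)%nat -> vnorm d (eps k) <= e * h n) ->
  (forall i j, (i <= j <= 2 ^ n)%nat -> (INR j - INR i) * h n <= h nZ ->
    vnorm d (vsub (Z j) (Z i)) <= CZ * rpow ((INR j - INR i) * h n) q) ->
  forall i, (i <= 2 ^ n)%nat -> vnorm d (vsub (Z i) (Y n i)) <= C * (vnorm d (vsub (Z O) ya) + e).
Proof.
intros HCZ. assert (Hq := inv_p_bounds).
destruct euler_bound as (n1 & CY & HCY & Hh1 & HY).
set (c := L + Cg + C4 + C4 * (CZ + CY)). set (K := sewing_const (2 * q)).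
destruct (sewing_const_spec (2 * q) ltac:(lra)) as [HK _]. fold K in HK.
assert (HC4 : 0 <= C4 * (CZ + CY)) by (apply Rmult_le_pos; lra).
assert (Hc : 0 <= c) by (unfold c; lra).
destruct (rpow_small (4 * (1 + 2 * c) * (1 + K)) q) as (del & Hdel & Hdelq);
  [repeat apply Rmult_le_pos; lra|lra|].
destruct (level_small T del clock_end_gt0 ltac:(lra)) as [n2 Hn2].
set (n0 := Nat.max n2 (Nat.max n1 nZ)).
assert (Hh0 := grid_step_gt0 n0).
assert (Hh02 : h n0 <= del) by (apply (Hn2 n0); lia).
assert (Hh01 : h n0 <= h n1) by (apply grid_step_antitone; lia).
assert (Hh0Z : h n0 <= h nZ) by (apply grid_step_antitone; lia).
assert (Hdelq0 : 4 * (1 + 2 * c) * (1 + K) * rpow (h n0) q <= 1).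
{ eapply Rle_trans; [|exact Hdelq]. apply Rmult_le_compat_l; [repeat apply Rmult_le_pos; lra|]. apply rpow_le; lra. }
exists n0, (2 ^ (2 ^ n0)). split; [apply pow_le; lra|].
intros n Z eps e Hn He HZ Heps HZh i Hi.
assert (Hh := grid_step_gt0 n).
destruct (HY n ltac:(lia)) as [_ HYh].
set (W := fun k => vsub (Z k) (Y n k)).
set (G := fun k => msub (g (Z k)) (g (Y n k))).
set (dd := fun k => vadd (vscale (tau n (S k) - tau n k) (vsub (hd (Z k)) (hd (Y n k)))) (eps k)).
assert (hXn : forall i j, (i <= j <= 2 ^ n)%nat ->
  vnorm m (vsub (x (tau n j)) (x (tau n i))) <= rpow ((INR j - INR i) * h n) q)
  by (intros i' j' Hij; now apply grid_incr).
assert (hWn : forall k l, (k < 2 ^ n)%nat -> (l < d)%nat ->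
  W (S k) l = W k l + dd k l + matvec m (G k) (vsub (x (tau n (S k))) (x (tau n k))) l).
{ intros k l Hk Hl. unfold W, G, dd. rewrite matvec_msub. unfold vsub at 1 2. rewrite (HZ k l Hk Hl).
  simpl euler. unfold vadd, vscale. unfold vsub at 3. ring. }
assert (hddn : forall k, (k < 2 ^ n)%nat -> vnorm d (dd k) <= (e + c * vnorm d (W k)) * h n).
{ intros k Hk. unfold dd. eapply Rle_trans; [apply vnorm_triangle|]. rewrite vnorm_scale.
  destruct (grid_incr n k (S k) ltac:(lia)) as [Hi' _]. rewrite S_INR in Hi'.
  rewrite Rabs_pos_eq by lra. assert (A := Heps k Hk).
  assert (B := hhd (Z k) (Y n k)). fold (W k) in B. assert (HW := vnorm_ge0 d (W k)).
  assert (B' : vnorm d (vsub (hd (Z k)) (hd (Y n k))) <= c * vnorm d (W k)).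
  { eapply Rle_trans; [exact B|]. apply Rmult_le_compat_r; unfold c; lra. }
  assert (B'' : (tau n (S k) - tau n k) * vnorm d (vsub (hd (Z k)) (hd (Y n k))) <= h n * (c * vnorm d (W k))).
  { apply Rmult_le_compat; [lra|apply vnorm_ge0|lra|easy]. }
  lra. }
assert (hGn : forall k, (k <= 2 ^ n)%nat -> opnorm d m (G k) <= e + c * vnorm d (W k)).
{ intros k _. assert (A := hg (Z k) (Y n k)). fold (W k) in A. fold (G k) in A.
  assert (HW := vnorm_ge0 d (W k)).
  assert (Cg * vnorm d (W k) <= c * vnorm d (W k)) by (apply Rmult_le_compat_r; unfold c; lra). lra. }
assert (hGGn : forall i k, (i <= k <= 2 ^ n)%nat -> (INR k - INR i) * h n <= h n0 ->
  opnorm d m (msub (G k) (G i)) <= c * vnorm d (vsub (W k) (W i))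
    + c * (vnorm d (W i) + vnorm d (W k)) * rpow ((INR k - INR i) * h n) q).
{ intros i' k Hik Hlen. eapply Rle_trans; [apply hfour|]. fold (W i') (W k).
  assert (A1 := HZh i' k Hik ltac:(lra)). destruct (HYh i' k Hik ltac:(lra)) as [A2 _].
  set (P := rpow ((INR k - INR i') * h n) q) in *.
  assert (HP : 0 <= P) by apply rpow_ge0.
  assert (W1 := vnorm_ge0 d (W i')). assert (W2 := vnorm_ge0 d (W k)). assert (W3 := vnorm_ge0 d (vsub (W k) (W i'))).
  rewrite Rmult_plus_distr_l. apply Rplus_le_compat.
  - apply Rmult_le_compat_r; [easy|]. unfold c; lra.
  - apply Rle_trans with (C4 * (vnorm d (W i') * ((CZ + CY) * P))).
    + apply Rmult_le_compat_l; [easy|]. apply Rmult_le_compat_l; [easy|]. lra.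
    + replace (C4 * (vnorm d (W i') * ((CZ + CY) * P))) with (C4 * (CZ + CY) * vnorm d (W i') * P) by ring.
      apply Rmult_le_compat_r; [easy|]. apply Rmult_le_compat; lra || (unfold c; lra). }
assert (EN : (2 ^ n = 2 ^ n0 * 2 ^ (n - n0))%nat) by (rewrite <- Nat.pow_add_r; f_equal; lia).
assert (HB := scheme_blocks d m (2 ^ n) q (h n) c e (h n0) W dd (fun k => x (tau n k)) G
    Hq Hh Hc He ltac:(lra) Hdelq0 hXn hWn hddn hGn hGGn (2 ^ (n - n0)) (2 ^ n0)
    ltac:(rewrite grid_block by lia; lra) EN (2 ^ n0) i ltac:(rewrite <- EN; easy) Hi).
fold (W i). change (vsub (Z 0%nat) ya) with (W 0%nat). lra.
Qed.

(** * Convergence of the Euler schemes *)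

(** A step error of order h^(2q) is h times h^(2q-1): the rate is the error per unit of clock
    time. *)
Definition rate (m : nat) (p : R) (x : R -> vec) (a b : R) (n : nat) : R :=
  rpow (grid_step m p x a b n) (2 * (1 / p) - 1).

Local Notation E := (rate m p x a b).

Lemma rate_gt0 (n : nat) : 0 < E n.
Proof. apply rpow_gt0, grid_step_gt0. Qed.

Lemma rate_S (n : nat) : E (S n) = rpow (1 / 2) (2 * q - 1) * E n.
Proof.
unfold rate. assert (H := grid_step_gt0 (S n)). rewrite <- rpow_mul by (assert (H' := grid_step_gt0 n); lra).
f_equal. rewrite (grid_step_S n). field.
Qed.

Lemma rate_ratio : 0 < rpow (1 / 2) (2 * q - 1) < 1.
Proof.
assert (Hq := inv_p_bounds). split; [apply rpow_gt0; lra|].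
apply Rlt_le_trans with (rpow 1 (2 * q - 1)); [apply rpow_lt; lra|rewrite rpow_one; lra].
Qed.

Lemma grid_step_le_rate (n : nat) (s : R) : h n <= 1 -> 2 * q - 1 <= s -> rpow (h n) s <= E n.
Proof.
intros Hh Hs. assert (H := grid_step_gt0 n). unfold rate. fold q.
replace s with ((2 * q - 1) + (s - (2 * q - 1))) by ring. rewrite rpow_add.
assert (A := rpow_ge0 (h n) (2 * q - 1)). assert (B := rpow_ge0 (h n) (s - (2 * q - 1))).
destruct Hs as [Hs|Hs].
- assert (rpow (h n) (s - (2 * q - 1)) <= 1) by (apply rpow_le_one; lra). nra.
- rewrite Hs, Rminus_diag. rewrite (rpow_Rpower (h n) 0), Rpower_O by easy. lra.
Qed.

(** Passage to the limit in an estimate at level n: the rate tends to 0 because 2q > 1. *)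
Lemma le_of_rate (A B C : R) (N : nat) : 0 <= C ->
  (forall n, (N <= n)%nat -> A <= B + C * E n) -> A <= B.
Proof.
intros HC H. apply Rle_plus_epsilon. intros eps Heps. assert (Hq := inv_p_bounds).
set (eta := eps / (C + 1)).
assert (Heta : 0 < eta) by (apply Rdiv_lt_0_compat; lra).
destruct (level_small T (rpow eta (1 / (2 * q - 1))) clock_end_gt0 (rpow_gt0 _ _ Heta)) as [n0 Hn0].
set (n := Nat.max N n0). specialize (H n ltac:(lia)). specialize (Hn0 n ltac:(lia)).
assert (HE : E n <= eta).
{ rewrite <- (rpow_inv_l eta (2 * q - 1)) by lra. apply rpow_le; [fold q; lra|]. exact Hn0. }
assert (HE0 := rate_gt0 n).
assert (C * E n <= C * eta) by now apply Rmult_le_compat_l.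
assert (eps = (C + 1) * eta) by (unfold eta; field; lra). nra.
Qed.

(** The integer part of F(t)/h, that is, the index of the last grid point not after t. *)
Definition grid_index (m : nat) (p : R) (x : R -> vec) (a b : R) (n : nat) (t : R) : nat :=
  epsilon (inhabits O) (fun i => INR i <= clock m p x a t / grid_step m p x a b n < INR i + 1).

Local Notation idx := (grid_index m p x a b).

Lemma clock_bounds (t : R) : a <= t <= b -> 0 <= F t <= T.
Proof.
intros Ht. destruct (clock_dominates a t) as (_ & _ & A); [lra|lra|].
destruct (clock_dominates t b) as (_ & _ & B); [lra|lra|]. rewrite clock_start in A. unfold T. lra.
Qed.

Lemma grid_index_spec (n : nat) (t : R) : a <= t <= b ->
  INR (idx n t) * h n <= F t < INR (idx n t) * h n + h n /\ (idx n t <= 2 ^ n)%nat.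
Proof.
intros Ht. assert (Hb := clock_bounds t Ht). assert (Hh := grid_step_gt0 n).
assert (HP : INR (idx n t) <= F t / h n < INR (idx n t) + 1).
{ unfold grid_index. apply epsilon_spec.
  destruct (nfloor_ex (F t / h n)) as [i Hi]; [apply Rdiv_le_0_compat; lra|]. now exists i. }
assert (HF : F t = F t / h n * h n) by (field; lra).
assert (H1 : INR (idx n t) * h n <= F t) by (rewrite HF; apply Rmult_le_compat_r; lra).
split; [split; [easy|]|].
- rewrite HF. replace (INR (idx n t) * h n + h n) with ((INR (idx n t) + 1) * h n) by ring.
  apply Rmult_lt_compat_r; lra.
- apply INR_le. apply Rmult_le_reg_r with (h n); [easy|]. rewrite grid_step_total. lra.
Qed.

Lemma grid_index_mono (n : nat) (s t : R) : a <= s <= t -> t <= b -> (idx n s <= idx n t)%nat.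
Proof.
intros Hs Ht. destruct (grid_index_spec n s) as [A _]; [lra|]. destruct (grid_index_spec n t) as [B _]; [lra|].
destruct (clock_dominates s t Hs Ht) as (_ & _ & D).
assert (Hh := grid_step_gt0 n).
assert (INR (idx n s) < INR (S (idx n t))); [|apply INR_lt in H; lia].
rewrite S_INR. apply Rmult_lt_reg_r with (h n); lra.
Qed.

Lemma grid_index_S (n : nat) (t : R) : a <= t <= b -> (2 * idx n t <= idx (S n) t <= 2 * idx n t + 1)%nat.
Proof.
intros Ht. destruct (grid_index_spec n t Ht) as [A _]. destruct (grid_index_spec (S n) t Ht) as [B _].
assert (Hh := grid_step_gt0 (S n)). rewrite (grid_step_S n) in A.
assert (H1 : INR (2 * idx n t) < INR (S (idx (S n) t))).
{ rewrite S_INR, mult_INR. simpl (INR 2). apply Rmult_lt_reg_r with (h (S n)); lra. }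
assert (H2 : INR (idx (S n) t) < INR (2 * idx n t + 2)).
{ rewrite plus_INR, mult_INR. simpl (INR 2). apply Rmult_lt_reg_r with (h (S n)); lra. }
apply INR_lt in H1, H2. lia.
Qed.

Lemma grid_index_close (n : nat) (t : R) : a <= t <= b ->
  0 <= t - tau n (idx n t) <= h n /\ vnorm m (vsub (x t) (x (tau n (idx n t)))) <= rpow (h n) q.
Proof.
intros Ht. destruct (grid_index_spec n t Ht) as [A A']. destruct (grid_spec n _ A') as [B B'].
assert (Hle : tau n (idx n t) <= t) by (apply clock_le_inv; lra).
destruct (clock_dominates (tau n (idx n t)) t) as (D1 & _ & D2); [lra|lra|].
split; [lra|]. eapply Rle_trans; [apply clock_inc; lra|].
apply rpow_le; [assert (Hq := inv_p_bounds); lra|lra].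
Qed.

(** Every second value of the finer scheme satisfies the coarser recursion up to small errors, so
    [euler_stability] compares the two levels. *)
Lemma euler_successive : exists (N : nat) (C : R), 0 <= C /\ forall n t, (N <= n)%nat -> a <= t <= b ->
  vnorm d (vsub (Y (S n) (idx (S n) t)) (Y n (idx n t))) <= C * E n.
Proof.
assert (Hq := inv_p_bounds).
destruct euler_bound as (n1 & CY & HCY & Hh1 & HY).
destruct (euler_stability CY n1 HCY) as (n0 & CS & HCS & HS).
exists (Nat.max n1 n0), (CY + CS * ((L + Cg) * CY)).
assert (HLC : 0 <= (L + Cg) * CY) by (apply Rmult_le_pos; lra).
split.
{ assert (0 <= CS * ((L + Cg) * CY)) by now apply Rmult_le_pos. lra. }
intros n t Hn Ht.
assert (Hh := grid_step_gt0 n). assert (Hh' := grid_step_gt0 (S n)). assert (H2 := grid_step_S n).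
assert (Hhn1 : h n <= h n1) by (apply grid_step_antitone; lia).
destruct (HY (S n) ltac:(lia)) as [_ HYh].
assert (E0 := rate_gt0 n).
assert (Eq : rpow (h n) q <= E n) by (apply grid_step_le_rate; lra).
assert (P0 := rpow_ge0 (h n) q).
set (Y' := Y (S n)) in *.
assert (Hone : forall k, (k < 2 ^ S n)%nat -> vnorm d (vsub (Y' (S k)) (Y' k)) <= CY * rpow (h n) q).
{ intros k Hk. destruct (HYh k (S k) ltac:(lia)) as [A _].
  - rewrite S_INR. lra.
  - eapply Rle_trans; [exact A|]. apply Rmult_le_compat_l; [easy|]. apply rpow_le; [lra|]. rewrite S_INR. lra. }
(* Two fine steps differ from one coarse step only in that the second evaluates hd and g at the
   midpoint value instead of at the left end. *)
set (eps := fun k => vadd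
  (vscale (tau (S n) (S (S (2 * k))) - tau (S n) (S (2 * k))) (vsub (hd (Y' (S (2 * k)))) (hd (Y' (2 * k)%nat))))
  (matvec m (msub (g (Y' (S (2 * k)))) (g (Y' (2 * k)%nat)))
     (vsub (x (tau (S n) (S (S (2 * k))))) (x (tau (S n) (S (2 * k))))))).
assert (Epow : (2 ^ S n = 2 * 2 ^ n)%nat) by (simpl; lia).
assert (HZ : forall i, (i <= 2 ^ n)%nat ->
  vnorm d (vsub (Y' (2 * i)%nat) (Y n i)) <= CS * (vnorm d (vsub (Y' (2 * 0)%nat) ya) + (L + Cg) * CY * E n)).
{ apply (HS n (fun i => Y' (2 * i)%nat) eps); [lia|apply Rmult_le_pos; lra| | |].
  - intros k l Hk Hl. cbv beta. rewrite <- !(grid_refine n).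
    replace (2 * S k)%nat with (S (S (2 * k))) by lia.
    assert (ES : forall i, Y' (S i) l = Y' i l + ((tau (S n) (S i) - tau (S n) i) * hd (Y' i) l +
      matvec m (g (Y' i)) (vsub (x (tau (S n) (S i))) (x (tau (S n) i))) l)) by reflexivity.
    rewrite (ES (S (2 * k))), (ES (2 * k)%nat). unfold eps, vadd, vscale.
    rewrite matvec_msub, !matvec_vsub. unfold vsub. ring.
  - intros k Hk. unfold eps. eapply Rle_trans; [apply vnorm_triangle|]. rewrite vnorm_scale.
    destruct (grid_incr (S n) (S (2 * k)) (S (S (2 * k))) ltac:(lia)) as [Hi Hx].
    rewrite (S_INR (S (2 * k))) in Hi, Hx.
    replace ((INR (S (2 * k)) + 1 - INR (S (2 * k))) * h (S n)) with (h (S n)) in Hi, Hx by ring.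
    rewrite Rabs_pos_eq by lra.
    assert (HYk := Hone (2 * k)%nat ltac:(lia)).
    assert (Hxh : rpow (h (S n)) q <= rpow (h n) q) by (apply rpow_le; lra).
    assert (B1 : (tau (S n) (S (S (2 * k))) - tau (S n) (S (2 * k))) *
      vnorm d (vsub (hd (Y' (S (2 * k)))) (hd (Y' (2 * k)%nat))) <= h n * (L * (CY * rpow (h n) q))).
    { apply Rmult_le_compat; [lra|apply vnorm_ge0|lra|]. eapply Rle_trans; [apply hhd|].
      now apply Rmult_le_compat_l. }
    assert (B2 : vnorm d (matvec m (msub (g (Y' (S (2 * k)))) (g (Y' (2 * k)%nat)))
     (vsub (x (tau (S n) (S (S (2 * k))))) (x (tau (S n) (S (2 * k)))))) <= Cg * (CY * rpow (h n) q) * rpow (h n) q).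
    { eapply Rle_trans; [apply matvec_opnorm|]. apply Rmult_le_compat; [apply opnorm_ge0|apply vnorm_ge0| |lra].
      eapply Rle_trans; [apply hg|]. now apply Rmult_le_compat_l. }
    assert (B3 : rpow (h n) q * rpow (h n) q = h n * E n).
    { unfold rate. fold q. transitivity (rpow (h n) 1 * rpow (h n) (2 * q - 1)); [|rewrite rpow_1; lra].
      rewrite <- !rpow_add. f_equal. ring. }
    assert (B4 : h n * (L * (CY * rpow (h n) q)) <= L * CY * (h n * E n)).
    { replace (h n * (L * (CY * rpow (h n) q))) with (L * CY * (h n * rpow (h n) q)) by ring.
      apply Rmult_le_compat_l; [now apply Rmult_le_pos|]. apply Rmult_le_compat_l; lra. }
    replace (Cg * (CY * rpow (h n) q) * rpow (h n) q) with (Cg * CY * (rpow (h n) q * rpow (h n) q)) in B2 by ring.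
    rewrite B3 in B2. lra.
  - intros i j Hij Hlen.
    assert (El : (INR (2 * j) - INR (2 * i)) * h (S n) = (INR j - INR i) * h n)
      by (rewrite !mult_INR, H2; simpl (INR 2); ring).
    destruct (HYh (2 * i)%nat (2 * j)%nat ltac:(lia)) as [A _]; [rewrite El; easy|]. rewrite El in A. exact A. }
destruct (grid_index_spec n t Ht) as [_ Hi]. assert (HiS := grid_index_S n t Ht).
specialize (HZ _ Hi).
rewrite (vnorm_zero d (vsub (Y' (2 * 0)%nat) ya)) in HZ by (intros; change (Y' (2 * 0)%nat) with ya; unfold vsub; ring).
eapply Rle_trans; [apply (vnorm_sub_triangle d _ (Y' (2 * idx n t)%nat))|].
(* The finer index of t is twice the coarser one or one more; the possible extra step costs one
   increment of the fine scheme. *)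
assert (HA : vnorm d (vsub (Y' (idx (S n) t)) (Y' (2 * idx n t)%nat)) <= CY * rpow (h n) q).
{ destruct (Nat.eq_dec (idx (S n) t) (2 * idx n t)) as [->|Hne].
  - rewrite vnorm_zero; [now apply Rmult_le_pos|]. intros; unfold vsub; ring.
  - replace (idx (S n) t) with (S (2 * idx n t)) by lia. apply Hone.
    destruct (grid_index_spec (S n) t Ht) as [_ Hi']. lia. }
assert (CY * rpow (h n) q <= CY * E n) by now apply Rmult_le_compat_l.
lra.
Qed.

Lemma euler_limit : exists (y : R -> vec) (N : nat) (C : R), 0 <= C /\ forall n t, (N <= n)%nat -> a <= t <= b ->
  vnorm d (vsub (y t) (Y n (idx n t))) <= C * E n.
Proof.
destruct euler_successive as (N & C & HC & H).
set (C' := C / (1 - rpow (1 / 2) (2 * q - 1))).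
(* The limit is taken coordinate by coordinate, with the rate as its specification; summing over
   coordinates costs the factor INR d. *)
set (P := fun t l z => forall n, (N <= n)%nat -> Rabs (Y n (idx n t) l - z) <= C' * E n).
exists (fun t l => epsilon (inhabits 0) (P t l)), N, (INR d * C').
assert (HC' : 0 <= C') by (apply Rdiv_le_0_compat; [easy|assert (A := rate_ratio); lra]).
split; [apply Rmult_le_pos; [apply pos_INR|easy]|].
intros n t Hn Ht. rewrite Rmult_assoc. apply vnorm_le_coord. intros l Hl.
assert (HP : P t l (epsilon (inhabits 0) (P t l))).
{ apply epsilon_spec.
  apply (geometric_limit (fun n => Y n (idx n t) l) E C (rpow (1 / 2) (2 * q - 1)) N); try easy.
  - apply rate_ratio.
  - apply rate_gt0.
  - apply rate_S.
  - intros k Hk. eapply Rle_trans; [|apply (H k t Hk Ht)].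
    exact (Rabs_le_vnorm d (vsub (Y (S k) (idx (S k) t)) (Y k (idx k t))) l Hl). }
unfold vsub. rewrite Rabs_minus_sym. now apply HP.
Qed.

(** * The limit path solves the equation *)

Lemma davie_coord (u v : vec) (s t : R) (l : nat) : davie d m hd g x u v s t l
  = v l - u l - ((t - s) * hd u l + (matvec m (g u) (x t) l - matvec m (g u) (x s) l)).
Proof. unfold davie. unfold vsub at 1 2. unfold vadd, vscale. rewrite matvec_vsub. ring. Qed.

(** Allows the times s, t and the limit values to be exchanged for neighbouring grid points and
    Euler values; every added term will be of the order of the rate. *)
Lemma davie_perturb (u v u' v' : vec) (s t s' t' : R) :
  vnorm d (davie d m hd g x u v s t) <= vnorm d (davie d m hd g x u' v' s' t')
  + (vnorm d (vsub u u') + vnorm d (vsub v v'))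
  + (Rabs (t - s) * (L * vnorm d (vsub u u')) + (Rabs (t - t') + Rabs (s - s')) * vnorm d (hd u'))
  + (Cg * vnorm d (vsub u u') * vnorm m (vsub (x t) (x s))
     + opnorm d m (g u') * (vnorm m (vsub (x t) (x t')) + vnorm m (vsub (x s) (x s')))).
Proof.
eapply Rle_trans.
{ apply (vnorm_add3_le d _ (vadd (davie d m hd g x u' v' s' t') (vadd (vscale (-1) (vsub u u')) (vsub v v')))
    (vscale (-1) (vadd (vscale (t - s) (vsub (hd u) (hd u'))) (vscale ((t - t') - (s - s')) (hd u'))))
    (vscale (-1) (vadd (matvec m (msub (g u) (g u')) (vsub (x t) (x s)))
       (matvec m (g u') (vsub (vsub (x t) (x t')) (vsub (x s) (x s'))))))).
  intros l _. unfold vadd, vscale. rewrite !davie_coord, matvec_msub, !matvec_vsub. unfold vsub. ring. }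
rewrite !vnorm_scale. replace (Rabs (-1)) with 1 by (rewrite Rabs_left; lra). rewrite !Rmult_1_l.
apply Rplus_le_compat; [apply Rplus_le_compat|].
- eapply Rle_trans; [apply vnorm_triangle|]. apply Rplus_le_compat_l.
  eapply Rle_trans; [apply vnorm_triangle|]. rewrite vnorm_scale.
  replace (Rabs (-1)) with 1 by (rewrite Rabs_left; lra). lra.
- eapply Rle_trans; [apply vnorm_triangle|]. rewrite !vnorm_scale. apply Rplus_le_compat.
  + apply Rmult_le_compat_l; [apply Rabs_pos|apply hhd].
  + apply Rmult_le_compat_r; [apply vnorm_ge0|]. unfold Rminus at 1.
    eapply Rle_trans; [apply Rabs_triang|]. rewrite Rabs_Ropp. lra.
- eapply Rle_trans; [apply vnorm_triangle|]. apply Rplus_le_compat.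
  + eapply Rle_trans; [apply matvec_opnorm|]. apply Rmult_le_compat_r; [apply vnorm_ge0|apply hg].
  + eapply Rle_trans; [apply matvec_opnorm|]. apply Rmult_le_compat_l; [apply opnorm_ge0|].
    eapply Rle_trans; [apply (vnorm_add_le m _ (vsub (x t) (x t')) (vscale (-1) (vsub (x s) (x s'))))|].
    * intros; unfold vsub, vscale; ring.
    * rewrite vnorm_scale. replace (Rabs (-1)) with 1 by (rewrite Rabs_left; lra). lra.
Qed.

Lemma limit_start (y : R -> vec) (N : nat) (CE : R) : 0 <= CE ->
  (forall n t, (N <= n)%nat -> a <= t <= b -> vnorm d (vsub (y t) (Y n (idx n t))) <= CE * E n) ->
  vnorm d (vsub (y a) ya) = 0.
Proof.
intros HCE H. apply Rle_antisym; [|apply vnorm_ge0].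
apply (le_of_rate _ 0 CE N); [easy|]. intros n Hn. rewrite Rplus_0_l.
destruct (grid_index_spec n a) as [A _]; [lra|]. rewrite clock_start in A.
assert (Hh := grid_step_gt0 n).
assert (Hi : idx n a = O).
{ destruct (idx n a) as [|k]; [easy|]. rewrite S_INR in A. assert (B := pos_INR k).
  assert (0 <= INR k * h n) by (apply Rmult_le_pos; lra). lra. }
assert (B := H n a Hn ltac:(lra)). now rewrite Hi in B.
Qed.

(** The Euler bounds are applied between the grid points below s and t, and the rounding errors
    disappear as n grows. *)
Lemma limit_davie (y : R -> vec) (N : nat) (CE : R) : 0 <= CE ->
  (forall n t, (N <= n)%nat -> a <= t <= b -> vnorm d (vsub (y t) (Y n (idx n t))) <= CE * E n) ->
  exists w C, 0 < w <= 1 /\ 0 <= C /\ (forall t, a <= t <= b -> vnorm d (y t) <= C) /\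
  forall s t, a <= s <= t -> t <= b -> F t - F s <= w ->
    vnorm d (vsub (y t) (y s)) <= C * rpow (F t - F s) q /\
    vnorm d (davie d m hd g x (y s) (y t) s t) <= C * rpow (F t - F s) (2 * q).
Proof.
intros HCE Hlim. assert (Hq := inv_p_bounds).
destruct euler_bound as (n1 & C1 & HC1 & Hh1 & HY).
assert (Hh1' := grid_step_gt0 n1).
set (f0 := vnorm d (hd vzero)). set (G0 := opnorm d m (g vzero)).
assert (Hf0 : 0 <= f0) by apply vnorm_ge0. assert (HG0 : 0 <= G0) by apply opnorm_ge0.
assert (P1 : 0 <= C1 * rpow 2 q) by (apply Rmult_le_pos; [easy|apply rpow_ge0]).
assert (P2 : 0 <= C1 * rpow 2 (2 * q)) by (apply Rmult_le_pos; [easy|apply rpow_ge0]).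
(* Once h n <= D, rounding to the grid enlarges the clock distance D to at most 2D, which must not
   exceed the window h n1. Hence the half, and the factors 2^q and 2^(2q). *)
exists (h n1 / 2), (C1 + C1 * rpow 2 q + C1 * rpow 2 (2 * q)).
split; [lra|]. split; [lra|]. split.
{ intros t Ht. apply Rle_trans with C1; [|lra].
  apply (le_of_rate _ C1 CE (Nat.max N n1)); [easy|]. intros n Hn.
  eapply Rle_trans; [apply (vnorm_le_sub d _ (Y n (idx n t)))|].
  destruct (HY n ltac:(lia)) as [A _]. destruct (grid_index_spec n t Ht) as [_ Hi].
  apply Rplus_le_compat; [now apply A|]. apply Hlim; [lia|easy]. }
intros s t Hs Ht Hw.
destruct (clock_dominates s t Hs Ht) as (D1 & _ & D2).
set (D := F t - F s) in *.
assert (HDq := rpow_ge0 D q). assert (HD2q := rpow_ge0 D (2 * q)).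
destruct (proj2 Hs) as [Hst|<-].
2: { split; (rewrite vnorm_zero; [apply Rmult_le_pos; try easy; lra|]).
     - intros; unfold vsub; ring.
     - intros l _. rewrite davie_coord. ring. }
assert (HD : 0 < D) by lra.
destruct (level_small T D clock_end_gt0 HD) as [n2 Hn2].
set (N' := Nat.max N (Nat.max n1 n2)).
assert (Hgrid : forall n, (N' <= n)%nat -> let i := idx n s in let j := idx n t in
  (i <= j <= 2 ^ n)%nat /\ 0 <= (INR j - INR i) * h n <= 2 * D /\ h n <= 1 /\
  (INR j - INR i) * h n <= h n1).
{ intros n Hn i j. assert (Hij : (i <= j)%nat) by (apply grid_index_mono; lra).
  destruct (grid_index_spec n s) as [A _]; [lra|]. destruct (grid_index_spec n t) as [B B']; [lra|].
  assert (Hh : h n <= D) by (apply Hn2; lia).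
  assert (Hh' : h n <= h n1) by (apply grid_step_antitone; lia).
  assert (Hh0 := grid_step_gt0 n). fold i in A. fold j in B, B'.
  assert (Hl : (INR j - INR i) * h n <= 2 * D) by (unfold D in *; lra).
  split; [lia|]. split; [|lra]. split; [|easy]. apply len_ge0; easy. }
assert (X2 : forall r, 0 < r -> rpow (2 * D) r = rpow 2 r * rpow D r) by (intros; apply rpow_mul; lra).
split.
- apply Rle_trans with (C1 * rpow (2 * D) q).
  2: { rewrite X2 by lra. rewrite <- Rmult_assoc. apply Rmult_le_compat_r; lra. }
  apply (le_of_rate _ _ (2 * CE) N'); [lra|]. intros n Hn.
  destruct (Hgrid n Hn) as (Hij & Hlen & _ & Hlen1).
  destruct (HY n ltac:(lia)) as [_ HYh]. destruct (HYh _ _ Hij Hlen1) as [A _].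
  assert (B : C1 * rpow ((INR (idx n t) - INR (idx n s)) * h n) q <= C1 * rpow (2 * D) q).
  { apply Rmult_le_compat_l; [easy|]. apply rpow_le; lra. }
  assert (Ls := Hlim n s ltac:(lia) ltac:(lra)). assert (Lt := Hlim n t ltac:(lia) ltac:(lra)).
  eapply Rle_trans; [apply (vnorm_add3_le d _ (vsub (Y n (idx n t)) (Y n (idx n s)))
    (vsub (y t) (Y n (idx n t))) (vsub (Y n (idx n s)) (y s)))|].
  + intros; unfold vsub; ring.
  + rewrite (vnorm_sub_sym d (Y n (idx n s))). lra.
- apply Rle_trans with (C1 * rpow (2 * D) (2 * q)).
  2: { rewrite X2 by lra. rewrite <- Rmult_assoc. apply Rmult_le_compat_r; lra. }
  set (XT := rpow D q).
  set (CC := 2 * CE + ((t - s) * (L * CE) + 2 * (L * C1 + f0)) + (Cg * CE * XT + (G0 + Cg * C1) * 2)).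
  assert (Q1 : 0 <= L * CE) by now apply Rmult_le_pos.
  assert (Q2 : 0 <= L * C1) by now apply Rmult_le_pos.
  assert (Q3 : 0 <= Cg * CE) by now apply Rmult_le_pos.
  assert (Q4 : 0 <= Cg * C1) by now apply Rmult_le_pos.
  assert (Q5 : 0 <= (t - s) * (L * CE)) by (apply Rmult_le_pos; lra).
  assert (Q6 : 0 <= Cg * CE * XT) by (apply Rmult_le_pos; lra || apply rpow_ge0).
  apply (le_of_rate _ _ CC N'); [unfold CC; lra|]. intros n Hn.
  destruct (Hgrid n Hn) as (Hij & Hlen & Hh & Hlen1).
  destruct (HY n ltac:(lia)) as [HYs HYh]. destruct (HYh _ _ Hij Hlen1) as [_ A].
  assert (B : C1 * rpow ((INR (idx n t) - INR (idx n s)) * h n) (2 * q) <= C1 * rpow (2 * D) (2 * q)).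
  { apply Rmult_le_compat_l; [easy|]. apply rpow_le; lra. }
  assert (Ls := Hlim n s ltac:(lia) ltac:(lra)). assert (Lt := Hlim n t ltac:(lia) ltac:(lra)).
  assert (E0 := rate_gt0 n).
  destruct (grid_index_close n s) as [Ts Xs]; [lra|]. destruct (grid_index_close n t) as [Tt Xt]; [lra|].
  assert (Hhq : rpow (h n) q <= E n) by (apply grid_step_le_rate; lra).
  assert (Hh1n : h n <= E n).
  { assert (Hh0 := grid_step_gt0 n). rewrite <- (rpow_1 (h n)) at 1 by lra. apply grid_step_le_rate; lra. }
  assert (HYi := HYs (idx n s) ltac:(lia)).
  assert (Hhd : vnorm d (hd (Y n (idx n s))) <= L * C1 + f0).
  { eapply Rle_trans; [apply hd_growth|]. apply Rplus_le_compat_r. now apply Rmult_le_compat_l. }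
  assert (Hgg : opnorm d m (g (Y n (idx n s))) <= G0 + Cg * C1).
  { eapply Rle_trans; [apply (g_growth d m Cg g hg)|]. apply Rplus_le_compat_l. now apply Rmult_le_compat_l. }
  eapply Rle_trans; [apply (davie_perturb (y s) (y t) (Y n (idx n s)) (Y n (idx n t)) s t (tau n (idx n s)) (tau n (idx n t)))|].
  rewrite (Rabs_pos_eq (t - s)), (Rabs_pos_eq (s - _)), (Rabs_pos_eq (t - _)) by lra.
  assert (U1 : (t - s) * (L * vnorm d (vsub (y s) (Y n (idx n s)))) <= (t - s) * (L * CE) * E n).
  { rewrite Rmult_assoc. apply Rmult_le_compat_l; [lra|]. rewrite Rmult_assoc. now apply Rmult_le_compat_l. }
  assert (U2 : (t - tau n (idx n t) + (s - tau n (idx n s))) * vnorm d (hd (Y n (idx n s))) <= 2 * E n * (L * C1 + f0)).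
  { apply Rmult_le_compat; [lra|apply vnorm_ge0|lra|easy]. }
  assert (U3 : Cg * vnorm d (vsub (y s) (Y n (idx n s))) * vnorm m (vsub (x t) (x s)) <= Cg * (CE * E n) * XT).
  { apply Rmult_le_compat; [apply Rmult_le_pos; [easy|apply vnorm_ge0]|apply vnorm_ge0| |].
    - now apply Rmult_le_compat_l.
    - apply clock_inc; lra. }
  assert (U4 : opnorm d m (g (Y n (idx n s))) * (vnorm m (vsub (x t) (x (tau n (idx n t)))) + vnorm m (vsub (x s) (x (tau n (idx n s)))))
    <= (G0 + Cg * C1) * (2 * E n)).
  { apply Rmult_le_compat; [apply opnorm_ge0| |easy|lra].
    assert (V1 := vnorm_ge0 m (vsub (x t) (x (tau n (idx n t))))).
    assert (V2 := vnorm_ge0 m (vsub (x s) (x (tau n (idx n s))))). lra. }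
  unfold CC. lra.
Qed.

(** Since pq = 1, the p-th power of a Hoelder increment is bounded by a multiple of a clock
    increment, and clock increments add up along a partition. *)
Lemma holder_Cpvar (z : R -> vec) (C : R) : 0 <= C ->
  (forall s t, a <= s <= t -> t <= b -> vnorm d (vsub (z t) (z s)) <= C * rpow (F t - F s) q) ->
  Cpvar d p z a b /\ forall s t, a <= s <= t -> t <= b -> pvar_semi d p z s t <= C * rpow (F t - F s) q.
Proof.
intros HC H. assert (Hq := inv_p_bounds).
assert (Hsum : forall s t l, a <= s -> t <= b -> incr_to s l t ->
  lsum (fun u v => rpow (inc d z u v) p) s l <= rpow C p * (F t - F s)).
{ intros s t l Hs Ht Hl.
  apply Rle_trans with (lsum (fun u v => rpow C p * (F v - F u)) s l).
  - apply (lsum_le _ _ s t); [|easy]. intros u v Hu Hv.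
    destruct (clock_dominates u v) as (_ & _ & D); [lra|lra|].
    rewrite <- (rpow_inv_l (F v - F u) p) by lra. rewrite <- rpow_mul by (easy || apply rpow_ge0).
    apply rpow_le; [lra|]. apply H; lra.
  - apply (lsum_superadd (fun u v => rpow C p * (F v - F u)) s t); [| |easy]; intros; apply Req_le; ring. }
assert (HCp : Cpvar d p z a b).
{ split.
  - intros t Ht eps Heps.
    destruct (rpow_small (2 * C / eps) q) as (eta & Heta & He); [apply Rdiv_le_0_compat; lra|lra|].
    destruct (clock_cont t Ht eta ltac:(lra)) as (del & Hd & Hc).
    exists del. split; [easy|]. intros s Hs Hst. specialize (Hc s Hs Hst). apply Rabs_def2 in Hc.
    assert (HB : C * rpow eta q <= eps / 2).
    { apply Rmult_le_compat_l with (r := eps / 2) in He; [|lra].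
      replace (eps / 2 * (2 * C / eps * rpow eta q)) with (C * rpow eta q) in He by (field; lra). lra. }
    destruct (Rle_lt_dec s t) as [Hle|Hlt].
    + rewrite vnorm_sub_sym. eapply Rle_lt_trans; [apply H; lra|].
      assert (C * rpow (F t - F s) q <= C * rpow eta q); [|lra].
      apply Rmult_le_compat_l; [easy|]. apply rpow_le; lra.
    + eapply Rle_lt_trans; [apply H; lra|].
      assert (C * rpow (F s - F t) q <= C * rpow eta q); [|lra].
      apply Rmult_le_compat_l; [easy|]. apply rpow_le; lra.
  - exists (rpow C p * (F b - F a)). intros v (l & Hl & ->). rewrite pv_sum_lsum.
    apply Hsum; lra || easy. }
split; [easy|]. intros s t Hs Ht. destruct (clock_dominates s t Hs Ht) as (_ & _ & D).
apply rpow_le_le_inv; [lra|now apply (pvar_pow_ge0 d p z a b HCp)|apply Rmult_le_pos; [easy|apply rpow_ge0]|].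
rewrite rpow_mul by (easy || apply rpow_ge0). unfold q. rewrite rpow_inv_l by lra.
apply (pvar_pow_least d p z a b HCp s t); [easy|easy|]. intros l Hl. apply Hsum; lra || easy.
Qed.

(** [I] is a candidate for the indefinite integral: local errors below the increments of [Psi]
    telescope, which is how convergence of Riemann sums will be checked. *)
Lemma RS_sum_close (term : R -> R -> vec) (I : R -> vec) (Psi : R -> R) (eta s t : R) (l : list R) :
  (forall u v, s <= u < v -> v <= t -> v - u < eta ->
     vnorm d (vsub (term u v) (vsub (I v) (I u))) <= Psi v - Psi u) ->
  incr_to s l t -> mesh s l < eta ->
  vnorm d (vsub (RS_sum term s l) (vsub (I t) (I s))) <= Psi t - Psi s.
Proof.
revert s; induction l as [|v l IH]; simpl; intros s H Hl Hm.
- subst. rewrite vnorm_zero; [lra|]. intros; unfold vsub, vzero; ring.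
- destruct Hl as [Hs Hl]. assert (Hv := incr_to_le _ _ _ Hl).
  assert (M1 := Rmax_l (v - s) (mesh v l)). assert (M2 := Rmax_r (v - s) (mesh v l)).
  eapply Rle_trans; [apply (vnorm_add_le d _ (vsub (term s v) (vsub (I v) (I s)))
    (vsub (RS_sum term v l) (vsub (I t) (I v))))|].
  + intros; unfold vsub, vadd; ring.
  + assert (A := H s v ltac:(lra) ltac:(lra) ltac:(lra)).
    assert (B := IH v ltac:(intros; apply H; lra) Hl ltac:(lra)). lra.
Qed.

Lemma clock_unif (eta : R) : 0 < eta -> exists del, 0 < del /\
  forall u v, a <= u < v -> v <= b -> v - u < del -> F v - F u < eta.
Proof.
intros He. destruct (cont_in_unif F a b ltac:(lra) clock_cont eta He) as (del & Hd & H).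
exists del. split; [easy|]. intros u v Hu Hv Huv.
assert (A := H v u ltac:(lra) ltac:(lra) ltac:(rewrite Rabs_pos_eq; lra)).
apply Rabs_def2 in A. lra.
Qed.

(** Along a Hoelder path the drift is continuous, so its coordinates are Riemann integrable. The
    left-point rule errs on [u,v] by at most v - u times the oscillation. *)
Lemma drift_integral (y : R -> vec) (C : R) : 0 <= C ->
  (forall s t, a <= s <= t -> t <= b -> vnorm d (vsub (y t) (y s)) <= C * rpow (F t - F s) q) ->
  exists I : R -> vec, (forall l, I a l = 0) /\ forall u v, a <= u <= v -> v <= b ->
    vnorm d (vsub (vscale (v - u) (hd (y u))) (vsub (I v) (I u))) <= INR d * ((v - u) * (L * (C * rpow (F v - F u) q))).
Proof.
intros HC H. assert (Hq := inv_p_bounds).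
destruct (holder_Cpvar y C HC H) as [[Hyc _] _].
set (phi := fun l u => hd (y (clamp a b u)) l).
assert (Hphi : forall l, (l < d)%nat -> continuity (phi l)).
{ intros l Hl. apply (cont_in_clamp (fun u => hd (y u) l)); [lra|].
  intros t0 H0 eps Heps.
  destruct (Hyc t0 H0 (eps / (L + 1))) as (del & Hd & Hc); [apply Rdiv_lt_0_compat; lra|].
  exists del. split; [easy|]. intros u Hu Hut. specialize (Hc u Hu Hut).
  eapply Rle_lt_trans; [exact (Rabs_le_vnorm d (vsub (hd (y u)) (hd (y t0))) l Hl)|].
  eapply Rle_lt_trans; [apply hhd|].
  assert (V0 := vnorm_ge0 d (vsub (y u) (y t0))).
  apply Rle_lt_trans with ((L + 1) * vnorm d (vsub (y u) (y t0))); [lra|].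
  replace eps with ((L + 1) * (eps / (L + 1))) by (field; lra).
  apply Rmult_lt_compat_l; lra. }
assert (Hex : forall l u v, (l < d)%nat -> ex_RInt (phi l) u v).
{ intros l u v Hl. apply (ex_RInt_continuous (V := R_CompleteNormedModule)). intros z _.
  apply continuity_pt_filterlim. now apply Hphi. }
(* Continuity of [phi l] is available for coordinates l < d only; the others are set to 0, which
   keeps I a l = 0. *)
exists (fun t l => if lt_dec l d then RInt (phi l) a t else 0). split.
{ intros l. destruct (lt_dec l d); [|easy]. apply (RInt_point (V := R_CompleteNormedModule)). }
intros u v Hu Hv. apply vnorm_le_coord. intros l Hl.
unfold vsub at 1 2, vscale. destruct (lt_dec l d) as [_|Hn]; [|lia].
assert (EC : RInt (phi l) a v - RInt (phi l) a u = RInt (phi l) u v).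
{ rewrite <- (RInt_Chasles (phi l) a u v) by now apply Hex. unfold plus; simpl. ring. }
rewrite EC.
assert (Ek : (v - u) * hd (y u) l = RInt (fun _ => hd (y u) l) u v).
{ rewrite RInt_const. unfold scal; simpl. unfold mult; simpl. ring. }
rewrite Ek.
replace (RInt (fun _ => hd (y u) l) u v - RInt (phi l) u v)
  with (RInt (fun z => minus (hd (y u) l) (phi l z)) u v).
2: { rewrite (RInt_minus (V := R_CompleteNormedModule) (fun _ => hd (y u) l) (phi l)); [easy| |now apply Hex].
     apply ex_RInt_const. }
apply abs_RInt_le_const; [lra| |].
- apply (ex_RInt_minus (V := R_NormedModule) (fun _ => hd (y u) l) (phi l)); [apply ex_RInt_const|now apply Hex].
- intros z Hz. unfold minus, plus, opp; simpl. unfold phi. rewrite clamp_id by lra.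
  eapply Rle_trans; [exact (Rabs_le_vnorm d (vsub (hd (y u)) (hd (y z))) l Hl)|].
  eapply Rle_trans; [apply hhd|]. apply Rmult_le_compat_l; [easy|].
  rewrite vnorm_sub_sym. eapply Rle_trans; [apply H; lra|].
  apply Rmult_le_compat_l; [easy|]. apply rpow_le; [lra|].
  destruct (clock_dominates z v) as (_ & _ & D); lra.
Qed.

(** The second integral is defined as y - ya minus the drift integral, so the equation holds by
    construction. What remains is that the sums against x converge to it, which the Davie estimate
    gives. *)
Lemma davie_solves (y : R -> vec) (w C : R) : 0 < w <= 1 -> 0 <= C ->
  vnorm d (vsub (y a) ya) = 0 ->
  (forall t, a <= t <= b -> vnorm d (y t) <= C) ->
  (forall s t, a <= s <= t -> t <= b -> F t - F s <= w ->
    vnorm d (vsub (y t) (y s)) <= C * rpow (F t - F s) q /\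
    vnorm d (davie d m hd g x (y s) (y t) s t) <= C * rpow (F t - F s) (2 * q)) ->
  Cpvar d p y a b /\
  forall t, a <= t <= b -> exists I1 I2,
    is_RS_integral d (fun u s => vscale (s - u) (hd (y u))) a t I1 /\
    is_RS_integral d (fun u s => matvec m (g (y u)) (vsub (x s) (x u))) a t I2 /\
    forall i, (i < d)%nat -> y t i = ya i + I1 i + I2 i.
Proof.
intros Hw HC Ha Hsup Hloc. assert (Hq := inv_p_bounds).
assert (Hwq := rpow_gt0 w q ltac:(lra)).
(* Beyond clock distance w the increment is at most 2C, which is at most (2C/w^q) D^q. *)
set (CH := C + 2 * C / rpow w q).
assert (HCw : 0 <= 2 * C / rpow w q) by (apply Rdiv_le_0_compat; lra).
assert (HCH : 0 <= CH) by (unfold CH; lra).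
assert (Hhol : forall s t, a <= s <= t -> t <= b -> vnorm d (vsub (y t) (y s)) <= CH * rpow (F t - F s) q).
{ intros s t Hs Ht. assert (P0 := rpow_ge0 (F t - F s) q).
  destruct (Rle_lt_dec (F t - F s) w) as [Hle|Hlt].
  - destruct (Hloc s t Hs Ht Hle) as [A _]. eapply Rle_trans; [exact A|].
    apply Rmult_le_compat_r; unfold CH; lra.
  - apply Rle_trans with (2 * C).
    + assert (A := Hsup s ltac:(lra)). assert (B := Hsup t ltac:(lra)).
      eapply Rle_trans; [apply (vnorm_add_le d _ (y t) (vscale (-1) (y s)))|].
      * intros; unfold vsub, vscale; ring.
      * rewrite vnorm_scale, Rabs_left; lra.
    + assert (P1 : rpow w q <= rpow (F t - F s) q) by (apply rpow_le; lra).
      apply Rle_trans with (2 * C / rpow w q * rpow w q); [right; field; lra|].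
      apply Rmult_le_compat; unfold CH; lra. }
destruct (holder_Cpvar y CH HCH Hhol) as [Hy _]. split; [easy|].
destruct (drift_integral y CH HCH Hhol) as (I & HI0 & HI).
assert (HLC : 0 <= L * CH) by now apply Rmult_le_pos.
assert (HdLC : 0 <= INR d * (L * CH)) by (apply Rmult_le_pos; [apply pos_INR|easy]).
intros t Ht. exists (I t), (vsub (vsub (y t) ya) (I t)). split; [|split].
- intros eps Heps.
  destruct (rpow_small (2 * (INR d * (L * CH) * (b - a)) / eps) q) as (eta & Heta & He).
  { apply Rdiv_le_0_compat; [|easy]. assert (0 <= INR d * (L * CH) * (b - a)) by (apply Rmult_le_pos; lra). lra. }
  { lra. }
  destruct (clock_unif eta ltac:(lra)) as (del & Hd & HF).
  exists del. split; [easy|]. intros l Hl Hm.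
  set (k := INR d * (L * CH) * rpow eta q).
  assert (Hk : 0 <= k) by (apply Rmult_le_pos; [easy|apply rpow_ge0]).
  assert (A : vnorm d (vsub (RS_sum (fun u s => vscale (s - u) (hd (y u))) a l) (vsub (I t) (I a))) <= k * t - k * a).
  { apply (RS_sum_close _ I (fun u => k * u) del); [|easy|easy].
    intros u v Hu Hv Huv. eapply Rle_trans; [apply HI; lra|].
    assert (B : rpow (F v - F u) q <= rpow eta q) by (apply rpow_le; [lra|]; assert (B := HF u v ltac:(lra) ltac:(lra) Huv); lra).
    apply Rmult_le_compat_l with (r := INR d * (L * CH) * (v - u)) in B; [|apply Rmult_le_pos; lra].
    unfold k. lra. }
  rewrite (vnorm_ext d _ (vsub (RS_sum (fun u s => vscale (s - u) (hd (y u))) a l) (vsub (I t) (I a))))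
    by (intros; unfold vsub; rewrite HI0; ring).
  eapply Rle_lt_trans; [exact A|].
  apply Rmult_le_compat_l with (r := eps / 2) in He; [|lra].
  replace (eps / 2 * (2 * (INR d * (L * CH) * (b - a)) / eps * rpow eta q)) with (k * (b - a)) in He by (unfold k; field; lra).
  assert (k * (t - a) <= k * (b - a)) by (apply Rmult_le_compat_l; lra). lra.
- intros eps Heps.
  (* C is the Davie constant, the rest is the error of the left-point drift. A local error CT D^(2q)
     is at most CT eta^(2q-1) D, and the increments D sum to at most T. *)
  set (CT := C + INR d * (L * CH)).
  destruct (rpow_small (2 * (CT * T) / eps) (2 * q - 1)) as (eta & Heta & He).
  { apply Rdiv_le_0_compat; [|easy]. assert (A := clock_end_gt0). unfold CT.
    assert (0 <= (C + INR d * (L * CH)) * T) by (apply Rmult_le_pos; lra). lra. }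
  { lra. }
  destruct (clock_unif (Rmin eta w)) as (del & Hd & HF); [apply Rmin_glb_lt; lra|].
  assert (Mi1 := Rmin_l eta w). assert (Mi2 := Rmin_r eta w).
  exists del. split; [easy|]. intros l Hl Hm.
  set (k := CT * rpow eta (2 * q - 1)).
  assert (HCT : 0 <= CT) by (unfold CT; lra).
  assert (Hk : 0 <= k) by (apply Rmult_le_pos; [easy|apply rpow_ge0]).
  set (term := fun u s => matvec m (g (y u)) (vsub (x s) (x u))).
  set (J := fun u => vsub (y u) (I u)).
  assert (A : vnorm d (vsub (RS_sum term a l) (vsub (J t) (J a))) <= k * F t - k * F a).
  { apply (RS_sum_close _ J (fun u => k * F u) del); [|easy|easy].
    intros u v Hu Hv Huv.
    assert (HD := HF u v ltac:(lra) ltac:(lra) Huv).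
    destruct (clock_dominates u v) as (D1 & _ & D2); [lra|lra|].
    destruct (Hloc u v ltac:(lra) ltac:(lra) ltac:(lra)) as [_ HDv].
    assert (HIv := HI u v ltac:(lra) ltac:(lra)).
    set (D := F v - F u) in *.
    eapply Rle_trans; [apply (vnorm_add_le d _ (vscale (-1) (davie d m hd g x (y u) (y v) u v))
      (vscale (-1) (vsub (vscale (v - u) (hd (y u))) (vsub (I v) (I u)))))|].
    { intros i Hi. unfold term, J, vscale. rewrite davie_coord. unfold vsub at 1. rewrite matvec_vsub.
      unfold vsub. ring. }
    rewrite !vnorm_scale. replace (Rabs (-1)) with 1 by (rewrite Rabs_left; lra). rewrite !Rmult_1_l.
    assert (P1 := rpow_ge0 D q). assert (P2 := len_le_pow D ltac:(lra)).
    assert (B1 : INR d * ((v - u) * (L * (CH * rpow D q))) <= INR d * (L * CH) * rpow D (2 * q)).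
    { replace (2 * q) with (q + q) by ring. rewrite rpow_add.
      replace (INR d * ((v - u) * (L * (CH * rpow D q)))) with (INR d * (L * CH) * ((v - u) * rpow D q)) by ring.
      apply Rmult_le_compat_l; [easy|]. apply Rmult_le_compat_r; lra. }
    assert (B2 : rpow D (2 * q) <= rpow eta (2 * q - 1) * D).
    { replace (2 * q) with ((2 * q - 1) + 1) at 1 by ring. rewrite rpow_add, rpow_1 by easy.
      apply Rmult_le_compat_r; [easy|]. apply rpow_le; lra. }
    apply Rmult_le_compat_l with (r := CT) in B2; [|easy].
    unfold k, D in *. unfold CT in *. lra. }
  rewrite (vnorm_ext d _ (vsub (RS_sum term a l) (vsub (J t) (J a)))).
  2: { intros i Hi. unfold J, vsub. rewrite HI0.
       assert (Hyi := vnorm_eq0 d (y a) ya i Hi ltac:(lra)). lra. }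
  eapply Rle_lt_trans; [exact A|].
  apply Rmult_le_compat_l with (r := eps / 2) in He; [|lra].
  replace (eps / 2 * (2 * (CT * T) / eps * rpow eta (2 * q - 1))) with (k * T) in He by (unfold k; field; lra).
  destruct (clock_bounds t Ht) as [_ HT]. rewrite clock_start.
  assert (k * F t <= k * T) by (apply Rmult_le_compat_l; lra). lra.
- intros i Hi. unfold vsub. ring.
Qed.

(** * Uniqueness *)

(** An arbitrary solution is first shown to be Hoelder in clock time, then to have Davie errors of
    order 2q. Sampled on the grid it is a perturbed Euler scheme, so stability ties it to Y^n, and
    hence to y. *)
Lemma solution_unique (y z : R -> vec) (N : nat) (CE : R) : 0 <= CE ->
  (forall n t, (N <= n)%nat -> a <= t <= b -> vnorm d (vsub (y t) (Y n (idx n t))) <= CE * E n) ->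
  Cpvar d p z a b -> vnorm d (vsub (z a) ya) = 0 ->
  (forall s t, a <= s < t -> t <= b -> is_RS_integral d (eqn_term m hd g x z) s t (vsub (z t) (z s))) ->
  forall t, a <= t <= b -> vnorm d (vsub (z t) (y t)) <= 0.
Proof.
intros HCE Hlim Hz Hza HRS. assert (Hq := inv_p_bounds).
set (f0 := vnorm d (hd vzero)). set (G0 := opnorm d m (g vzero)).
assert (Hf0 : 0 <= f0) by apply vnorm_ge0. assert (HG0 : 0 <= G0) by apply opnorm_ge0.
set (Zs := pvar_semi d p z a b). assert (HZs : 0 <= Zs) by apply rpow_ge0.
set (Mz := vnorm d (z a) + Zs).
assert (HMz0 : 0 <= Mz) by (unfold Mz; assert (A := vnorm_ge0 d (z a)); lra).
assert (HMz : forall u, a <= u <= b -> vnorm d (z u) <= Mz).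
{ intros u Hu. apply (vnorm_le_semi d p a b z hp Hz); lra. }
assert (HK := Kc_gt0 p hp).
set (c1 := L * Mz + f0). set (c2 := G0 + Cg * Mz).
assert (HLM : 0 <= L * Mz) by now apply Rmult_le_pos.
assert (HGM : 0 <= Cg * Mz) by now apply Rmult_le_pos.
assert (Hc1 : 0 <= c1) by (unfold c1; lra). assert (Hc2 : 0 <= c2) by (unfold c2; lra).
assert (HT1 := rpow_ge0 T (1 - q)).
(* Drift, first-order term and Young remainder in turn; in the last one the variation of z is
   bounded by its total Zs. The power of T comes from D <= D^q T^(1-q). *)
set (CZ := c1 * rpow T (1 - q) + c2 + Cg * Kc p * Zs).
assert (Hc1T : 0 <= c1 * rpow T (1 - q)) by now apply Rmult_le_pos.
assert (HCK : 0 <= Cg * Kc p) by (apply Rmult_le_pos; lra).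
assert (HCKZ : 0 <= Cg * Kc p * Zs) by now apply Rmult_le_pos.
assert (HCZ : 0 <= CZ) by (unfold CZ; lra).
assert (Hhol : forall s t, a <= s <= t -> t <= b -> vnorm d (vsub (z t) (z s)) <= CZ * rpow (F t - F s) q).
{ intros s t Hs Ht.
  destruct (clock_dominates s t Hs Ht) as (D1 & _ & D2).
  assert (Hx := clock_semi s t Hs Ht). assert (Hxi := clock_inc s t Hs Ht).
  assert (HT : F t - F s <= T).
  { destruct (clock_bounds s ltac:(lra)). destruct (clock_bounds t ltac:(lra)). lra. }
  set (D := F t - F s) in *. assert (P := rpow_ge0 D q).
  destruct (proj2 Hs) as [Hst|<-].
  2: { rewrite vnorm_zero; [now apply Rmult_le_pos|]. intros; unfold vsub; ring. }
  assert (Hyb := young_bound d m p a b Cg hd g x z hp hCg hg hx Hz HRS s t vzero (fun u => c1 * u)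
    ltac:(lra) ltac:(lra)).
  assert (B0 : vnorm d (matvec m (g (z s)) (vsub (x t) (x s))) <= c2 * rpow D q).
  { eapply Rle_trans; [apply matvec_opnorm|]. apply Rmult_le_compat; [apply opnorm_ge0|apply vnorm_ge0| |easy].
    eapply Rle_trans; [apply (g_growth d m Cg g hg)|]. apply Rplus_le_compat_l, Rmult_le_compat_l; [easy|].
    apply HMz; lra. }
  assert (B1 : t - s <= rpow D q * rpow T (1 - q)).
  { apply Rle_trans with D; [easy|]. rewrite <- (rpow_1 D) at 1 by easy.
    replace 1 with (q + (1 - q)) at 1 by ring. rewrite rpow_add. apply Rmult_le_compat_l; [easy|]. apply rpow_le; lra. }
  apply Rmult_le_compat_l with (r := c1) in B1; [|easy].
  assert (B2 : pvar_semi d p z s t * pvar_semi m p x s t <= Zs * rpow D q).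
  { apply Rmult_le_compat; [apply rpow_ge0|apply rpow_ge0| |easy]. apply (semi_mono d p z a b); lra || easy. }
  apply Rmult_le_compat_l with (r := Cg * Kc p) in B2; [|easy].
  eapply Rle_trans; [apply (vnorm_add_le d _ (vsub (vsub (z t) (z s)) (vadd (vscale (t - s) vzero)
    (matvec m (g (z s)) (vsub (x t) (x s))))) (matvec m (g (z s)) (vsub (x t) (x s))))|].
  { intros l _. unfold vsub at 1 2 3, vadd, vscale, vzero. ring. }
  eapply Rle_trans; [apply Rplus_le_compat; [apply Hyb|exact B0]|].
  - intros u v Hu Hv. rewrite (vnorm_ext d _ (hd (z u))) by (intros; unfold vsub, vzero; ring).
    assert (A : vnorm d (hd (z u)) <= c1).
    { eapply Rle_trans; [apply hd_growth|]. apply Rplus_le_compat_r, Rmult_le_compat_l; [easy|]. apply HMz; lra. }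
    apply Rmult_le_compat_r with (r := v - u) in A; lra.
  - unfold CZ. lra. }
destruct (holder_Cpvar z CZ HCZ Hhol) as [_ Hsemi].
set (CD := (L + Cg * Kc p) * CZ).
assert (HCD : 0 <= CD) by (apply Rmult_le_pos; lra).
assert (Hdav : forall s t, a <= s <= t -> t <= b -> F t - F s <= 1 ->
  vnorm d (davie d m hd g x (z s) (z t) s t) <= CD * rpow (F t - F s) (2 * q)).
{ intros s t Hs Ht HD1.
  destruct (clock_dominates s t Hs Ht) as (D1 & _ & D2).
  assert (Hx := clock_semi s t Hs Ht). assert (Hzs := Hsemi s t Hs Ht).
  assert (Hdom : forall u, s <= u <= t -> F u - F s <= F t - F s).
  { intros u Hu. destruct (clock_dominates u t) as (_ & _ & D); lra. }
  set (D := F t - F s) in *. assert (P := rpow_ge0 D q).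
  destruct (proj2 Hs) as [Hst|<-].
  2: { rewrite vnorm_zero; [apply Rmult_le_pos; [easy|apply rpow_ge0]|]. intros l _. rewrite davie_coord. ring. }
  (* Second use of the Young bound, now around the drift at z_s. With the Hoelder bound available,
     the drift oscillation and the variation of z each supply a factor D^q. *)
  assert (Hyb := young_bound d m p a b Cg hd g x z hp hCg hg hx Hz HRS s t (hd (z s))
    (fun u => L * (CZ * rpow D q) * u) ltac:(lra) ltac:(lra)).
  assert (E2 : rpow D (2 * q) = rpow D q * rpow D q) by (rewrite <- rpow_add; f_equal; ring).
  rewrite E2.
  assert (B2 : pvar_semi d p z s t * pvar_semi m p x s t <= CZ * rpow D q * rpow D q).
  { apply Rmult_le_compat; try apply rpow_ge0; easy. }
  apply Rmult_le_compat_l with (r := Cg * Kc p) in B2; [|easy].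
  assert (B1 : L * (CZ * rpow D q) * (t - s) <= L * (CZ * rpow D q) * rpow D q).
  { apply Rmult_le_compat_l; [repeat apply Rmult_le_pos; easy|]. assert (A := len_le_pow D ltac:(lra)). lra. }
  eapply Rle_trans; [apply Hyb|].
  - intros u v Hu Hv.
    assert (A : vnorm d (vsub (hd (z u)) (hd (z s))) <= L * (CZ * rpow D q)).
    { eapply Rle_trans; [apply hhd|]. apply Rmult_le_compat_l; [easy|].
      eapply Rle_trans; [apply Hhol; lra|]. apply Rmult_le_compat_l; [easy|].
      apply rpow_le; [lra|]. apply Hdom; lra. }
    apply Rmult_le_compat_r with (r := v - u) in A; lra.
  - unfold CD. lra. }
(* Level 0 has step T, so the Hoelder bound is offered for all pairs of grid points. *)
destruct (euler_stability CZ 0 HCZ) as (n0 & CS & HCS & HS).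
destruct (level_small T 1 clock_end_gt0 ltac:(lra)) as [n2 Hn2].
intros t Ht.
set (Cf := CZ + CS * CD + CE).
assert (HSD : 0 <= CS * CD) by now apply Rmult_le_pos.
apply (le_of_rate _ 0 Cf (Nat.max N (Nat.max n0 n2))); [unfold Cf; lra|].
intros n Hn. assert (Hh := grid_step_gt0 n). assert (E0 := rate_gt0 n).
assert (Hh1 : h n <= 1) by (apply Hn2; lia).
destruct (grid_index_spec n t Ht) as [Hi Hi'].
assert (HGF : forall i j, (i <= j <= 2 ^ n)%nat -> F (tau n j) - F (tau n i) = (INR j - INR i) * h n).
{ intros i j Hij. destruct (grid_spec n i ltac:(lia)) as [_ ->]. destruct (grid_spec n j ltac:(lia)) as [_ ->]. ring. }
assert (HGO : forall i j, (i <= j <= 2 ^ n)%nat -> a <= tau n i <= tau n j /\ tau n j <= b).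
{ intros i j Hij. assert (A := grid_mono n i j Hij). destruct (grid_spec n i ltac:(lia)) as [A1 _].
  destruct (grid_spec n j ltac:(lia)) as [A2 _]. lra. }
assert (HZ : vnorm d (vsub (z (tau n (idx n t))) (Y n (idx n t))) <= CS * (vnorm d (vsub (z (tau n 0)) ya) + CD * E n)).
{ apply (HS n (fun i => z (tau n i)) (fun k => davie d m hd g x (z (tau n k)) (z (tau n (S k))) (tau n k) (tau n (S k))));
    [lia|apply Rmult_le_pos; lra| | | |easy].
  - intros k l Hk Hl. rewrite davie_coord, matvec_vsub. ring.
  - intros k Hk. destruct (HGO k (S k) ltac:(lia)) as [A1 A2].
    assert (A3 := HGF k (S k) ltac:(lia)). rewrite S_INR in A3.
    replace ((INR k + 1 - INR k) * h n) with (h n) in A3 by ring.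
    eapply Rle_trans; [apply Hdav; lra|]. rewrite A3, Rmult_assoc. apply Rmult_le_compat_l; [easy|].
    right. unfold rate. fold q. transitivity (rpow (h n) (2 * q - 1) * rpow (h n) 1); [|rewrite rpow_1; lra].
    rewrite <- rpow_add. f_equal. ring.
  - intros i j Hij _. destruct (HGO i j Hij) as [A1 A2]. rewrite <- HGF by easy. now apply Hhol. }
rewrite grid_start, Hza, Rplus_0_l in HZ.
assert (HL := Hlim n t ltac:(lia) Ht).
destruct (grid_spec n _ Hi') as [G1 G2].
destruct (grid_index_close n t Ht) as [G3 _].
assert (HX : vnorm d (vsub (z t) (z (tau n (idx n t)))) <= CZ * E n).
{ eapply Rle_trans; [apply Hhol; lra|]. apply Rmult_le_compat_l; [easy|].
  apply Rle_trans with (rpow (h n) q); [apply rpow_le; lra|]. apply grid_step_le_rate; lra. }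
eapply Rle_trans; [apply (vnorm_add3_le d _ (vsub (z t) (z (tau n (idx n t))))
  (vsub (z (tau n (idx n t))) (Y n (idx n t))) (vsub (Y n (idx n t)) (y t)))|].
{ intros; unfold vsub; ring. }
rewrite (vnorm_sub_sym d (Y n (idx n t))). unfold Cf. lra.
Qed.

End Euler.

(** ** Second order differences of a field with Lipschitz derivative *)

Section FourPoint.

Context (d m : nat) (g : vec -> mat) (Dg : vec -> vec -> mat) (Cg CD : R).
Context (hCg : 0 <= Cg) (hg : lipschitz_m d m g Cg).
Context (hlin : forall u h k c i j, (i < d)%nat -> (j < m)%nat ->
        Dg u (vadd (vscale c h) k) i j = c * Dg u h i j + Dg u k i j).
Context (hfre : forall u eps, 0 < eps -> exists delta, 0 < delta /\ forall h,
        vnorm d h < delta ->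
        opnorm d m (msub (msub (g (vadd u h)) (g u)) (Dg u h)) <= eps * vnorm d h).
Context (hlip : forall u v h, opnorm d m (msub (Dg u h) (Dg v h)) <= CD * vnorm d (vsub u v) * vnorm d h).
Context (i j : nat) (hi : (i < d)%nat) (hj : (j < m)%nat).

Lemma Dg_scale (u h : vec) (c : R) : Dg u (vscale c h) i j = c * Dg u h i j.
Proof.
assert (E0 : Dg u vzero i j = 0).
{ assert (E := hlin u vzero vzero 1 i j hi hj).
  replace (vadd (vscale 1 vzero) vzero) with vzero in E
    by (extensionality k; unfold vadd, vscale, vzero; ring). lra. }
assert (E := hlin u h vzero c i j hi hj).
replace (vadd (vscale c h) vzero) with (vscale c h) in E
  by (extensionality k; unfold vadd, vscale, vzero; ring). lra.
Qed.

Lemma Dg_increment (u w : vec) (eps : R) : 0 < eps -> exists del, 0 < del /\ forall h, Rabs h < del ->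
  Rabs (g (vadd u (vscale h w)) i j - g u i j - h * Dg u w i j) <= eps * Rabs h.
Proof.
intros He. assert (Hw := vnorm_ge0 d w).
(* The added 1 covers the direction w = 0. *)
destruct (hfre u (eps / (vnorm d w + 1))) as (del & Hd & H); [apply Rdiv_lt_0_compat; lra|].
exists (del / (vnorm d w + 1)). split; [apply Rdiv_lt_0_compat; lra|]. intros h Hh.
assert (Hh0 := Rabs_pos h).
assert (Hn : vnorm d (vscale h w) < del).
{ rewrite vnorm_scale. apply Rle_lt_trans with (Rabs h * (vnorm d w + 1)).
  - apply Rmult_le_compat_l; lra.
  - apply Rmult_lt_compat_r with (r := vnorm d w + 1) in Hh; [|lra].
    replace (del / (vnorm d w + 1) * (vnorm d w + 1)) with del in Hh by (field; lra). easy. }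
specialize (H _ Hn). rewrite <- Dg_scale.
eapply Rle_trans; [exact (Rabs_le_opnorm d m (msub (msub (g (vadd u (vscale h w))) (g u)) (Dg u (vscale h w))) i j hi hj)|].
eapply Rle_trans; [exact H|]. rewrite vnorm_scale.
apply Rle_trans with (eps / (vnorm d w + 1) * (Rabs h * (vnorm d w + 1))).
- apply Rmult_le_compat_l; [apply Rdiv_le_0_compat; lra|]. apply Rmult_le_compat_l; lra.
- right. field; lra.
Qed.

(** A difference quotient of g in the direction w is bounded by Cg |w| and differs from the
    derivative by at most eps. *)
Lemma Dg_bound (u w : vec) : Rabs (Dg u w i j) <= Cg * vnorm d w.
Proof.
apply Rle_plus_epsilon. intros eps He.
destruct (Dg_increment u w eps He) as (del & Hd & H).
specialize (H (del / 2)). rewrite (Rabs_pos_eq (del / 2)) in H by lra. specialize (H ltac:(lra)).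
assert (A : Rabs (g (vadd u (vscale (del / 2) w)) i j - g u i j) <= Cg * (del / 2 * vnorm d w)).
{ eapply Rle_trans; [exact (Rabs_le_opnorm d m (msub (g (vadd u (vscale (del / 2) w))) (g u)) i j hi hj)|].
  eapply Rle_trans; [apply hg|]. apply Rmult_le_compat_l; [easy|].
  rewrite (vnorm_ext d _ (vscale (del / 2) w)) by (intros; unfold vsub, vadd; ring).
  rewrite vnorm_scale, Rabs_pos_eq; lra. }
assert (B : Rabs (del / 2 * Dg u w i j) <= Cg * (del / 2 * vnorm d w) + eps * (del / 2)).
{ replace (del / 2 * Dg u w i j) with ((g (vadd u (vscale (del / 2) w)) i j - g u i j)
    + - (g (vadd u (vscale (del / 2) w)) i j - g u i j - del / 2 * Dg u w i j)) by ring.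
  eapply Rle_trans; [apply Rabs_triang|]. rewrite Rabs_Ropp. lra. }
rewrite Rabs_mult, (Rabs_pos_eq (del / 2)) in B by lra.
apply Rmult_le_reg_l with (del / 2); [lra|]. lra.
Qed.

Lemma Dg_line (v w : vec) (s : R) :
  derivable_pt_lim (fun s => g (vadd v (vscale s w)) i j) s (Dg (vadd v (vscale s w)) w i j).
Proof.
intros eps He.
destruct (Dg_increment (vadd v (vscale s w)) w (eps / 2)) as (del & Hd & H); [lra|].
exists (mkposreal del Hd). intros h Hh0 Hh. simpl in Hh. specialize (H h Hh).
replace (vadd (vadd v (vscale s w)) (vscale h w)) with (vadd v (vscale (s + h) w)) in H
  by (extensionality k; unfold vadd, vscale; ring).
assert (Ha := Rabs_pos_lt h Hh0).
apply Rmult_lt_reg_r with (Rabs h); [easy|]. rewrite <- Rabs_mult.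
replace (((g (vadd v (vscale (s + h) w)) i j - g (vadd v (vscale s w)) i j) / h - Dg (vadd v (vscale s w)) w i j) * h)
  with (g (vadd v (vscale (s + h) w)) i j - g (vadd v (vscale s w)) i j - h * Dg (vadd v (vscale s w)) w i j)
  by (field; easy).
eapply Rle_lt_trans; [exact H|]. apply Rmult_lt_compat_r; lra.
Qed.

(** The mean value theorem, applied entrywise to the difference of g along the segments from v to u
    and from v' to u'. The derivative splits as Dg P (w - w') + (Dg P - Dg Q) w', and P - Q is a
    convex combination of u - u' and v - v'. No sign is assumed for CD, hence its absolute value. *)
Lemma four_point_entry (u v u' v' : vec) :
  Rabs (g u i j - g v i j - (g u' i j - g v' i j))
  <= Cg * vnorm d (vsub (vsub u v) (vsub u' v'))
     + Rabs CD * (vnorm d (vsub u' v') * (vnorm d (vsub u u') + vnorm d (vsub v v'))).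
Proof.
set (w := vsub u v). set (w' := vsub u' v').
set (phi := fun s => g (vadd v (vscale s w)) i j - g (vadd v' (vscale s w')) i j).
destruct (MVT_cor2 phi (fun s => Dg (vadd v (vscale s w)) w i j - Dg (vadd v' (vscale s w')) w' i j) 0 1) as (s & Hs & Hs01).
- lra.
- intros s _. apply derivable_pt_lim_minus; apply Dg_line.
- assert (E1 : phi 1 = g u i j - g u' i j).
  { unfold phi. do 2 f_equal; [f_equal|f_equal; f_equal]; extensionality k; unfold w, w', vadd, vscale, vsub; ring. }
  assert (E0 : phi 0 = g v i j - g v' i j).
  { unfold phi. do 2 f_equal; [f_equal|f_equal; f_equal]; extensionality k; unfold w, w', vadd, vscale, vsub; ring. }
  set (P := vadd v (vscale s w)) in *. set (Q := vadd v' (vscale s w')) in *.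
  assert (EP : Dg P w i j = Dg P (vsub w w') i j + Dg P w' i j).
  { assert (A := hlin P (vsub w w') w' 1 i j hi hj). rewrite Rmult_1_l in A. rewrite <- A.
    f_equal. f_equal. extensionality k. unfold vadd, vscale, vsub. ring. }
  replace (g u i j - g v i j - (g u' i j - g v' i j)) with (Dg P (vsub w w') i j + (Dg P w' i j - Dg Q w' i j)) by lra.
  eapply Rle_trans; [apply Rabs_triang|]. apply Rplus_le_compat; [apply Dg_bound|].
  eapply Rle_trans; [exact (Rabs_le_opnorm d m (msub (Dg P w') (Dg Q w')) i j hi hj)|].
  eapply Rle_trans; [apply hlip|].
  assert (HPQ : vnorm d (vsub P Q) <= vnorm d (vsub u u') + vnorm d (vsub v v')).
  { eapply Rle_trans; [apply (vnorm_add_le d _ (vscale s (vsub u u')) (vscale (1 - s) (vsub v v')))|].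
    - intros k _. unfold P, Q, w, w', vadd, vscale, vsub. ring.
    - rewrite !vnorm_scale, !Rabs_pos_eq by lra.
      assert (A := vnorm_ge0 d (vsub u u')). assert (B := vnorm_ge0 d (vsub v v')). nra. }
  assert (H0 := vnorm_ge0 d (vsub P Q)). assert (H1 := vnorm_ge0 d w').
  apply Rle_trans with (Rabs CD * vnorm d (vsub P Q) * vnorm d w').
  + apply Rmult_le_compat_r; [easy|]. apply Rmult_le_compat_r; [easy|apply Rle_abs].
  + replace (Rabs CD * vnorm d (vsub P Q) * vnorm d w') with (Rabs CD * (vnorm d w' * vnorm d (vsub P Q))) by ring.
    apply Rmult_le_compat_l; [apply Rabs_pos|]. now apply Rmult_le_compat_l.
Qed.

End FourPoint.

(** With u, v the values of two schemes at one time and u', v' those at another, this bounds the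
    increments of g(Z) - g(Y), as [euler_stability] requires. *)
Lemma four_point (d m : nat) (g : vec -> mat) (Cg : R) : 0 <= Cg -> lipschitz_m d m g Cg ->
  C1_Dg_lipschitz d m g -> exists C4, 0 <= C4 /\
  forall u v u' v', opnorm d m (msub (msub (g u) (g v)) (msub (g u') (g v')))
  <= C4 * (vnorm d (vsub (vsub u v) (vsub u' v'))
     + vnorm d (vsub u' v') * (vnorm d (vsub u u') + vnorm d (vsub v v'))).
Proof.
intros hCg hg (Dg & CD & hlin & hfre & hlip).
assert (HD := Rabs_pos CD).
exists (INR d * (INR m * (Cg + Rabs CD))). split.
{ repeat apply Rmult_le_pos; try apply pos_INR; lra. }
intros u v u' v'. rewrite !Rmult_assoc. apply opnorm_le_entries. intros i j Hi Hj.
eapply Rle_trans; [exact (four_point_entry d m g Dg Cg CD hCg hg hlin hfre hlip i j Hi Hj u v u' v')|].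
set (X := vnorm d (vsub (vsub u v) (vsub u' v'))).
set (Z := vnorm d (vsub u' v') * (vnorm d (vsub u u') + vnorm d (vsub v v'))).
assert (HX : 0 <= X) by apply vnorm_ge0.
assert (HZ : 0 <= Z).
{ apply Rmult_le_pos; [apply vnorm_ge0|]. assert (A := vnorm_ge0 d (vsub u u')). assert (B := vnorm_ge0 d (vsub v v')). lra. }
assert (0 <= Cg * Z) by now apply Rmult_le_pos. assert (0 <= Rabs CD * X) by now apply Rmult_le_pos. lra.
Qed.

(** ** The Young differential equation *)

(** On [a,a] the empty list is a partition with sum zero, so both integrals vanish. *)
Lemma is_solution_start (d m : nat) (p : R) (A : mat) (f : vec -> vec) (g : vec -> mat)
    (x : R -> vec) (a b : R) (ya : vec) (z : R -> vec) :
  a <= b -> is_solution d m p A f g x a b ya z -> vnorm d (vsub (z a) ya) = 0.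
Proof.
intros hab [_ H]. destruct (H a ltac:(lra)) as (I1 & I2 & H1 & H2 & E).
assert (Z : forall term I, is_RS_integral d term a a I -> vnorm d I <= 0).
{ intros term I HI. apply Rle_plus_epsilon. intros eps He. destruct (HI eps He) as (del & Hd & HI').
  assert (B := HI' nil eq_refl Hd). simpl in B.
  rewrite (vnorm_ext d _ (vscale (-1) I)) in B by (intros; unfold vsub, vscale, vzero; ring).
  rewrite vnorm_scale, Rabs_left in B; lra. }
assert (Z1 := Z _ _ H1). assert (Z2 := Z _ _ H2).
apply Rle_antisym; [|apply vnorm_ge0].
eapply Rle_trans; [apply (vnorm_add_le d _ I1 I2)|lra].
intros i Hi. unfold vsub. rewrite (E i Hi). ring.
Qed.

Theorem theorem2p3 (d m : nat) (p : R) (A : mat) (f : vec -> vec) (g : vec -> mat)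
    (Cf Cg a b : R) (x : R -> vec) (ya : vec) :
  (1 <= d)%nat -> (1 <= m)%nat -> 1 < p < 2 ->
  H2 d m A f g Cf Cg -> 0 < Lc d A Cf ->
  0 <= a < b -> Cpvar m p x a b ->
  exists y : R -> vec,
    is_solution d m p A f g x a b ya y /\
    (forall z, is_solution d m p A f g x a b ya z ->
       forall t, a <= t <= b -> forall i, (i < d)%nat -> z t i = y t i) /\
    let N := INR (N_greedy m p Cg x a b) in
    let B := (vnorm d ya + M0c d m p A f g Cf Cg * N)
             * exp (alphac p * N + 2 * Lc d A Cf * (b - a)) in
    sup_norm d y a b <= B /\
    pvar_norm d p y a b <= B * rpow N ((p - 1) / p).
Proof.
intros _ _ hp (hCf & hCg & hf & hg & hC1) hL hab hx.
(* Linear part and f form one drift, Lipschitz with constant L = |A| + C_f; its growth constant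
   |f(0)| is the numerator in M_0. *)
set (hd := fun u => vadd (matvec d A u) (f u)).
set (L := Lc d A Cf) in *.
assert (hhd : lipschitz_v d hd L).
{ intros u v. eapply Rle_trans; [apply (vnorm_add_le d _ (matvec d A (vsub u v)) (vsub (f u) (f v)))|].
  - intros i _. rewrite matvec_vsub. unfold hd, vsub, vadd. ring.
  - assert (B := matvec_opnorm d d A (vsub u v)). assert (C := hf u v). unfold L, Lc. lra. }
assert (hgr : forall u, vnorm d (hd u) <= L * vnorm d u + vnorm d (f vzero)).
{ intros u. eapply Rle_trans; [apply (vnorm_add3_le d _ (matvec d A u) (vsub (f u) (f vzero)) (f vzero))|].
  - intros i _. unfold hd, vsub, vadd. ring.
  - assert (B := matvec_opnorm d d A u). assert (C := hf u vzero).
    rewrite (vnorm_ext d (vsub u vzero) u) in C by (intros; unfold vsub, vzero; ring). unfold L, Lc. lra. }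
destruct (four_point d m g Cg ltac:(lra) hg hC1) as (C4 & hC4 & hfour).
destruct (euler_limit d m p a b L Cg C4 hd g x ya hp ltac:(lra) ltac:(lra) ltac:(lra) hC4 hhd hg hx hfour)
  as (y & N0 & CE & hCE & hlim).
assert (Hya := limit_start d m p a b hd g x ya hp ltac:(lra) hx y N0 CE hCE hlim).
destruct (limit_davie d m p a b L Cg hd g x ya hp ltac:(lra) ltac:(lra) ltac:(lra) hhd hg hx y N0 CE hCE hlim)
  as (w & C & hw & hC & hsup & hloc).
assert (Hsol : is_solution d m p A f g x a b ya y).
{ apply (davie_solves d m p a b L hd g x ya hp ltac:(lra) ltac:(lra) hhd hx y w C hw hC Hya hsup hloc). }
exists y. split; [exact Hsol|]. split.
- intros z Hz t Ht i Hi. apply (vnorm_eq0 d _ _ i Hi).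
  apply (solution_unique d m p a b L Cg C4 hd g x ya hp ltac:(lra) ltac:(lra) ltac:(lra) hC4 hhd hg hx hfour
    y z N0 CE hCE hlim); [apply Hz|now apply (is_solution_start d m p A f g x a b); lra || easy| |easy].
  intros s u Hs Hu. now apply (is_solution_RS d m p A f g x a b ya).
(* The a priori bound involves y at a, which is known to agree with [ya] in the coordinates below d;
   the norm sees only those. *)
- replace (vnorm d ya) with (vnorm d (y a)).
  2: { apply vnorm_ext. intros i Hi. apply (vnorm_eq0 d _ _ i Hi). lra. }
  apply (apriori_final d m p a b L (vnorm d (f vzero)) Cg hd g x y hp ltac:(lra) hL hCg hg hgr hx (proj1 Hsol)).
  intros s u Hs Hu. now apply (is_solution_RS d m p A f g x a b ya).
Qed.
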